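(* Let $G(z)=\sum_{j=1}^n\frac{R_j}{z-\lambda_j}$ be the true system and $\check G(z)=\sum_{k=1}^n\frac{\check R_k}{z-\mu_k}$ the surrogate system described in the context, and let $\mathbb P_0$ and $\mathbb P_1$ be the conditional distributions of $\{y_t\}_{t=1}^N$ given $\{u_t\}_{t=0}^{N-1}$ when the data $\{y_t,u_{t-1}\}_{t=1}^N$ are from $G$ (hypothesis $\mathcal H_0$) and from $\check G$ (hypothesis $\mathcal H_1$), respectively. Then the expected KL divergence (expectation with respect to the persistently exciting input $u_t$) satisfies $$\mathbb E\,D_{\mathrm{KL}}(\mathbb P_0\|\mathbb P_1)\le\frac{\bar R^2\,\|\mathcal R^{-1}\|\,\mathrm{ess}\sup_\omega\|\Phi_u(\omega)\|}{2(1-\rho_\lambda^2)}\,\tau_n(\mathcal D)^{2n}N,$$ where $\rho_\lambda=\max_j|\lambda_j|$ is the spectral radius of the true system $G$, $\mathcal R$ is the covariance matrix of the noise, $\bar R=\sum_{j=1}^n\|R_j\|$, and $\tau_n(\mathcal D)$ is the finite hyperbolic Chebyshev constant of $\mathcal D$. Moreover, given a constant $\delta>0$, in order to distinguish the two hypotheses with the KL divergence no smaller than $\delta$, $N$ satisfies $$N\ge\frac{2\delta(1-\rho_\lambda^2)}{\bar R^2\,\|\mathcal R^{-1}\|\,\mathrm{ess}\sup_\omega\|\Phi_u(\omega)\|}\,\tau_n(\mathcal D)^{-2n}.$$ When the system dimension $n$ tends to infinity, $$\liminf_{n\to\infty}N^{1/(2n)}\ge\tau(\mathcal D)^{-1},$$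 where $\tau(\mathcal D)$ is the hyperbolic Chebyshev constant of $\mathcal D$.
   Context: **System.** A stable discrete-time LTI system with $m$ inputs and $p$ outputs, $y_t=G(z)u_t+H(z)e_t=G(z)u_t+v_t$, where $z$ is the time-shift operator, $\{u_t\}$ is a quasistationary signal and $\{e_t\}$ is i.i.d. with zero mean and unit covariance. $\mathbb D=\{z\in\mathbb C:|z|<1\}$. **Assumptions.** (i) $G$ and $H$ are strictly stable (all poles in $\mathbb D$) and $G$ has relative degree at least $1$. (ii) The system is controlled by a linear controller $u_t=G_u(z)y_t+H_u(z)\epsilon_t$ with $\{\epsilon_t\}$ i.i.d., zero mean, unit covariance, mutually independent with $\{e_t\}$; the closed loop is stable; $G_u,H_u$ and the realization of $\epsilon_t$ are known. (iii) $H_u(z)\epsilon_t$ is persistently exciting of sufficiently high order. (iv) $G$ has no repeated poles and its poles lie in a known closed continuum (compact connected set) $\mathcal D\subset\mathbb D$; hence $G(z)=\sum_{j=1}^n\frac{R_j}{z-\lambda_j}$ with distinct $\lambda_j\in\mathcal D$, $R_j\in\mathbb C^{p\times m}$. (v) The noise $\{v_t\}$ is i.i.d. Gaussian, $v_t\sim\mathcal N(0,\mathcal R)$ with $\mathcal R\succ0$. (vi) Samples are collected starting from time $0$, and the inputs from time $-\infty$ to $-1$ are kept at $0$. (vii) The input is a stationary process with bounded power spectral density: $\mathrm{ess}\sup_\omega\|\Phi_u(\omega)\|<\infty$, where $\Phi_u(\omega)=\sum_{k=-\infty}^\infty R_u(k)e^{ik\omega}$, $R_u(k)=\bar{\mathbb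 E}(u_tu_{t-k}^H)$, $\bar{\mathbb E}(X_t)=\lim_{t\to\infty}\mathbb E(X_t)$. **Surrogate system.** $\check G(z)=\sum_{k=1}^n\frac{\check R_k}{z-\mu_k}$, where $\mu_1,\dots,\mu_n$ is a minimizer of $\min_{\mu_1,\dots,\mu_n\in\mathcal D}\max_{\lambda\in\partial\mathcal D}\prod_{k=1}^n[\lambda,\mu_k]_{\mathrm h}$ and then $\check R_1,\dots,\check R_n$ minimize $\big\|G(z)-\sum_{k=1}^n\frac{\check R_k}{z-\mu_k}\big\|_2$ over $\mathbb C^{p\times m}$. Data ''from $\check G$'' means that $G$ is replaced by $\check G$ in the output equation, with the same noise law. **Notation.** $\|\cdot\|$ is the Frobenius norm for matrices; $\|F\|_2^2=\frac1{2\pi}\int_{-\pi}^{\pi}\mathrm{tr}(F(e^{i\omega})F(e^{i\omega})^H)\,d\omega$; $[z,\mu]_{\mathrm h}=\left|\frac{z-\mu}{1-\bar\mu z}\right|$; $$\tau_q(\mathcal D)=\min_{\mu_1,\dots,\mu_q\in\mathcal D}\max_{z\in\mathcal D}\Big(\prod_{k=1}^q[z,\mu_k]_{\mathrm h}\Big)^{1/q},\qquad\tau(\mathcal D)=\lim_{q\to\infty}\tau_q(\mathcal D).$$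
   Formalization: Repeated minimizing nodes μ_k contribute successive powers 1/(z−μ_k)^j to the surrogate; signals and the impulse responses of G and Ǧ are real; as n→∞, R̄, ‖R^{-1}‖ and ess sup‖Φ_u‖ are assumed bounded. Without these the English claim fails. *)

(* Defs.v *)
From HB Require Import structures.
From mathcomp Require Import all_boot all_order all_algebra complex.
From mathcomp Require Import all_classical all_reals all_analysis.
From mathcomp Require Import measurable_realfun ess_sup_inf.

Set Implicit Arguments.
Unset Strict Implicit.
Unset Printing Implicit Defensive.

Import Order.TTheory GRing.Theory Num.Theory.
Import numFieldNormedType.Exports.

Local Open Scope classical_set_scope.
Local Open Scope ring_scope.

(* The complex plane, R[i]^o being R[i] with its norm topology. *)
Notation CC R := (complex (Real.sort R))^o.

Section norms.
Context {R : realType}.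

Definition cabs (z : CC R) : R := Normc.normc z.

Definition toC (x : R) : CC R := real_complex R x.

Definition expi (w : R) : CC R := Complex (cos w) (sin w).

Definition frob (a b : nat) (A : 'M[R]_(a, b)) : R :=
  Num.sqrt (\sum_i \sum_j A i j ^+ 2).

Definition frobC (a b : nat) (A : 'M[CC R]_(a, b)) : R :=
  Num.sqrt (\sum_i \sum_j cabs (A i j) ^+ 2).

Definition hermitian_tr (a b : nat) (A : 'M[CC R]_(a, b)) : 'M[CC R]_(b, a) :=
  map_mx (@conjc R) A^T.

Definition h2norm_sq (a b : nat) (F : CC R -> 'M[CC R]_(a, b)) : R :=
  (2 * pi)^-1 * \int[lebesgue_measure]_(w in `[- pi, pi])
    complex.Re (\tr (F (expi w) *m hermitian_tr (F (expi w)))).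

Definition pos_def (k : nat) (S : 'M[R]_k) : Prop :=
  S^T = S /\ forall x : 'cV[R]_k, x != 0 -> 0 < (x^T *m S *m x) 0 0.

End norms.

Section chebyshev.
Context {R : realType}.
Implicit Types D : set (CC R).

Definition hyp_dist (z mu : CC R) : R :=
  cabs ((z - mu) / (1 - conjc mu * z)).

Definition hyp_prod (q : nat) (mu : 'I_q -> CC R) (z : CC R) : R :=
  \prod_(k < q) hyp_dist z (mu k).

Definition bdry D : set (CC R) := closure D `\` interior D.

Definition cheb (q : nat) D : R :=
  inf [set sup [set hyp_prod mu z `^ q%:R^-1 | z in D]
      | mu in [set mu : 'I_q -> CC R | forall k, D (mu k)]].

Definition cheb_lim D : R := limn (fun q => cheb q D).

Definition cheb_minimizer D (q : nat) (mu : 'I_q -> CC R) : Prop :=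
  (forall k, D (mu k)) /\
  forall nu : 'I_q -> CC R, (forall k, D (nu k)) ->
    sup [set hyp_prod mu z | z in bdry D] <=
    sup [set hyp_prod nu z | z in bdry D].

End chebyshev.

Section systems.
Context {R : realType} (p m : nat).

(* The number of i <= k with lam i = lam k: it is 1 for every k when the poles
   are distinct. *)
Definition pole_order (n : nat) (lam : 'I_n -> CC R) (k : 'I_n) : nat :=
  #|[set i : 'I_n | (i <= k)%N & lam i == lam k]|.

(* z |-> \sum_k A_k / (z - lam_k); a pole that is listed several times
   contributes the successive powers of 1 / (z - lam_k).  The true system has
   distinct poles.  The minimizing nodes of the surrogate need not be distinct:
   for a disc centred at 0 they are all 0, and simple fractions alone would then
   span a space too small for the bound to hold. *)
Definition partial_fractions (n : nat) (lam : 'I_n -> CC R)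
    (A : 'I_n -> 'M[CC R]_(p, m)) (z : CC R) : 'M[CC R]_(p, m) :=
  \sum_(k < n) ((z - lam k) ^+ pole_order lam k)^-1 *: A k.

Definition best_residues (n : nat) (G : CC R -> 'M[CC R]_(p, m))
    (mu : 'I_n -> CC R) (A : 'I_n -> 'M[CC R]_(p, m)) : Prop :=
  forall B : 'I_n -> 'M[CC R]_(p, m),
    h2norm_sq (fun z => G z - partial_fractions mu A z) <=
    h2norm_sq (fun z => G z - partial_fractions mu B z).

(* F(z) = \sum_k g_k z^-k.  As g is real, this also says that F is the transfer
   function of a real system. *)
Definition impulse_response (F : CC R -> 'M[CC R]_(p, m))
    (g : nat -> 'M[R]_(p, m)) : Prop :=
  forall z : CC R, 1 <= cabs z -> forall i j,
    (fun K : nat => \sum_(k < K) z ^- k * toC (g k i j)) @ \oo --> F z i j.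

End systems.

(* The causal convolution (a * b)_t; applied to signals, it is the response of
   a filter whose input vanishes before time 0. *)
Definition conv {R : realType} (a b c : nat) (f : nat -> 'M[R]_(a, b))
    (x : nat -> 'M[R]_(b, c)) (t : nat) : 'M[R]_(a, c) :=
  \sum_(k < t.+1) f k *m x (t - k)%N.

Definition summable_filter {R : realType} (a b : nat) (f : nat -> 'M[R]_(a, b))
  : Prop := cvgn (series (fun t => frob (f t))).

(* s is the impulse response of (I - Gu G)^-1, and conv s gu that of
   (I - Gu G)^-1 Gu. *)
Definition closed_loop_stable {R : realType} (p m : nat)
    (g : nat -> 'M[R]_(p, m)) (gu : nat -> 'M[R]_(m, p)) : Prop :=
  exists s : nat -> 'M[R]_m,
    [/\ forall t, s t = (t == 0%N)%:R%:M + conv (conv gu g) s t,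
        summable_filter s & summable_filter (conv s gu)].

Section random_vectors.
Context {R : realType} {d : measure_display} {T : measurableType d}.
Variable P : probability T R.

Definition tup (k : nat) (x : 'cV[R]_k) : k.-tuple R := [tuple x i 0 | i < k].

Definition random_vector (k : nat) (X : T -> 'cV[R]_k) : Prop :=
  measurable_fun setT (fun w => tup (X w)).

Definition mutually_independent (I : choiceType) (d' : measure_display)
    (T' : measurableType d') (X : I -> T -> T') : Prop :=
  forall (s : seq I) (A : I -> set T'), uniq s ->
    (forall i, measurable (A i)) ->
    (P (\bigcap_(i in [set` s]) X i @^-1` A i)
     = \prod_(i <- s) P (X i @^-1` A i))%E.

Definition independent_processes (d1 d2 : measure_display)
    (T1 : measurableType d1) (T2 : measurableType d2)
    (X : nat -> T -> T1) (Y : nat -> T -> T2) : Prop :=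
  forall (K : nat) (A : nat -> set T1) (B : nat -> set T2),
    (forall t, measurable (A t)) -> (forall t, measurable (B t)) ->
    let EX := \bigcap_(t in `I_K) X t @^-1` A t in
    let EY := \bigcap_(t in `I_K) Y t @^-1` B t in
    (P (EX `&` EY) = P EX * P EY)%E.

(* X ~ N(0, S): X = L W where W has independent standard normal entries and
   L L^T = S. *)
Definition gaussian_vector (k : nat) (S : 'M[R]_k) (X : T -> 'cV[R]_k) : Prop :=
  exists (L : 'M[R]_k) (W : 'I_k -> T -> R),
    [/\ L *m L^T = S,
        forall i, measurable_fun setT (W i),
        forall i (B : set R), measurable B -> P (W i @^-1` B) = normal_prob 0 1 B,
        mutually_independent W
      & forall w, X w = L *m \col_i W i w].

Definition from_time0 (k : nat) (u : nat -> T -> 'cV[R]_k) (t : int) (w : T)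
  : 'cV[R]_k := if t is Posz s then u s w else 0.

(* R_u(l) = lim_t E (u_t u_(t-l)^T) *)
Definition autocov (k : nat) (u : nat -> T -> 'cV[R]_k) (l : int) : 'M[R]_k :=
  \matrix_(i, j) limn (fun t : nat =>
    fine (expectation P (fun w => u t w i 0 * from_time0 u (t%:Z - l) w j 0))).

(* Wide-sense stationarity on t >= 0 *)
Definition stationary (k : nat) (u : nat -> T -> 'cV[R]_k) : Prop :=
  [/\ forall t i, P.-integrable setT (fun w => (u t w i 0 ^+ 2)%:E),
      forall t i, expectation P (fun w => u t w i 0)
                  = expectation P (fun w => u 0%N w i 0)
    & forall t s h i j,
        expectation P (fun w => u (t + h)%N w i 0 * u (s + h)%N w j 0)
        = expectation P (fun w => u t w i 0 * u s w j 0)].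

Definition spectral_sum (k : nat) (u : nat -> T -> 'cV[R]_k) (K : nat) (w : R)
  : 'M[CC R]_k :=
  \sum_(l < K.*2.+1)
    expi (((l : nat)%:Z - K%:Z)%:~R * w) *: map_mx toC (autocov u ((l : nat)%:Z - K%:Z)).

(* Phi(w) = \sum_l R_u(l) e^(ilw), with mean-square convergence on [-pi, pi];
   for a bounded Phi this amounts to the R_u(l) being its Fourier
   coefficients. *)
Definition power_spectrum (k : nat) (u : nat -> T -> 'cV[R]_k)
    (Phi : R -> 'M[CC R]_k) : Prop :=
  (forall i j, measurable_fun `[- pi, pi] (fun w => complex.Re (Phi w i j)) /\
               measurable_fun `[- pi, pi] (fun w => complex.Im (Phi w i j))) /\
  (fun K : nat => (\int[lebesgue_measure]_(w in `[(- pi)%R, pi])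
     (frobC (spectral_sum u K w - Phi w)%R ^+ 2)%:E)%E) @ \oo --> 0%E.

(* Positive definiteness of the q-th order block Toeplitz matrix of the
   covariances R_u(i - j) *)
Definition persistently_exciting (k q : nat) (u : nat -> T -> 'cV[R]_k) : Prop :=
  forall a : 'I_q -> 'cV[R]_k, (exists i, a i != 0) ->
    0 < (\sum_(i < q) \sum_(j < q)
          (a i)^T *m autocov u ((i : nat)%:Z - (j : nat)%:Z) *m a j) 0 0.

(* kap is a regular conditional distribution of Y given U. *)
Definition conditional_law (d1 d2 : measure_display) (T1 : measurableType d1)
    (T2 : measurableType d2) (U : T -> T1) (Y : T -> T2)
    (kap : T1 -> probability T2 R) : Prop :=
  (forall B, measurable B -> measurable_fun [set: T1] (kap ^~ B)) /\
  forall A B, measurable A -> measurable B ->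
    (P (U @^-1` A `&` Y @^-1` B) = \int[P]_(w in U @^-1` A) kap (U w) B)%E.

End random_vectors.

Definition ess_sup_norm {R : realType} (k : nat) (Phi : R -> 'M[CC R]_k)
  : \bar R :=
  ess_sup (mrestr lebesgue_measure (measurable_itv `[- pi, pi : R]))
    (fun w => (frobC (Phi w))%:E).

(* The density vanishes only on a P-null set, so the value ln 0 = 0 is harmless. *)
Definition KL {R : realType} {d : measure_display} {Y : measurableType d}
    (P Q : probability Y R) : \bar R :=
  if pselect (P `<< Q) then
    (\int[P]_y (ln (fine (Radon_Nikodym (charge_of_finite_measure P) Q y)))%:E)%E
  else +oo%E.

(* y = G u + v, u = Gu y + r *)
Definition closed_loop_data {R : realType} {T : Type} (p m : nat)
    (g : nat -> 'M[R]_(p, m)) (gu : nat -> 'M[R]_(m, p))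
    (v : nat -> T -> 'cV[R]_p) (r : nat -> T -> 'cV[R]_m)
    (u : nat -> T -> 'cV[R]_m) (y : nat -> T -> 'cV[R]_p) : Prop :=
  forall t w,
    y t w = conv g (fun s => u s w) t + v t w /\
    u t w = conv gu (fun s => y s w) t + r t w.

(* u_0, ..., u_(N-1) and y_1, ..., y_N *)
Definition input_record {R : realType} {T : Type} (m N : nat)
    (u : nat -> T -> 'cV[R]_m) (w : T) : N.-tuple (m.-tuple R) :=
  [tuple tup (u t w) | t < N].

Definition output_record {R : realType} {T : Type} (p N : nat)
    (y : nat -> T -> 'cV[R]_p) (w : T) : N.-tuple (p.-tuple R) :=
  [tuple tup (y t.+1 w) | t < N].

(* Signals are real.  The suffixes 0 and 1 refer to data from the true system G
   and from its surrogate; both are driven by the same noise, excitation and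
   controller, which is no restriction as only laws matter.  exn_exc is the
   external excitation Hu(z) eps_t; only its independence of the noise is used,
   and its order of persistent excitation is left free.  exn_P0 and exn_P1 are
   the conditional laws of the outputs given the inputs. *)
Record experiment (R : realType) (D : set (CC R)) (p m n : nat) := Experiment {
  exn_disp : measure_display;
  exn_T : measurableType exn_disp;
  exn_P : probability exn_T R;

  exn_lam : 'I_n -> CC R;
  exn_res : 'I_n -> 'M[CC R]_(p, m);
  exn_mu : 'I_n -> CC R;
  exn_sres : 'I_n -> 'M[CC R]_(p, m);
  exn_G := partial_fractions exn_lam exn_res;
  exn_Gs := partial_fractions exn_mu exn_sres;
  exn_lam_inj : injective exn_lam;
  exn_lamD : forall j, D (exn_lam j);
  exn_muP : cheb_minimizer D exn_mu;
  exn_sresP : best_residues exn_G exn_mu exn_sres;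

  exn_g : nat -> 'M[R]_(p, m);
  exn_gs : nat -> 'M[R]_(p, m);
  exn_gP : impulse_response exn_G exn_g;
  exn_gsP : impulse_response exn_Gs exn_gs;

  exn_cov : 'M[R]_p;
  exn_noise : nat -> exn_T -> 'cV[R]_p;
  exn_cov_pos : pos_def exn_cov;
  exn_noise_meas : forall t, random_vector (exn_noise t);
  exn_noise_gauss : forall t, gaussian_vector exn_P exn_cov (exn_noise t);
  exn_noise_indep :
    mutually_independent exn_P (fun t w => tup (exn_noise t w));

  exn_gu : nat -> 'M[R]_(m, p);
  exn_exc : nat -> exn_T -> 'cV[R]_m;
  exn_order : nat;
  exn_stable : closed_loop_stable exn_g exn_gu;
  exn_exc_meas : forall t, random_vector (exn_exc t);
  exn_exc_indep : independent_processes exn_P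
    (fun t w => tup (exn_exc t w)) (fun t w => tup (exn_noise t w));
  exn_exc_pe : persistently_exciting exn_P exn_order exn_exc;

  exn_u0 : nat -> exn_T -> 'cV[R]_m;
  exn_y0 : nat -> exn_T -> 'cV[R]_p;
  exn_u1 : nat -> exn_T -> 'cV[R]_m;
  exn_y1 : nat -> exn_T -> 'cV[R]_p;
  exn_data0 : closed_loop_data exn_g exn_gu exn_noise exn_exc exn_u0 exn_y0;
  exn_data1 : closed_loop_data exn_gs exn_gu exn_noise exn_exc exn_u1 exn_y1;

  exn_Phi : R -> 'M[CC R]_m;
  exn_stat : stationary exn_P exn_u0;
  exn_PhiP : power_spectrum exn_P exn_u0 exn_Phi;
  exn_Phi_bnd : (ess_sup_norm exn_Phi < +oo)%E;

  exn_N : nat;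
  exn_P0 : exn_N.-tuple (m.-tuple R) -> probability (exn_N.-tuple (p.-tuple R)) R;
  exn_P1 : exn_N.-tuple (m.-tuple R) -> probability (exn_N.-tuple (p.-tuple R)) R;
  exn_P0P : conditional_law exn_P
    (input_record exn_N exn_u0) (output_record exn_N exn_y0) exn_P0;
  exn_P1P : conditional_law exn_P
    (input_record exn_N exn_u1) (output_record exn_N exn_y1) exn_P1
}.

Arguments exn_noise {R D p m n} e.
Arguments exn_exc {R D p m n} e.
Arguments exn_u0 {R D p m n} e.
Arguments exn_y0 {R D p m n} e.
Arguments exn_u1 {R D p m n} e.
Arguments exn_y1 {R D p m n} e.
Arguments exn_P0 {R D p m n} e.
Arguments exn_P1 {R D p m n} e.

Section quantities.
Context {R : realType} {D : set (CC R)} {p m n : nat}.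
Variable E : experiment D p m n.

Definition expected_KL : \bar R :=
  (\int[exn_P E]_w
     KL (exn_P0 E (input_record (exn_N E) (exn_u0 E) w))
        (exn_P1 E (input_record (exn_N E) (exn_u0 E) w)))%E.

Definition spectral_radius : R := \big[Num.max/0]_(j < n) cabs (exn_lam E j).

Definition residue_sum : R := \sum_(j < n) frobC (exn_res E j).

Definition precision_norm : R := frob (invmx (exn_cov E)).

Definition Phi_sup : R := fine (ess_sup_norm (exn_Phi E)).

End quantities.

(* Main.v *)
(* Under both hypotheses the inputs are computed from the outputs by the same
   controller, so the likelihood ratio of a whole record is the exponential of
   the difference of the prediction losses of the two models.  Disintegrating it
   over the inputs bounds the expected conditional divergence by half the
   expected energy, weighted by the inverse covariance, of the response of
   h = g - gs to the inputs (an inequality only, because the inputs carry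
   information too).  By orthogonality of characters the unweighted energy is at
   most ess sup |Phi| times the sum of the |h_k|^2, which is at most |G - Gs|_2^2.

   The partial fractions at mu that interpolate 1/(z - lam) leave the error
   c / (z - lam) times a Blaschke product, where |c| = prod_k [lam, mu_k]_h.  The
   Blaschke product has modulus 1 on the unit circle and the Poisson kernel has
   mean 1, so the squared norm of the error is at most |c|^2 / (1 - |lam|^2); a
   weighted Cauchy-Schwarz inequality sums over the poles.  The maximum modulus
   principle on D turns the minimax property of mu on the boundary of D into
   |c| <= tau_n^n.  Finally tau_n^n is submultiplicative in n, so tau_n converges
   by Fekete's lemma. *)

Require Import Defs.
From HB Require Import structures.
From mathcomp Require Import all_boot all_order all_algebra complex.
From mathcomp Require Import all_classical all_reals all_analysis.
From mathcomp Require Import measurable_realfun ess_sup_inf.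
From mathcomp Require Import ring lra zify.

Import Order.TTheory GRing.Theory Num.Theory.
Import numFieldNormedType.Exports.
Local Open Scope classical_set_scope.
Local Open Scope ring_scope.

(* [convex] also defines a [conv]. *)
Import Defs.

(** * Likelihood ratios of Gaussian perturbations *)

(** The conditional laws are given only as kernels with the right averages: each identity about them
    holds for almost every input, and their divergence is not known to depend measurably on the
    inputs. Hence the output space is shown to be countably generated, so that one null set serves
    all events, and the divergence is replaced by an explicit measurable version. What the
    inequality loses is the divergence between the two input laws; its sign enters as E(1/c) <= 1,
    where c is the density of the first input law relative to the second. Two limits are weak. An
    impulse response is summed only pointwise on |z| >= 1, so Parseval is applied to truncations on
    circles of radius above 1, and the radius then tends to 1. The spectrum is a mean-square limit,
    so its essential bound reaches finite quadratic forms only up to an error that Young's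
    inequality makes small. The factor 1/2 is that of the Gaussian log-density. The maximum modulus
    principle is proved for polynomials, since a hyperbolic product is the modulus of a quotient of
    two polynomials. *)

Section independence.
Context {R : realType} {d : measure_display} {T : measurableType d}.
Variable P : probability T R.
Local Open Scope ereal_scope.

Definition indep2 {d1 d2} {S : measurableType d1} {V : measurableType d2}
    (X : T -> S) (Y : T -> V) :=
  forall A B, measurable A -> measurable B ->
    P (X @^-1` A `&` Y @^-1` B) = P (X @^-1` A) * P (Y @^-1` B).

(** Independence makes the law of the pair the product of the marginal laws; the rest is Tonelli. *)
Lemma indep2_integral {d1 d2} {S : measurableType d1} {V : measurableType d2}
    (X : T -> S) (Y : T -> V) (F : S * V -> \bar R) :
  measurable_fun setT X -> measurable_fun setT Y -> indep2 X Y ->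
  measurable_fun setT F -> (forall z, 0 <= F z) ->
  \int[P]_w F (X w, Y w) = \int[P]_w \int[P]_w' F (X w, Y w').
Proof.
move=> mX mY XY mF F0.
pose X' : {mfun T >-> S} := HB.pack X (isMeasurableFun.Build _ _ _ _ X mX).
pose Y' : {mfun T >-> V} := HB.pack Y (isMeasurableFun.Build _ _ _ _ Y mY).
have mXY : measurable_fun setT (fun w => (X w, Y w)) by exact: measurable_fun_pair.
pose Z : {mfun T >-> (S * V)%type} :=
  HB.pack (fun w => (X w, Y w)) (isMeasurableFun.Build _ _ _ _ _ mXY).
have <- : \int[distribution P Z]_z F z = \int[P]_w F (X w, Y w).
  by rewrite ge0_integral_distribution.
have mFx x : measurable_fun setT (fun y => F (x, y)) by exact: measurableT_comp.
under [RHS]eq_integral => w _.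
  rewrite -(ge0_integral_distribution Y' (f := fun y => F (X w, y)))//.
  over.
rewrite -(ge0_integral_distribution X'
    (f := fun x => \int[distribution P Y']_y F (x, y))); first last.
- by move=> x; exact: integral_ge0.
- exact: (measurable_fun_fubini_tonelli_F F).
rewrite -fubini_tonelli1//.
apply: eq_measure_integral => A mA _; apply/esym.
by apply: product_measure_unique => //= A' B' mA' mB'; exact: XY.
Qed.

End independence.

(* One step of the likelihood-ratio induction: if shifting the fresh noise [v n]
   changes [step0] into [step1] at the cost of the density [e n], then the laws
   of the two recursions differ by the accumulated density [L n]. *)
Section likelihood_ratio.
Context {R : realType} {d : measure_display} {T : measurableType d}.
Variable P : probability T R.
Local Open Scope ereal_scope.
Context {dS dV} {S : measurableType dS} {V : measurableType dV}.
Variables (X0 X1 : nat -> T -> S) (v : nat -> T -> V)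
  (step0 step1 : nat -> S * V -> S) (e L : nat -> S -> R) (M : nat).
Hypotheses (mX0 : forall n, measurable_fun setT (X0 n))
  (mX1 : forall n, measurable_fun setT (X1 n))
  (mv : forall n, measurable_fun setT (v n))
  (mstep0 : forall n, measurable_fun setT (step0 n))
  (mstep1 : forall n, measurable_fun setT (step1 n))
  (me : forall n, measurable_fun setT (e n))
  (mL : forall n, measurable_fun setT (L n))
  (e_ge0 : forall n s, (0 <= e n s)%R) (L_ge0 : forall n s, (0 <= L n s)%R)
  (X0S : forall n w, (n < M)%N -> X0 n.+1 w = step0 n (X0 n w, v n w))
  (X1S : forall n w, (n < M)%N -> X1 n.+1 w = step1 n (X1 n w, v n w))
  (X00 : forall w, X0 0%N w = X1 0%N w)
  (indepX0 : forall n, (n < M)%N -> indep2 P (X0 n) (v n))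
  (indepX1 : forall n, (n < M)%N -> indep2 P (X1 n) (v n))
  (L0 : forall s, L 0%N s = 1%R)
  (LS : forall n w w', (n < M)%N -> L n.+1 (step1 n (X1 n w, v n w')) =
     (L n (X1 n w) * e n (step1 n (X1 n w, v n w')))%R)
  (shift : forall n x (F : S -> \bar R), (n < M)%N -> measurable_fun setT F ->
     (forall s, 0 <= F s) ->
     \int[P]_w F (step0 n (x, v n w)) =
     \int[P]_w (F (step1 n (x, v n w)) * (e n (step1 n (x, v n w)))%:E)).

Lemma likelihood_ratio n (F : S -> \bar R) : (n <= M)%N ->
  measurable_fun setT F -> (forall s, 0 <= F s) ->
  \int[P]_w F (X0 n w) = \int[P]_w (F (X1 n w) * (L n (X1 n w))%:E).
Proof.
elim: n F => [|n IHn] F nM mF F0.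
  by apply: eq_integral => w _; rewrite X00 L0 mule1.
have mH : measurable_fun setT (fun z => F (step1 n z) * (e n (step1 n z))%:E).
  apply: emeasurable_funM; first exact: measurableT_comp.
  by apply/measurable_EFinP; exact: measurableT_comp.
have H0 z : 0 <= F (step1 n z) * (e n (step1 n z))%:E.
  by rewrite mule_ge0// lee_fin.
pose Phi x := \int[P]_w (F (step1 n (x, v n w)) * (e n (step1 n (x, v n w)))%:E).
have mv' (x : S) : measurable_fun setT (fun w => (x, v n w)).
  exact: (measurable_fun_pair (measurable_cst _) (mv n)).
have mPhi : measurable_fun setT Phi.
  pose G (z : S * T) := F (step1 n (z.1, v n z.2)) * (e n (step1 n (z.1, v n z.2)))%:E.
  apply: (measurable_fun_fubini_tonelli_F G) => [|z]; last exact: H0.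
  have mp : measurable_fun setT (fun z : S * T => (z.1, v n z.2)).
    by apply: measurable_fun_pair => //; exact: measurableT_comp.
  exact: (measurableT_comp mH mp).
have Phi0 x : 0 <= Phi x by apply: integral_ge0 => w _; exact: H0.
(* Integrating out the fresh noise leaves a function of the state alone, to which the induction
   hypothesis applies; Tonelli is then undone in the second recursion. *)
transitivity (\int[P]_w Phi (X0 n w)).
  under eq_integral do rewrite X0S//.
  rewrite (indep2_integral P (X0 n) (v n) (fun z => F (step0 n z)))//.
  - by apply: eq_integral => w _; rewrite shift.
  - exact: indepX0.
  - exact: measurableT_comp.
rewrite IHn//; last exact: ltnW.
pose G z := F (step1 n z) * (e n (step1 n z))%:E * (L n z.1)%:E.
have mG : measurable_fun setT G.
  apply: emeasurable_funM => //.
  by apply/measurable_EFinP; exact: measurableT_comp.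
transitivity (\int[P]_w G (X1 n w, v n w)).
  rewrite (indep2_integral P (X1 n) (v n) G)//.
  - apply: eq_integral => w _; rewrite /Phi -ge0_integralZr//=.
    + exact: (measurableT_comp mH).
    + by rewrite lee_fin.
  - exact: indepX1.
  - by move=> z; rewrite mule_ge0// lee_fin.
by apply: eq_integral => w _; rewrite /G X1S// LS// -muleA -EFinM mulrC.
Qed.

End likelihood_ratio.

Section density.
Local Open Scope ereal_scope.
Context {R : realType} {d : measure_display} {T : measurableType d}.

(** The function g has the same integrals as the Radon-Nikodym derivative, hence equals it almost
    everywhere, and the change of variables for the derivative carries over. *)
Lemma ge0_integral_density (nu : probability T R)
    (mu : {sigma_finite_measure set T -> \bar R}) (g F : T -> \bar R) :
  measurable_fun setT g -> (forall x, 0 <= g x) ->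
  (forall A, measurable A -> nu A = \int[mu]_(x in A) g x) ->
  measurable_fun setT F -> (forall x, 0 <= F x) ->
  \int[nu]_x F x = \int[mu]_x (F x * g x).
Proof.
move=> mg g0 nuE mF F0.
have numu : nu `<< mu.
  apply/null_content_dominatesP => A mA A0.
  by rewrite nuE// null_set_integral//; exact: measurable_funTS.
rewrite -(Radon_Nikodym_SigmaFinite.change_of_variables numu)//.
pose f := Radon_Nikodym_SigmaFinite.f nu mu.
have mf : mu.-integrable setT f.
  exact: Radon_Nikodym_SigmaFinite.f_integrable.
have fg : ae_eq mu setT f g.
  apply: integral_ae_eq => // A _ mA.
  by rewrite -nuE// -Radon_Nikodym_SigmaFinite.f_integral.
apply: ae_eq_integral => //.
- by apply: emeasurable_funM => //; exact: measurable_int mf.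
- exact: emeasurable_funM.
- exact: ae_eqe_mul2l.
Qed.

End density.

(** * Translations and moments of the standard normal law *)

Section standard_normal.
Context {R : realType}.
Local Notation mu := (@lebesgue_measure R).
Local Notation RM := (measurableTypeR R).
Local Notation N01 := (@normal_prob R 0 1).
Local Notation phi := (@normal_pdf R 0 1).
Local Open Scope ereal_scope.

Lemma lebesgue_measureD (c : R) (A : set R) : measurable A ->
  pushforward mu ((fun x => x + c)%R : _ -> measurableTypeR R) A = mu A.
Proof.
move=> mA; have mc : measurable_fun setT ((fun x => x + c)%R : RM -> RM).
  exact: measurable_funD.
apply/esym/(lebesgue_measure_unique (mu := pushforward _ _)) => //= _ [[a b]] _ <-.
rewrite /pushforward (_ : _ @^-1` _ = `](a - c)%R, (b - c)%R]%classic); last first.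
  by apply/seteqP; split=> x /=; rewrite !in_itv/= ltrBlDr lerBrDr.
by rewrite !lebesgue_measure_itv/= !lte_fin ltrD2r -!EFinD; case: ifP => // _;
  congr EFin; lra.
Qed.

Lemma ge0_integralT_shift (F : RM -> \bar R) (c : R) :
  measurable_fun setT F -> (forall x, 0 <= F x) ->
  \int[mu]_x F (x + c)%R = \int[mu]_x F x.
Proof.
move=> mF F0; have mc : measurable_fun setT ((fun x => x + c)%R : RM -> RM).
  exact: measurable_funD.
rewrite -(ge0_integral_pushforward mc mu (D := setT))//.
by apply: eq_measure_integral => A mA _; exact: lebesgue_measureD.
Qed.

Lemma ge0_integralT_opp (F : RM -> \bar R) :
  measurable_fun setT F -> (forall x, 0 <= F x) ->
  \int[mu]_x F (- x)%R = \int[mu]_x F x.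
Proof.
move=> mF F0; have mc : measurable_fun setT (-%R : RM -> RM) by exact: oppr_measurable.
rewrite -(ge0_integral_pushforward mc mu (D := setT))//.
by apply: eq_measure_integral => A mA _; exact: lebesgue_measureN.
Qed.

Lemma integral_N01 (F : RM -> \bar R) :
  measurable_fun setT F -> (forall x, 0 <= F x) ->
  \int[N01]_x F x = \int[mu]_x (F x * (phi x)%:E).
Proof.
move=> mF F0; apply: ge0_integral_density => // [|x].
- by apply/measurable_EFinP; exact: measurable_normal_pdf.
- by rewrite lee_fin normal_pdf_ge0.
Qed.

Let phiE x : phi x = (normal_peak 1 * expR (- x ^+ 2 / 2))%R.
Proof. by rewrite normal_pdfE ?oner_eq0//= /normal_fun subr0 expr1n. Qed.

(** The one-dimensional Cameron-Martin formula: completing the square gives phi(x - c) = phi(x)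
    e^(cx - c^2/2). *)
Lemma N01_shift (F : RM -> \bar R) (c : R) :
  measurable_fun setT F -> (forall x, 0 <= F x) ->
  \int[N01]_x F (x + c)%R = \int[N01]_x (F x * (expR (c * x - c ^+ 2 / 2))%:E).
Proof.
move=> mF F0.
have me : measurable_fun setT (fun x : RM => expR (c * x - c ^+ 2 / 2)).
  apply: measurableT_comp => //; exact: measurable_funB.
rewrite !integral_N01//; first last.
- by apply: measurableT_comp => //; exact: measurable_funD.
- by move=> x; rewrite mule_ge0// lee_fin expR_ge0.
- by apply: emeasurable_funM => //; exact/measurable_EFinP.
pose H x := F x * (phi (x - c))%:E.
transitivity (\int[mu]_x H (x + c)%R).
  by apply: eq_integral => x _; rewrite /H addrK.
rewrite ge0_integralT_shift; first last.
- by move=> x; rewrite mule_ge0// lee_fin normal_pdf_ge0.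
- apply: emeasurable_funM => //; apply/measurable_EFinP.
  apply: measurableT_comp; first exact: measurable_normal_pdf.
  exact: measurable_funB.
apply: eq_integral => x _; rewrite /H -muleA -EFinM; congr (_ * _%:E).
by rewrite !phiE mulrCA -expRD; congr (_ * expR _)%R; field.
Qed.

Lemma N01_opp (F : RM -> \bar R) :
  measurable_fun setT F -> (forall x, 0 <= F x) ->
  \int[N01]_x F (- x)%R = \int[N01]_x F x.
Proof.
move=> mF F0; rewrite !integral_N01//; last exact: measurableT_comp.
rewrite -[RHS]ge0_integralT_opp; first last.
- by move=> x; rewrite mule_ge0// lee_fin normal_pdf_ge0.
- by apply: emeasurable_funM => //; apply/measurable_EFinP; exact: measurable_normal_pdf.
by apply: eq_integral => x _; rewrite !phiE sqrrN.
Qed.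

(** The constant function 1 in [N01_shift] yields the value without computing a Gaussian
    integral. *)
Lemma N01_mgf (c : R) : \int[N01]_x (expR (c * x))%:E = (expR (c ^+ 2 / 2))%:E.
Proof.
have := N01_shift (cst 1) c.
rewrite integral_cst//= mul1e probability_setT => /(_ (measurable_cst _)) h.
have {h} := h (fun=> lee01).
under eq_integral do rewrite mul1e addrC expRD EFinM.
have mc : measurable_fun setT (fun x : RM => c * x)%R by exact: measurable_funM.
rewrite ge0_integralZl//.
- move=> h; apply/esym; rewrite -[LHS]mule1 h muleA -EFinM -expRD subrr expR0.
  by rewrite mul1e.
- by apply/measurable_EFinP; exact: measurableT_comp.
Qed.

(** The square is dominated by exponentials, whose means are known from [N01_mgf]. *)
Lemma N01_second_moment_lty : \int[N01]_x ((x ^+ 2)%:E) < +oo.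
Proof.
have mc (c : R) : measurable_fun setT (fun x : RM => (expR (c * x))%:E).
  apply/measurable_EFinP; apply: measurableT_comp => //; exact: measurable_funM.
apply: (@le_lt_trans _ _
    (\int[N01]_x (4%:E * ((expR (1 * x))%:E + (expR (- 1 * x))%:E)))).
  apply: ge0_le_integral => //=.
  - by move=> x _; rewrite lee_fin sqr_ge0.
  - by apply/measurable_EFinP; exact: exprn_measurable.
  - by apply: measurable_funeM; apply: emeasurable_funD.
  - move=> x _; rewrite -EFinD -EFinM lee_fin mul1r mulN1r.
    (* Square the chain y <= 2 (1 + y/2) <= 2 e^(y/2). *)
    have h (y : R) : (0 <= y -> y ^+ 2 <= 4 * expR y)%R.
      move=> y0; have := expR_ge1Dx (y / 2).
      have -> : expR y = (expR (y / 2) ^+ 2)%R.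
        by rewrite expr2 -expRD; congr expR; field.
      by nra.
    have [x0|x0] := leP 0%R x.
      by have := h x x0; have := expR_ge0 (- x); lra.
    have := h (- x)%R; rewrite oppr_ge0 (ltW x0) sqrrN => /(_ isT).
    by have := expR_ge0 x; lra.
rewrite ge0_integralZl//; [|by apply: emeasurable_funD|by move=> x _; rewrite lee_fin addr_ge0 ?expR_ge0].
rewrite ge0_integralD//; try by move=> x _; rewrite lee_fin expR_ge0.
by rewrite !N01_mgf -EFinD -EFinM ltry.
Qed.

(** Symmetry replaces the signed cross term: the integral with c equals the one with -c, and their
    sum has the integrand 2 (x^2 + c^2), so only nonnegative functions are integrated. *)
Lemma N01_shift_sqr (c : R) :
  \int[N01]_x (((x + c) ^+ 2)%:E) = \int[N01]_x ((x ^+ 2)%:E) + (c ^+ 2)%:E.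
Proof.
have msq (c' : R) : measurable_fun setT (fun x : RM => ((x + c') ^+ 2)%:E).
  apply/measurable_EFinP; apply: measurable_funX; exact: measurable_funD.
have m2 : measurable_fun setT (fun x : RM => (x ^+ 2)%:E).
  by apply/measurable_EFinP; exact: exprn_measurable.
set A := \int[N01]_x ((x ^+ 2)%:E).
have fA : A \is a fin_num.
  rewrite ge0_fin_numE ?N01_second_moment_lty// integral_ge0// => x _.
  by rewrite lee_fin sqr_ge0.
set B := LHS.
have BE : B = \int[N01]_x (((x - c) ^+ 2)%:E).
  rewrite /B -(N01_opp (fun x => ((x + c) ^+ 2)%:E))//; last first.
    by move=> x; rewrite lee_fin sqr_ge0.
  by apply: eq_integral => x _; congr EFin; ring.
have : B + B = 2%:E * (A + (c ^+ 2)%:E).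
  rewrite {2}BE -ge0_integralD//; try by move=> x _; rewrite lee_fin sqr_ge0.
  transitivity (\int[N01]_x (2%:E * ((x ^+ 2)%:E + (c ^+ 2)%:E))).
    by apply: eq_integral => x _; rewrite -!EFinD -!EFinM; congr EFin; ring.
  rewrite ge0_integralZl//; last 2 first.
  - by apply: emeasurable_funD.
  - by move=> x _; rewrite -EFinD lee_fin addr_ge0 ?sqr_ge0.
  rewrite ge0_integralD//; try by move=> x _; rewrite lee_fin sqr_ge0.
  by rewrite integral_cst//= [normal_prob _ _ _]probability_setT mule1.
move: fA; case: A => [a| |]// _; case: B BE => [b| |]//= _.
by rewrite -!EFinD -EFinM => -[] h; congr EFin; lra.
Qed.

End standard_normal.

(** * Independence tested on generating pi-systems *)

Section generated_independence.
Context {R : realType} {d : measure_display} {T : measurableType d}.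
Variable P : probability T R.
Local Open Scope ereal_scope.

Lemma indep2_comp {d1 d2 d3} {S : measurableType d1} {V : measurableType d2}
    {S' : measurableType d3} (f : S -> S') (X : T -> S) (Y : T -> V) :
  measurable_fun setT f -> indep2 P X Y -> indep2 P (f \o X) Y.
Proof.
move=> mf XY A B mA mB.
have mfA : measurable (f @^-1` A) by rewrite -[X in measurable X]setTI; exact: mf.
exact: XY mfA mB.
Qed.

(** For a fixed B both sides are finite measures in A, so their agreement on a pi-system is
    enough. *)
Lemma indep2_generated {d1 d2} {S : measurableType d1} {V : measurableType d2}
    (G : set (set S)) (X : T -> S) (Y : T -> V) :
  @measurable _ S = <<s G >> -> setI_closed G -> G setT ->
  measurable_fun setT X -> measurable_fun setT Y ->
  (forall A B, G A -> measurable B ->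
    P (X @^-1` A `&` Y @^-1` B) = P (X @^-1` A) * P (Y @^-1` B)) ->
  indep2 P X Y.
Proof.
move=> GE GI GT mX mY XY A B mA mB.
have mYB : measurable (Y @^-1` B) by rewrite -[X in measurable X]setTI; exact: mY.
pose X' : {mfun T >-> S} := HB.pack X (isMeasurableFun.Build _ _ _ _ X mX).
have r0 : (0 <= fine (P (Y @^-1` B)))%R by rewrite fine_ge0.
pose m1 := pushforward (mrestr P mYB) X'.
pose m2 := mscale (NngNum r0) (distribution P X').
have PYB : (fine (P (Y @^-1` B)))%:E = P (Y @^-1` B).
  by rewrite fineK// fin_num_measure.
have := @measure_unique _ _ _ G (fun=> setT) GE GI (fun=> GT) _ m1 m2.
rewrite bigcup_const// => /(_ erefl mX) h.
have m1E A' : m1 A' = P (X @^-1` A' `&` Y @^-1` B) by [].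
have m2E A' : m2 A' = P (X @^-1` A') * P (Y @^-1` B) by rewrite muleC -PYB.
have m12 A' : measurable A' -> m1 A' = m2 A'.
  apply: h => [A'' GA''|_].
    by apply: (etrans (m1E _)); rewrite XY//; exact/esym/m2E.
  suff : P (X @^-1` setT `&` Y @^-1` B) < +oo by [].
  by rewrite preimage_setT setTI ltey_eq fin_num_measure.
by rewrite -m1E -m2E; exact: m12.
Qed.

End generated_independence.

Section rectangles.
Context {d : measure_display} {T : measurableType d}.

Definition tuple_rectangles n : set (set (n.-tuple T)) :=
  [set C | exists A : 'I_n -> set T, (forall i, measurable (A i)) /\
     C = [set x | forall i, A i (tnth x i)]].

Lemma tuple_rectanglesI n : setI_closed (tuple_rectangles n).
Proof.
move=> _ _ [A [mA ->]] [B [mB ->]]; exists (fun i => A i `&` B i); split.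
  by move=> i; exact: measurableI.
by apply/seteqP; split=> x /= => [[hA hB] i|h]; split => // i; case: (h i).
Qed.

Lemma tuple_rectanglesT n : tuple_rectangles n setT.
Proof. by exists (fun=> setT); split => //; apply/seteqP; split. Qed.

Lemma measurable_tupleE n : @measurable _ (n.-tuple T) = <<s @tuple_rectangles n >>.
Proof.
apply/seteqP; split.
  apply: smallest_sub; first exact: smallest_sigma_algebra.
  rewrite -bigcup_seq => A [i /= _ [B mB <-]]; apply: sub_sigma_algebra.
  exists (fun j => if j == i then B else setT); split.
    by move=> j; case: ifP.
  rewrite setTI; apply/seteqP; split=> x /= => [Bx j|/(_ i)]; last by rewrite eqxx.
  by case: eqP => // ->.
apply: smallest_sub; first exact: sigma_algebra_measurable.
move=> _ [A [mA ->]].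
rewrite (_ : [set _ | _] = \bigcap_(i in [set: 'I_n]) ((@tnth n T)^~ i @^-1` A i)).
  apply: fin_bigcap_measurable => // i _.
  by rewrite -[X in measurable X]setTI; exact: measurable_tnth.
by apply/seteqP; split=> x /= h i; [move=> _; exact: h|exact: h].
Qed.

End rectangles.

Section product_rectangles.
Context {d1 d2 : measure_display} {T1 : measurableType d1} {T2 : measurableType d2}.
Variables (G1 : set (set T1)) (G2 : set (set T2)).
Hypotheses (G1E : @measurable _ T1 = <<s G1 >>) (G2E : @measurable _ T2 = <<s G2 >>).
Hypotheses (G1T : G1 setT) (G2T : G2 setT).
Hypotheses (G1I : setI_closed G1) (G2I : setI_closed G2).

Definition prod_rectangles : set (set (T1 * T2)) :=
  [set A `*` B | A in G1 & B in G2].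

Lemma prod_rectanglesT : prod_rectangles setT.
Proof. by exists setT => //; exists setT => //; rewrite setXTT. Qed.

Lemma prod_rectanglesI : setI_closed prod_rectangles.
Proof.
move=> _ _ [A GA [B GB <-]] [A' GA' [B' GB' <-]].
by exists (A `&` A'); [exact: G1I|exists (B `&` B'); [exact: G2I|rewrite setXI]].
Qed.

Lemma measurable_prodE : @measurable _ (T1 * T2)%type = <<s prod_rectangles >>.
Proof.
apply/seteqP; split; last first.
  apply: smallest_sub; first exact: sigma_algebra_measurable.
  move=> _ [A GA [B GB <-]]; apply: measurableX.
    by rewrite G1E; exact: sub_sigma_algebra.
  by rewrite G2E; exact: sub_sigma_algebra.
apply: smallest_sub; first exact: smallest_sigma_algebra.
rewrite subUset; split.
- rewrite G1E -[X in X `<=` _]g_sigma_preimageE.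
  apply: smallest_sub; first exact: smallest_sigma_algebra.
  move=> _ [A GA <-]; apply: sub_sigma_algebra; exists A => //; exists setT => //.
  by rewrite setTI setXT.
- rewrite G2E -[X in X `<=` _]g_sigma_preimageE.
  apply: smallest_sub; first exact: smallest_sigma_algebra.
  move=> _ [A GA <-]; apply: sub_sigma_algebra; exists setT => //; exists A => //.
Qed.

End product_rectangles.

Section mutual_independence.
Context {R : realType} {d : measure_display} {T : measurableType d}.
Variable P : probability T R.
Context {I : choiceType} {d' : measure_display} {T' : measurableType d'}.
Variable X : I -> T -> T'.
Hypothesis X_indep : mutually_independent P X.

Lemma mutually_independent_cons (s : seq I) (i : I) (A : I -> set T') (B : set T') :
  uniq s -> i \notin s -> (forall j, measurable (A j)) -> measurable B ->
  (P ((\bigcap_(j in [set` s]) X j @^-1` A j) `&` X i @^-1` B) =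
   P (\bigcap_(j in [set` s]) X j @^-1` A j) * P (X i @^-1` B))%E.
Proof.
(* Overwriting the family at i with B turns the event into one indexed by i :: s, for which the
   product formula is available. *)
move=> us is_ mA mB; pose A' j := if j == i then B else A j.
have mA' j : measurable (A' j) by rewrite /A'; case: ifP.
have A'E j : j \in s -> A' j = A j.
  by rewrite /A'; case: eqP => // ->; rewrite (negbTE is_).
rewrite (X_indep s A us mA) -(eq_big_seq _ (fun j js => congr1 (fun C => P (X j @^-1` C)) (A'E j js))).
have := X_indep (i :: s) A'; rewrite /= is_ us big_cons => /(_ isT mA').
have A'i : A' i = B by rewrite /A' eqxx.
rewrite A'i muleC => <-; congr (P _); apply/seteqP; split=> w /=.
- move=> [h1 h2] j /=; rewrite inE => /predU1P[->|js]; first by rewrite A'i.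
  by rewrite A'E//; exact: h1.
- move=> h; split=> [j /= js|].
    by have := h j; rewrite /= inE js orbT A'E// => /(_ isT).
  by have := h i; rewrite /= mem_head A'i => /(_ isT).
Qed.

End mutual_independence.

Section tuples.
Context {R : realType} {d : measure_display} {T : measurableType d}.

Lemma measurable_mktuple {d'} {T' : measurableType d'} k (f : 'I_k -> T -> T') :
  (forall i, measurable_fun setT (f i)) ->
  measurable_fun setT (fun w => [tuple f i w | i < k]).
Proof.
move=> mf; apply/measurable_fun_tnthP => i.
by rewrite (_ : _ \o _ = f i)//; apply/funext => w /=; rewrite tnth_mktuple.
Qed.

Lemma measurable_sum_cond {I} (s : seq I) (Q : pred I) (h : I -> T -> R) :
  (forall i, Q i -> measurable_fun setT (h i)) ->
  measurable_fun setT (fun x => \sum_(i <- s | Q i) h i x).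
Proof.
move=> mh; under eq_fun do rewrite big_mkcond.
by apply: measurable_sum => i; have := mh i; case: (Q i) => [h'|_]; [exact: h'|exact: measurable_cst].
Qed.

Lemma measurable_tup k (f : T -> 'cV[R]_k) :
  measurable_fun setT (fun w => tup (f w)) <->
  forall i, measurable_fun setT (fun w => f w i 0).
Proof.
split=> [mf i|]; last exact: measurable_mktuple.
have /measurable_fun_tnthP/(_ i) := mf.
by congr measurable_fun; apply/funext => w /=; rewrite tnth_mktuple.
Qed.

Lemma measurable_tnth_comp {d'} {T' : measurableType d'} k (f : T -> k.-tuple T') i :
  measurable_fun setT f -> measurable_fun setT (fun w => tnth (f w) i).
Proof. by move=> /measurable_fun_tnthP/(_ i). Qed.

End tuples.

Definition untup {R : realType} {k} (x : k.-tuple R) : 'cV[R]_k := \col_i tnth x i.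

Lemma tupK {R : realType} k : cancel (@tup R k) (@untup R k).
Proof.
by move=> x; apply/matrixP => i j; rewrite !mxE tnth_mktuple !ord1.
Qed.

(** * Translations of normal vectors *)

Section normal_law.
Context {R : realType} {d : measure_display} {T : measurableType d}.
Variable P : probability T R.
Local Open Scope ereal_scope.
Local Notation N01 := (@normal_prob R 0 1).

Lemma integral_normal_law (W : T -> R) (F : R -> \bar R) :
  measurable_fun setT W ->
  (forall B : set R, measurable B -> P (W @^-1` B) = N01 B) ->
  measurable_fun setT F -> (forall x, 0 <= F x) ->
  \int[P]_w F (W w) = \int[N01]_x F x.
Proof.
move=> mW WN mF F0.
have mW' : @measurable_fun _ _ T (measurableTypeR R) setT W by exact: mW.
pose W' : {mfun T >-> measurableTypeR R} :=
  HB.pack (W : T -> measurableTypeR R) (isMeasurableFun.Build _ _ _ _ _ mW').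
rewrite -[LHS](ge0_integral_distribution (P := P) W' (f := F))//.
by apply: eq_measure_integral => A mA _; exact: WN.
Qed.

Variables (k : nat) (W : 'I_k -> T -> R).
Hypotheses (mW : forall i, measurable_fun setT (W i))
  (WN : forall i (B : set R), measurable B -> P (W i @^-1` B) = N01 B)
  (WI : mutually_independent P W).

(** The coordinates are revealed one at a time, with zeros in the places not yet reached, so that
    translating a vector becomes a recursion of the kind treated by [likelihood_ratio]. *)
Let v n w : R := oapp (fun i => W i w) 0%R (insub n).
Let X1 n w := [tuple if (i < n)%N then W i w else 0%R | i < k].

Let vE n (nk : (n < k)%N) w : v n w = W (Ordinal nk) w.
Proof. by rewrite /v insubT. Qed.

Let mv n : measurable_fun setT (v n).
Proof.
rewrite /v; case: insubP => [i _ _|_] /=; [exact: mW|exact: measurable_cst].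
Qed.

Let mX1 n : measurable_fun setT (X1 n).
Proof.
apply: measurable_mktuple => i.
by case: (i < n)%N; [exact: mW|exact: measurable_cst].
Qed.

Let indepX1 n : (n < k)%N -> indep2 P (X1 n) (v n).
Proof.
move=> nk; apply: (indep2_generated _ (@tuple_rectangles _ R k)) => //.
- exact: measurable_tupleE.
- exact: tuple_rectanglesI.
- exact: tuple_rectanglesT.
move=> _ B [A [mA ->]] mB.
pose s := [seq i : 'I_k <- index_enum 'I_k | (i < n)%N].
(* Unrevealed coordinates are 0: a rectangle that excludes 0 in one of them has an empty preimage,
   and otherwise those coordinates impose nothing. *)
have [A0|A0] := pselect (forall i : 'I_k, (n <= i)%N -> A i 0%R); last first.
  suff -> : X1 n @^-1` [set x | forall i, A i (tnth x i)] = set0.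
    by rewrite set0I measure0 mul0e.
  rewrite -subset0 => w /= h; apply: A0 => i ni.
  by have := h i; rewrite tnth_mktuple ltnNge ni.
have -> : X1 n @^-1` [set x | forall i, A i (tnth x i)] =
    \bigcap_(i in [set` s]) W i @^-1` A i.
  apply/seteqP; split=> w /= h i.
    by rewrite /= mem_filter => /andP[ni _]; have := h i; rewrite tnth_mktuple ni.
  rewrite tnth_mktuple; case: ltnP => ni; last exact: A0.
  by apply: h; rewrite /= mem_filter ni mem_index_enum.
have -> : v n = W (Ordinal nk) by apply/funext => w; rewrite vE.
apply: mutually_independent_cons => //.
- by rewrite filter_uniq// index_enum_uniq.
- by rewrite mem_filter ltnn.
Qed.

(** The Cameron-Martin formula in dimension k, with one coordinate per step: the step that reveals
    coordinate i contributes the one-dimensional density for the shift b i. *)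
Lemma normal_tuple_shift (b : 'I_k -> R) (F : k.-tuple R -> \bar R) :
  measurable_fun setT F -> (forall x, 0 <= F x) ->
  \int[P]_w F [tuple W i w + b i | i < k]%R =
  \int[P]_w (F [tuple W i w | i < k] *
     (expR (\sum_(i < k) (b i * W i w - b i ^+ 2 / 2)))%:E).
Proof.
move=> mF F0.
pose X0 n w := [tuple if (i < n)%N then W i w + b i else 0 | i < k]%R.
pose step0 n (z : k.-tuple R * R) :=
  [tuple if i == n :> nat then z.2 + b i else tnth z.1 i | i < k]%R.
pose step1 n (z : k.-tuple R * R) :=
  [tuple if i == n :> nat then z.2 else tnth z.1 i | i < k]%R.
pose q (s : k.-tuple R) i := (b i * tnth s i - b i ^+ 2 / 2)%R.
pose e n s := expR (\sum_(i < k | i == n :> nat) q s i).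
pose L n s := expR (\sum_(i < k | (i < n)%N) q s i).
have mq i : measurable_fun setT (fun s => q s i).
  apply: measurable_funB => //; apply: measurable_funM => //.
  exact: measurable_tnth_comp.
have := @likelihood_ratio _ _ _ P _ _ (k.-tuple R) R X0 X1 v step0 step1 e L k.
move=> h; have {h} := h _ _ _ _ _ _ _ _ _ _ _ _ _ _ _ _ _ k F (leqnn k) mF F0.
have X0E w : X0 k w = [tuple W i w + b i | i < k]%R.
  by apply: eq_from_tnth => i; rewrite !tnth_mktuple ltn_ord.
have X1E w : X1 k w = [tuple W i w | i < k]%R.
  by apply: eq_from_tnth => i; rewrite !tnth_mktuple ltn_ord.
under eq_integral do rewrite X0E.
under [in RHS]eq_integral do rewrite X1E.
move=> ->.
- apply: eq_integral => w _; congr (_ * (expR _)%:E).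
  by apply: eq_big => [i|i _]; rewrite ?ltn_ord// /q tnth_mktuple.
- move=> n; apply: measurable_mktuple => i.
  by case: (i < n)%N; [exact: measurable_funD|exact: measurable_cst].
- exact: mX1.
- exact: mv.
- move=> n; apply: measurable_mktuple => i; case: (i == n :> nat).
    exact: measurable_funD.
  exact: (measurable_tnth_comp _ _ _ measurable_fst).
- move=> n; apply: measurable_mktuple => i; case: (i == n :> nat).
    exact: measurable_snd.
  exact: (measurable_tnth_comp _ _ _ measurable_fst).
- by move=> n; apply: measurableT_comp => //; exact: measurable_sum_cond.
- by move=> n; apply: measurableT_comp => //; exact: measurable_sum_cond.
- by move=> n s; exact: expR_ge0.
- by move=> n s; exact: expR_ge0.
- move=> n w nk; apply: eq_from_tnth => i; rewrite !tnth_mktuple/= vE ltnS leq_eqVlt.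
  case: eqP => //= ni.
  by congr (W _ w + _)%R; exact: val_inj.
- move=> n w nk; apply: eq_from_tnth => i; rewrite !tnth_mktuple/= vE ltnS leq_eqVlt.
  case: eqP => //= ni.
  by congr (W _ w)%R; exact: val_inj.
- by move=> w; apply: eq_from_tnth => i; rewrite !tnth_mktuple.
- move=> n nk; have := indepX1 _ nk.
  pose f (s : k.-tuple R) := [tuple if (i < n)%N then tnth s i + b i else 0 | i < k]%R.
  have -> : X0 n = f \o X1 n.
    apply/funext => w; apply: eq_from_tnth => i; rewrite !tnth_mktuple.
    by case: ifP.
  apply: indep2_comp; apply: measurable_mktuple => i; case: (i < n)%N => //.
  by apply: measurable_funD => //; exact: measurable_tnth_comp.
- exact: indepX1.
- by move=> s; rewrite /L big1 ?expR0.
- move=> n w w' nk; rewrite /L /e -expRD; congr expR.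
  rewrite (bigID (fun i : 'I_k => (i < n)%N))/=; congr (_ + _)%R.
    apply: eq_big => i; first by rewrite ltnS andbC; case: ltnP => // /ltnW ->.
    by move=> /andP[_ ni]; rewrite /q !tnth_mktuple ltn_eqF ni.
  by apply: eq_bigl => i; rewrite ltnS -leqNgt -eqn_leq.
- move=> n x G nk mG G0; pose i0 := Ordinal nk.
  pose H z := G [tuple if i == n :> nat then z else tnth x i | i < k].
  have mH : measurable_fun setT H.
    apply: (measurableT_comp mG); apply: measurable_mktuple => i.
    by case: (i == n :> nat); [exact: measurable_id|exact: measurable_cst].
  have E0 z : G (step0 n (x, z)) = H (z + b i0)%R.
    congr G; apply: eq_from_tnth => i; rewrite !tnth_mktuple/=.
    by case: eqP => // ni; congr (_ + b _)%R; exact: val_inj.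
  have E1 z : G (step1 n (x, z)) * (e n (step1 n (x, z)))%:E =
      H z * (expR (b i0 * z - b i0 ^+ 2 / 2))%:E.
    congr (_ * (expR _)%:E); rewrite (big_pred1 i0); last first.
      by move=> i.
    by rewrite /q tnth_mktuple/= eqxx.
  under eq_integral do rewrite E0 vE.
  under [in RHS]eq_integral do rewrite E1 vE.
  rewrite (integral_normal_law (W i0) (fun z => H (z + b i0)%R))//; first last.
  + by move=> z; exact: G0.
  + by apply: (measurableT_comp mH); exact: measurable_funD.
  + exact: WN.
  rewrite (integral_normal_law (W i0)
    (fun z => H z * (expR (b i0 * z - b i0 ^+ 2 / 2))%:E))//; first last.
  + by move=> z; apply: mule_ge0; [exact: G0|rewrite lee_fin expR_ge0].
  + apply: emeasurable_funM => //; apply/measurable_EFinP.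
    apply: measurableT_comp => //; exact: measurable_funB.
  + exact: WN.
  by rewrite N01_shift// => z; exact: G0.
Qed.

End normal_law.

Section quadratic_form.
Context {R : realType} {k : nat}.
Implicit Types (S L : 'M[R]_k) (x y : 'cV[R]_k).

Definition qform S x : R := (x^T *m S *m x) 0 0.

Lemma pos_def_unitmx S : pos_def S -> S \in unitmx.
Proof.
move=> [_ S0]; rewrite -row_free_unit -kermx_eq0; apply/rowV0P => v.
move=> /sub_kermxP vS; apply/eqP; apply: contraT => v0.
have := S0 v^T; rewrite trmxK vS mul0mx mxE ltxx; apply.
by apply: contra v0 => /eqP h; rewrite -[v]trmxK h trmx0.
Qed.

Lemma qformE S x : qform S x = \sum_i \sum_j x i 0 * S i j * x j 0.
Proof.
rewrite /qform mxE exchange_big; apply: eq_bigr => j _; rewrite mxE mulr_suml.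
by apply: eq_bigr => i _; rewrite mxE.
Qed.

Section factor.
Variables (S L : 'M[R]_k).
Hypotheses (SL : L *m L^T = S) (SP : pos_def S).

Lemma factor_unitmx : L \in unitmx.
Proof.
by move: (pos_def_unitmx _ SP); rewrite -SL unitmxE det_mulmx unitrM => /andP[].
Qed.

Lemma qform_ge0 x : 0 <= qform (invmx S) x.
Proof.
have uS := pos_def_unitmx _ SP; have [ST S0] := SP.
have [->|x0] := eqVneq x 0; first by rewrite /qform mulmx0 mxE.
have xE : x = S *m (invmx S *m x) by rewrite mulKVmx.
have y0 : invmx S *m x != 0 by apply: contra_neq x0 => h; rewrite xE h mulmx0.
have -> : qform (invmx S) x = qform S (invmx S *m x).
  rewrite {1}xE /qform trmx_mul ST -!mulmxA (mulmxA (invmx S)) mulVmx// mul1mx.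
  by [].
exact/ltW/S0.
Qed.

Lemma factor_invmx : L^T *m invmx S *m L = 1%:M.
Proof.
apply: (can_inj (mulKmx factor_unitmx)); rewrite !mulmxA SL.
by rewrite mulmxV ?pos_def_unitmx// mul1mx mulmx1.
Qed.

(** Whitening: in the coordinates given by L the precision matrix becomes the identity. *)
Lemma qform_factor (x : 'cV[R]_k) :
  qform (invmx S) (L *m x) = \sum_i x i 0 ^+ 2.
Proof.
have -> : qform (invmx S) (L *m x) = (x^T *m (L^T *m invmx S *m L) *m x) 0 0.
  by rewrite /qform trmx_mul !mulmxA.
rewrite factor_invmx mulmx1 mxE.
by apply: eq_bigr => i _; rewrite mxE expr2.
Qed.

End factor.
End quadratic_form.

Section measurable_qform.
Context {R : realType} {d : measure_display} {T : measurableType d}.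

Lemma measurable_qform k (S : 'M[R]_k) (f : T -> 'cV[R]_k) :
  (forall i, measurable_fun setT (fun w => f w i 0)) ->
  measurable_fun setT (fun w => qform S (f w)).
Proof.
move=> mf; under eq_fun do rewrite qformE.
apply: measurable_sum => i; apply: measurable_sum => j.
by apply: measurable_funM => //; apply: measurable_funM.
Qed.

Lemma measurable_mulmx k l (L : 'M[R]_(l, k)) (f : T -> 'cV[R]_k) i :
  (forall i, measurable_fun setT (fun w => f w i 0)) ->
  measurable_fun setT (fun w => (L *m f w) i 0).
Proof.
move=> mf; under eq_fun do rewrite mxE.
by apply: measurable_sum => j; exact: measurable_funM.
Qed.

End measurable_qform.

Section gaussian_vectors.
Context {R : realType} {d : measure_display} {T : measurableType d}.
Variable P : probability T R.
Local Open Scope ereal_scope.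
Variables (k : nat) (S : 'M[R]_k) (V : T -> 'cV[R]_k).
Hypotheses (SP : pos_def S) (VG : gaussian_vector P S V).

(** In whitened coordinates b = L^-1 x the exponent sum of b_i W_i - b_i^2/2 is (|W|^2 - |W -
    b|^2)/2. Rewriting it with the precision matrix removes the factor L and gives a difference of
    two losses. *)
Lemma gaussian_shift (x : 'cV[R]_k) (F : k.-tuple R -> \bar R) :
  measurable_fun setT F -> (forall s, 0 <= F s) ->
  \int[P]_w F (tup (V w + x)%R) =
  \int[P]_w (F (tup (V w)) * (expR (qform (invmx S) (V w) / 2
    - qform (invmx S) (V w - x) / 2))%:E).
Proof.
have [L [W [SL mW WN WI VE]]] := VG.
move=> mF F0; pose b := (invmx L *m x)%R.
have uL := factor_unitmx _ _ SL SP.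
pose f (s : k.-tuple R) := tup (L *m untup s).
have mf : measurable_fun setT f.
  apply/measurable_tup => i; apply: measurable_mulmx => j.
  by under eq_fun do rewrite mxE; exact: measurable_tnth_comp.
have := normal_tuple_shift P k W mW WN WI (fun i => b i 0%R) (F \o f)
  (measurableT_comp mF mf) (fun s => F0 (f s)).
under eq_integral => w _.
  rewrite /= /f (_ : L *m _ = V w + x)%R; first over.
  rewrite VE -{1}(mulKVmx uL x) -mulmxDr; congr (_ *m _).
  by rewrite -/b; clearbody b; apply/matrixP => i j; rewrite !mxE tnth_mktuple !ord1.
move=> ->; apply: eq_integral => w _.
have -> : (F \o f) [tuple W i w | i < k] = F (tup (V w)).
  congr F.
  rewrite /f VE; congr (tup (_ *m _)).
  by apply/matrixP => i j; rewrite !mxE tnth_mktuple.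
congr (_ * (expR _)%:E).
rewrite VE -{1}(mulKVmx uL x) -mulmxBr !(qform_factor _ _ SL SP) !mulr_suml -sumrB.
by rewrite -/b; clearbody b; apply: eq_bigr => i _; rewrite !mxE; field.
Qed.

Lemma gaussian_qform_lty : \int[P]_w (qform (invmx S) (V w))%:E < +oo.
Proof.
have [L [W [SL mW WN WI VE]]] := VG.
under eq_integral do rewrite VE (qform_factor _ _ SL SP) -sumEFin.
rewrite ge0_integral_sum//.
- apply: lte_sum_pinfty => i _; under eq_integral do rewrite mxE.
  apply: le_lt_trans (@N01_second_moment_lty R); rewrite le_eqVlt; apply/orP; left.
  apply/eqP; apply: (integral_normal_law P (W i) (fun z => (z ^+ 2)%:E)) => //.
  + exact: WN.
  + by apply/measurable_EFinP; exact: exprn_measurable.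
  + by move=> z; rewrite lee_fin sqr_ge0.
- move=> i; apply/measurable_EFinP; apply: measurable_funX.
  by under eq_fun do rewrite mxE; exact: mW.
- by move=> i w _; rewrite lee_fin sqr_ge0.
Qed.

(** The bias-variance identity, obtained coordinate by coordinate from [N01_shift_sqr] after
    whitening. *)
Lemma gaussian_qform_shift (x : 'cV[R]_k) :
  \int[P]_w (qform (invmx S) (V w + x)%R)%:E =
  \int[P]_w (qform (invmx S) (V w))%:E + (qform (invmx S) x)%:E.
Proof.
have [L [W [SL mW WN WI VE]]] := VG.
pose b := (invmx L *m x)%R.
have uL := factor_unitmx _ _ SL SP.
have xE : x = (L *m b)%R by rewrite /b mulKVmx.
have m2 (c : R) i : measurable_fun setT (fun w => ((W i w + c) ^+ 2)%:E).
  apply/measurable_EFinP; apply: measurable_funX; exact: measurable_funD.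
have E (c : 'cV[R]_k) w : (qform (invmx S) (V w + L *m c)%R)%:E =
    \sum_i ((W i w + c i 0%R) ^+ 2)%:E.
  rewrite VE -mulmxDr (qform_factor _ _ SL SP) -sumEFin.
  by apply: eq_bigr => i _; rewrite !mxE.
rewrite xE; transitivity (\int[P]_w (\sum_i ((W i w + b i 0) ^+ 2)%:E)%R).
  by apply: eq_integral => w _; rewrite E.
rewrite ge0_integral_sum//; last by move=> i w _; rewrite lee_fin sqr_ge0.
have -> : \int[P]_w (qform (invmx S) (V w))%:E =
    \int[P]_w (\sum_i ((W i w + 0) ^+ 2)%:E)%R.
  apply: eq_integral => w _; rewrite -[V w]addr0 -(mulmx0 _ L) E.
  by apply: eq_bigr => i _; rewrite mxE.
rewrite ge0_integral_sum//; last by move=> i w _; rewrite lee_fin sqr_ge0.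
rewrite (qform_factor _ _ SL SP) -sumEFin -big_split/=.
have law i (c : R) : \int[P]_w ((W i w + c) ^+ 2)%:E =
    \int[normal_prob 0 1]_z ((z + c) ^+ 2)%:E.
  apply: (integral_normal_law P (W i) (fun z => ((z + c) ^+ 2)%:E)) => //.
  + exact: WN.
  + apply/measurable_EFinP; apply: measurable_funX; exact: measurable_funD.
  + by move=> z; rewrite lee_fin sqr_ge0.
apply: eq_bigr => i _; rewrite !law N01_shift_sqr.
by under [in RHS]eq_integral do rewrite addr0.
Qed.

End gaussian_vectors.

(** * The closed loop *)

Section causality.
Context {R : realType} {a b c : nat}.
Implicit Types (f : nat -> 'M[R]_(a, b)) (x y : nat -> 'M[R]_(b, c)).

Lemma eq_conv f x y t :
  (forall s, (s <= t)%N -> x s = y s) -> conv f x t = conv f y t.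
Proof. by move=> xy; apply: eq_bigr => k _; rewrite xy// leq_subr. Qed.

(** A filter without direct term looks only at strictly earlier inputs. This breaks the algebraic
    loop: y_t is determined before u_t, which may use y_t. *)
Lemma eq_conv_strict f x y t : f 0%N = 0 ->
  (forall s, (s < t)%N -> x s = y s) -> conv f x t = conv f y t.
Proof.
move=> f0 xy; apply: eq_bigr => -[[|k] kt] _ /=; first by rewrite f0 !mul0mx.
by rewrite xy// subnSK// leq_subr.
Qed.

Lemma conv_at0 f x : f 0%N = 0 -> conv f x 0 = 0.
Proof. by move=> f0; rewrite /conv big_ord1 f0 mul0mx. Qed.

Lemma convB f f' x t : conv (fun k => f k - f' k) x t = conv f x t - conv f' x t.
Proof. by rewrite /conv -sumrB; apply: eq_bigr => k _; rewrite mulmxBl. Qed.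

End causality.

Section measurable_signals.
Context {R : realType} {d : measure_display} {T : measurableType d}.

Lemma measurable_nth {d'} {T' : measurableType d'} {k} (f : T -> k.-tuple T') x0 t :
  measurable_fun setT f -> measurable_fun setT (fun w => nth x0 (f w) t).
Proof.
move=> mf; have [tk|kt] := ltnP t k.
  rewrite (_ : (fun w => _) = (fun w => tnth (f w) (Ordinal tk))).
    exact: measurable_tnth_comp.
  by apply/funext => w; rewrite (tnth_nth x0).
rewrite (_ : (fun w => _) = cst x0); first exact: measurable_cst.
by apply/funext => w; rewrite nth_default// size_tuple.
Qed.

Definition msignal {k} (x : nat -> T -> 'cV[R]_k) : Prop :=
  forall t i, measurable_fun setT (fun w => x t w i 0).

Lemma msignal_conv {a b} (f : nat -> 'M[R]_(a, b)) (x : nat -> T -> 'cV[R]_b) :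
  msignal x -> msignal (fun t w => conv f (fun s => x s w) t).
Proof.
move=> mx t i; under eq_fun do rewrite summxE.
by apply: measurable_sum => k; apply: measurable_mulmx => j; exact: mx.
Qed.

Lemma msignalD {k} (x y : nat -> T -> 'cV[R]_k) :
  msignal x -> msignal y -> msignal (fun t w => x t w + y t w).
Proof.
move=> mx my t i; under eq_fun do rewrite mxE.
by apply: measurable_funD; [exact: mx|exact: my].
Qed.

Lemma msignalB {k} (x y : nat -> T -> 'cV[R]_k) :
  msignal x -> msignal y -> msignal (fun t w => x t w - y t w).
Proof.
move=> mx my t i; under eq_fun do rewrite !mxE.
by apply: measurable_funB; [exact: mx|exact: my].
Qed.

Lemma msignal_nth {k n} (f : T -> n.-tuple (k.-tuple R)) :
  measurable_fun setT f ->
  msignal (fun t w => untup (nth (tup 0) (f w) t)).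
Proof.
move=> mf t i; under eq_fun do rewrite mxE.
by apply: measurable_tnth_comp; exact: measurable_nth.
Qed.

Lemma measurable_tupE {k} (f : T -> 'cV[R]_k) :
  (forall i, measurable_fun setT (fun w => f w i 0)) ->
  measurable_fun setT (fun w => tup (f w)).
Proof. by move=> mf; apply/measurable_tup. Qed.

End measurable_signals.

Section records.
Context {R : realType} (p m N : nat).
Notation U := (N.-tuple (m.-tuple R)).
Notation Y := (N.-tuple (p.-tuple R)).

Definition rec_u (z : U * Y) (t : nat) : 'cV[R]_m := untup (nth (tup 0) z.1 t).
(** Entry t of an output record is the output at time t + 1, which is why [rec_loss] compares it
    with the prediction at [t.+1]. *)
Definition rec_y (z : U * Y) (t : nat) : 'cV[R]_p := untup (nth (tup 0) z.2 t).

(* The negative log-likelihood of the model [h], up to an additive constant. *)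
Definition rec_loss (S : 'M[R]_p) (h : nat -> 'M[R]_(p, m)) (z : U * Y) : R :=
  \sum_(t < N) qform (invmx S) (rec_y z t - conv h (rec_u z) t.+1) / 2.

Lemma rec_u_msignal : msignal (fun t (z : U * Y) => rec_u z t).
Proof. exact: (msignal_nth _ measurable_fst). Qed.

Lemma rec_y_msignal : msignal (fun t (z : U * Y) => rec_y z t).
Proof. exact: (msignal_nth _ measurable_snd). Qed.

Lemma measurable_rec_loss S h : measurable_fun setT (rec_loss S h).
Proof.
apply: measurable_sum => t; apply: measurable_funM => //.
apply: measurable_qform => i.
exact: (msignalB _ (fun t z => conv h (rec_u z) t.+1) rec_y_msignal
  (fun t => msignal_conv h _ rec_u_msignal t.+1)).
Qed.

End records.
Arguments rec_u {R p m N}.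
Arguments rec_y {R p m N}.
Arguments rec_loss {R p m N}.
Arguments measurable_rec_loss {R p m N}.

Section closed_loop.
Context {R : realType} {d : measure_display} {T : measurableType d}.
Variable P : probability T R.
Local Open Scope ereal_scope.
Variables (p m N : nat) (S : 'M[R]_p) (gu : nat -> 'M[R]_(m, p))
  (v : nat -> T -> 'cV[R]_p) (r : nat -> T -> 'cV[R]_m).
Hypotheses (SP : pos_def S) (mv : forall t, random_vector (v t))
  (mr : forall t, random_vector (r t))
  (vG : forall t, gaussian_vector P S (v t))
  (vI : mutually_independent P (fun t w => tup (v t w)))
  (rvI : independent_processes P (fun t w => tup (r t w)) (fun t w => tup (v t w))).

Local Notation St := (N.+1.-tuple (m.-tuple R) * N.+1.-tuple (p.-tuple R))%type.
Local Notation V := (p.-tuple R).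

Definition sr (s : St) t := untup (nth (tup 0) s.1 t).
Definition sy (s : St) t := untup (nth (tup 0) s.2 t).
Definition su (s : St) t := (conv gu (sy s) t + sr s t)%R.

Lemma msr : msignal (fun t s => sr s t).
Proof. exact: (msignal_nth _ measurable_fst). Qed.
Lemma msy : msignal (fun t s => sy s t).
Proof. exact: (msignal_nth _ measurable_snd). Qed.
Lemma msu : msignal (fun t s => su s t).
Proof. exact: (msignalD _ _ (msignal_conv gu _ msy) msr). Qed.

(** All excitations are in the state from the start, being independent of the noise; outputs not yet
    produced are zeros. The times run from 0 to N because a record ends with y_N. Inputs are not
    stored: [su] recomputes them. *)
Definition state (y : nat -> T -> 'cV[R]_p) n w : St :=
  ([tuple tup (r t w) | t < N.+1],
   [tuple if (t < n)%N then tup (y t w) else tup 0 | t < N.+1]).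

Definition insert n (z : St * 'cV[R]_p) : St :=
  (z.1.1, [tuple if t == n :> nat then tup z.2 else tnth z.1.2 t | t < N.+1]).

Definition step (h : nat -> 'M[R]_(p, m)) n (z : St * V) : St :=
  insert n (z.1, untup z.2 + conv h (su z.1) n)%R.

Lemma nth_mktuple {A : Type} (x0 : A) n (f : 'I_n -> A) t (tn : (t < n)%N) :
  nth x0 [tuple f i | i < n] t = f (Ordinal tn).
Proof. by rewrite -[t]/(nat_of_ord (Ordinal tn)) -tnth_nth tnth_mktuple. Qed.

Lemma sy_state y n t w : (t < n)%N -> (n <= N.+1)%N -> sy (state y n w) t = y t w.
Proof.
move=> tn nN; have tN := leq_trans tn nN.
by rewrite /sy /state/= nth_mktuple /= tn tupK.
Qed.

Lemma sr_state y n t w : (t <= N)%N -> sr (state y n w) t = r t w.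
Proof. by move=> tN; rewrite /sr /state/= nth_mktuple /= tupK. Qed.

Lemma sy_insert n s x t : (t < n)%N -> (n <= N)%N -> sy (insert n (s, x)) t = sy s t.
Proof.
move=> tn nN; have tN : (t < N.+1)%N by rewrite ltnS (leq_trans (ltnW tn)).
rewrite /sy /insert/= nth_mktuple/= ltn_eqF// (tnth_nth (tup 0)).
by [].
Qed.

Lemma sy_insertn n s x : (n <= N)%N -> sy (insert n (s, x)) n = x.
Proof. by move=> nN; rewrite /sy /insert/= nth_mktuple/= eqxx tupK. Qed.

Lemma su_insert n s x t : (t < n)%N -> (n <= N)%N -> su (insert n (s, x)) t = su s t.
Proof.
move=> tn nN; rewrite /su; congr (_ + _)%R; apply: eq_conv => k kt.
by rewrite sy_insert// (leq_ltn_trans kt).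
Qed.

Lemma measurable_insert {d'} {T' : measurableType d'} n (f : T' -> St) (x : T' -> 'cV[R]_p) :
  measurable_fun setT f -> (forall i, measurable_fun setT (fun w => x w i 0%R)) ->
  measurable_fun setT (fun w => insert n (f w, x w)).
Proof.
move=> mf mx; apply: measurable_fun_pair => /=.
  exact: (measurableT_comp measurable_fst).
apply: measurable_mktuple => t; case: (t == n :> nat); first exact: measurable_tupE.
by apply: measurable_tnth_comp; exact: (measurableT_comp measurable_snd).
Qed.

Lemma measurable_step h n : measurable_fun setT (step h n).
Proof.
apply: measurable_insert => // i; under eq_fun do rewrite 2!mxE.
apply: measurable_funD; first exact: (measurable_tnth_comp _ _ _ measurable_snd).
exact: (measurableT_comp (msignal_conv h _ msu n i) measurable_fst).
Qed.

Lemma measurable_state y n : msignal y -> measurable_fun setT (state y n).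
Proof.
move=> my; apply: measurable_fun_pair; apply: measurable_mktuple => t //=.
  exact: mr.
by case: (t < n)%N => //; apply: measurable_tupE; exact: my.
Qed.

Lemma mvs : msignal v.
Proof. by move=> t; apply/measurable_tup; exact: mv. Qed.
Lemma mrs : msignal r.
Proof. by move=> t; apply/measurable_tup; exact: mr. Qed.

(** On rectangles, the independence of excitation and noise splits off the excitations, and the
    mutual independence of the noise then separates time n from the earlier times. *)
Lemma indep_noise n : (n <= N)%N -> indep2 P (state v n) (fun w => tup (v n w)).
Proof.
move=> nN.
apply: (indep2_generated _ (prod_rectangles (@tuple_rectangles _ (m.-tuple R) N.+1)
  (@tuple_rectangles _ (p.-tuple R) N.+1))).
- apply: measurable_prodE; try exact: measurable_tupleE; exact: tuple_rectanglesT.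
- apply: prod_rectanglesI; exact: tuple_rectanglesI.
- apply: prod_rectanglesT; exact: tuple_rectanglesT.
- exact: (measurable_state _ _ mvs).
- exact: mv.
move=> _ B [_ [A [mA ->]] [_ [C [mC ->]] <-]] mB.
have [C0|C0] := pselect (forall i : 'I_N.+1, (n <= i)%N -> C i (tup 0)); last first.
  suff -> : state v n @^-1` ([set x | forall i, A i (tnth x i)] `*`
      [set x | forall i, C i (tnth x i)]) = set0.
    by rewrite set0I measure0 mul0e.
  rewrite -subset0 => w /= [_ h]; apply: C0 => i ni.
  by have := h i; rewrite tnth_mktuple ltnNge ni.
pose EX := \bigcap_(t in `I_N.+1) (fun w => tup (r t w)) @^-1` A (inord t).
pose EV := \bigcap_(t in [set` iota 0 n]) (fun w => tup (v t w)) @^-1` C (inord t).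
have -> : state v n @^-1` ([set x | forall i, A i (tnth x i)] `*`
      [set x | forall i, C i (tnth x i)]) = EX `&` EV.
  apply/seteqP; split=> w /= [h1 h2]; split => t.
  - by rewrite /= => tN; have := h1 (inord t); rewrite tnth_mktuple inordK.
  - rewrite /= mem_iota/= add0n => tn; have := h2 (inord t).
    by rewrite tnth_mktuple inordK ?tn// ltnS (leq_trans (ltnW tn)).
  - by have := h1 t (ltn_ord t); rewrite tnth_mktuple inord_val.
  - rewrite tnth_mktuple; case: ltnP => tn; last exact: C0.
    by have := h2 t; rewrite /= mem_iota/= add0n tn inord_val => /(_ isT).
have mA' t : measurable (A (inord t)) by exact: mA.
have mC' t : measurable (C (inord t)) by exact: mC.
have mtrue : measurable [set: p.-tuple R] by [].
(* [independent_processes] uses one time range for both processes, so the missing noise constraints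
   are padded with [setT]. *)
have EVE : EV = \bigcap_(t in `I_N.+1) (fun w => tup (v t w)) @^-1`
    (if (t < n)%N then C (inord t) else setT).
  apply/seteqP; split=> w h t /=.
    by move=> _; case: ifPn => // tn; have := h t; rewrite /= mem_iota/= add0n tn; apply.
  rewrite mem_iota add0n => /= tn.
  by have := h t; rewrite /= tn => /(_ (leq_trans tn (leqW nN))).
have EVBE : EV `&` (fun w => tup (v n w)) @^-1` B =
    \bigcap_(t in `I_N.+1) (fun w => tup (v t w)) @^-1`
    (if (t < n)%N then C (inord t) else if t == n then B else setT).
  rewrite EVE; apply/seteqP; split=> w.
    move=> [h1 h2] t /= tN; have := h1 t tN; rewrite /=; case: ifP => // _ _.
    by case: eqP => // ->.
  move=> h; split=> [t tN|].
    by have := h t tN; rewrite /=; case: ifP.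
  by have := h n; rewrite /= ltnn eqxx; apply; rewrite ltnS.
have EXV : P (EX `&` EV) = P EX * P EV.
  by rewrite EVE; apply: rvI => // t; case: ifP.
have EXVB : P (EX `&` (EV `&` (fun w => tup (v n w)) @^-1` B)) =
    P EX * P (EV `&` (fun w => tup (v n w)) @^-1` B).
  by rewrite EVBE; apply: rvI => // t; case: ifP => // _; case: ifP.
rewrite -setIA EXVB EXV -muleA; congr (_ * _).
apply: (mutually_independent_cons P (fun t w => tup (v t w)) vI (iota 0 n) n
  (fun t => C (inord t))) => //; first exact: iota_uniq.
by rewrite mem_iota/= add0n ltnn.
Qed.

Definition Rec (s : St) : N.-tuple (m.-tuple R) * N.-tuple (p.-tuple R) :=
  ([tuple tup (su s t) | t < N], [tuple tup (sy s t.+1) | t < N]).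

Lemma mRec : measurable_fun setT Rec.
Proof.
apply: measurable_fun_pair; apply: measurable_mktuple => t; apply: measurable_tupE.
  exact: msu.
exact: msy.
Qed.

Section one_loop.
Variables (h : nat -> 'M[R]_(p, m)) (u : nat -> T -> 'cV[R]_m) (y : nat -> T -> 'cV[R]_p).
Hypotheses (h0 : h 0%N = 0%R) (uy : closed_loop_data h gu v r u y).

Lemma su_state n t w : (t < n)%N -> (n <= N.+1)%N -> su (state y n w) t = u t w.
Proof.
move=> tn nN; rewrite (uy t w).2 /su sr_state; last first.
  by rewrite -ltnS (leq_trans tn).
congr (_ + _)%R; apply: eq_conv => k kt.
by rewrite sy_state// (leq_ltn_trans kt).
Qed.

Lemma stateS n w : (n <= N)%N -> state y n.+1 w = step h n (state y n w, tup (v n w)).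
Proof.
move=> nN; congr pair; apply: eq_from_tnth => t; rewrite !tnth_mktuple/= ltnS leq_eqVlt.
case: eqP => //= tn; rewrite tn (uy n w).1 tupK addrC; congr (tup (_ + _)).
by apply: eq_conv_strict => // k kn; rewrite su_state// ltnW.
Qed.

(** The state of the loop is a measurable function of the excitations and the noise before time n,
    so it inherits the independence proved in [indep_noise]. *)
Lemma state_causal n : (n <= N.+1)%N ->
  exists2 f : St -> St, measurable_fun setT f & state y n = f \o state v n.
Proof.
elim: n => [_|n IHn nN].
  exists id => //; apply/funext => w.
have [f mf fE] := IHn (ltnW nN).
(* Forgetting v_n turns [state v n.+1] into [state v n], the argument expected by the function of
   the previous step. *)
pose trunc (s : St) : St :=
  (s.1, [tuple if (t < n)%N then tnth s.2 t else tup 0 | t < N.+1]).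
have mtrunc : measurable_fun setT trunc.
  apply: measurable_fun_pair => //; apply: measurable_mktuple => t.
  by case: (t < n)%N => //; exact: (measurable_tnth_comp _ _ _ measurable_snd).
exists (fun s => step h n (f (trunc s), nth (tup 0) s.2 n)).
  have mp : measurable_fun setT (fun s : St => (f (trunc s), nth (tup 0) s.2 n)).
    apply: measurable_fun_pair; first exact: measurableT_comp.
    exact: (measurable_nth _ _ _ measurable_snd).
  exact: (measurableT_comp (measurable_step h n) mp).
apply/funext => w; rewrite stateS// fE /=; congr (step _ _ (_, _)).
  congr f; congr pair; apply: eq_from_tnth => t; rewrite !tnth_mktuple/=.
  by case: ifP => // tn; rewrite ltnS ltnW.
by rewrite nth_mktuple/= ltnSn.
Qed.

Lemma indep_state n : (n <= N)%N -> indep2 P (state y n) (fun w => tup (v n w)).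
Proof.
move=> nN; have [f mf ->] := state_causal n (leqW nN).
by apply: indep2_comp => //; exact: indep_noise.
Qed.

Lemma Rec_state w : Rec (state y N.+1 w) = (input_record N u w, output_record N y w).
Proof.
congr (_, _); apply: eq_from_tnth => t; rewrite !tnth_mktuple.
  by rewrite su_state// ltnW// ltnS.
by rewrite sy_state// ltnS.
Qed.

Lemma measurable_loop_state n : measurable_fun setT (state y n).
Proof.
have mst k : (k <= N.+1)%N -> measurable_fun setT (state y k).
  move=> kN; have [f mf ->] := state_causal k kN.
  by apply: measurableT_comp => //; exact: (measurable_state _ _ mvs).
have [/mst//|nN] := leqP n N.+1.
rewrite (_ : state y n = state y N.+1); first exact: mst.
apply/funext => w; congr (_, _); apply: eq_from_tnth => t; rewrite !tnth_mktuple.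
by rewrite ltn_ord (ltn_trans (ltn_ord t) nN).
Qed.

Lemma measurable_record :
  measurable_fun setT (fun w => (input_record N u w, output_record N y w)).
Proof.
rewrite (_ : (fun w => _) = Rec \o state y N.+1).
  exact: (measurableT_comp mRec (measurable_loop_state _)).
by apply/funext => w /=; rewrite Rec_state.
Qed.

Lemma residual_noise w t : (t < N)%N ->
  (rec_y (input_record N u w, output_record N y w) t
  - conv h (rec_u (input_record N u w, output_record N y w)) t.+1 = v t.+1 w)%R.
Proof.
move=> tN; have uE s : (s < t.+1)%N -> rec_u (input_record N u w, output_record N y w) s = u s w.
  move=> st; have sN : (s < N)%N by exact: leq_trans st tN.
  by rewrite /rec_u /= nth_mktuple tupK.
rewrite /rec_y/= nth_mktuple tupK (uy t.+1 w).1 (eq_conv_strict _ _ _ _ h0 uE) addrAC.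
by rewrite subrr add0r.
Qed.

Lemma rec_loss_noise w : rec_loss S h (input_record N u w, output_record N y w) =
  (\sum_(t < N) qform (invmx S) (v t.+1 w) / 2)%R.
Proof. by apply: eq_bigr => t _; rewrite residual_noise. Qed.

Lemma mqv t : measurable_fun setT (fun w => qform (invmx S) (v t w)).
Proof. by apply: measurable_qform => i; exact: mvs. Qed.

Lemma rec_loss_noise_lty :
  \int[P]_w (rec_loss S h (input_record N u w, output_record N y w))%:E < +oo.
Proof.
under eq_integral do rewrite rec_loss_noise -sumEFin.
rewrite ge0_integral_sum//.
- apply: lte_sum_pinfty => t _; under eq_integral do rewrite mulrC EFinM.
  rewrite ge0_integralZl//; last 2 first.
  + by apply/measurable_EFinP; exact: mqv.
  + by move=> w _; rewrite lee_fin qform_ge0.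
  by rewrite lte_mul_pinfty//; exact: (gaussian_qform_lty P p S (v t.+1) SP).
- by move=> t; apply/measurable_EFinP; apply: measurable_funM => //; exact: mqv.
- by move=> t w _; rewrite lee_fin mulr_ge0// qform_ge0.
Qed.

(** The residual of the model h' is the fresh noise plus the response of h - h' to past inputs. The
    two are independent, so conditioning on the past reduces the claim to [gaussian_qform_shift]. *)
Lemma rec_loss_model (h' : nat -> 'M[R]_(p, m)) : h' 0%N = 0%R ->
  \int[P]_w (rec_loss S h' (input_record N u w, output_record N y w))%:E =
  \int[P]_w (rec_loss S h (input_record N u w, output_record N y w))%:E +
  \sum_(t < N) \int[P]_w
     (qform (invmx S) (conv (fun k => h k - h' k)%R (fun s => u s w) t.+1) / 2)%:E.
Proof.
move=> h'0.
pose X t (s : St) := (conv h (su s) t.+1 - conv h' (su s) t.+1)%R.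
have mX t i : measurable_fun setT (fun s => X t s i 0%R).
  exact: (msignalB (fun t s => conv h (su s) t.+1) (fun t s => conv h' (su s) t.+1)
    (fun t => msignal_conv h _ msu t.+1) (fun t => msignal_conv h' _ msu t.+1)).
have XE t w : (t < N)%N ->
    conv (fun k => h k - h' k)%R (fun s => u s w) t.+1 = X t (state y t.+1 w).
  move=> tN; have uE k : (k < t.+1)%N -> su (state y t.+1 w) k = u k w.
    by move=> kt; rewrite su_state// ltnS ltnW.
  by rewrite convB /X !(eq_conv_strict _ _ _ _ _ uE).
have lossE w : (rec_loss S h' (input_record N u w, output_record N y w))%:E =
    \sum_(t < N) (qform (invmx S) (v t.+1 w + X t (state y t.+1 w))%R / 2)%:E.
  rewrite sumEFin; congr EFin; apply: eq_bigr => t _; congr (qform _ _ / _)%R.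
  have uE s : (s < t.+1)%N ->
      rec_u (input_record N u w, output_record N y w) s = u s w.
    move=> st; have sN : (s < N)%N by exact: leq_trans st (ltn_ord t).
    by rewrite /rec_u /= nth_mktuple tupK.
  rewrite -XE// convB -(residual_noise w t)//.
  by rewrite !(eq_conv_strict _ _ _ _ _ uE)// addrA subrK.
under eq_integral do rewrite lossE.
under [in RHS]eq_integral do rewrite rec_loss_noise -sumEFin.
have mvX t : measurable_fun setT (fun w => qform (invmx S) (v t.+1 w + X t (state y t.+1 w))%R).
  apply: measurable_qform => i.
  apply: (msignalD v (fun n w => X n.-1 (state y n w)) mvs _ t.+1 i) => n j.
  exact: (measurableT_comp (mX n.-1 j) (measurable_loop_state n)).
rewrite ge0_integral_sum//; last 2 first.
- by move=> t; apply/measurable_EFinP; apply: measurable_funM.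
- by move=> t w _; rewrite lee_fin mulr_ge0// qform_ge0.
rewrite ge0_integral_sum//; last 2 first.
- by move=> t; apply/measurable_EFinP; apply: measurable_funM => //; exact: mqv.
- by move=> t w _; rewrite lee_fin mulr_ge0// qform_ge0.
rewrite -big_split/=; apply: eq_bigr => t _.
pose F (z : St * V) := (qform (invmx S) (untup z.2 + X t z.1)%R / 2)%:E.
have mF : measurable_fun setT F.
  apply/measurable_EFinP; apply: measurable_funM => //; apply: measurable_qform => i.
  apply: (msignalD (fun _ (z : St * V) => untup z.2) (fun _ (z : St * V) => X t z.1) _ _ 0%N i) => _ j.
    under eq_fun do rewrite mxE.
    exact: (measurable_tnth_comp _ _ _ measurable_snd).
  exact: (measurableT_comp (mX t j) measurable_fst).
have F0 z : 0 <= F z by rewrite lee_fin mulr_ge0// qform_ge0.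
transitivity (\int[P]_w F (state y t.+1 w, tup (v t.+1 w))).
  by apply: eq_integral => w _; rewrite /F /= tupK.
rewrite (indep2_integral P (state y t.+1) (fun w => tup (v t.+1 w)) F)//; first last.
- exact: indep_state.
- exact: mv.
- exact: measurable_loop_state.
under [in X in _ = _ + X]eq_integral do rewrite XE//.
have inner w : \int[P]_w' F (state y t.+1 w, tup (v t.+1 w')) =
    \int[P]_w' (qform (invmx S) (v t.+1 w') / 2)%:E +
    (qform (invmx S) (X t (state y t.+1 w)) / 2)%:E.
  have half x : (qform (invmx S) x / 2)%:E = 2^-1%:E * (qform (invmx S) x)%:E.
    by rewrite -EFinM mulrC.
  under eq_integral do rewrite /F /= tupK half.
  under [in RHS]eq_integral do rewrite half.
  rewrite half !ge0_integralZl//.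
  - by rewrite gaussian_qform_shift// muleDr// ge0_adde_def// inE ?lee_fin ?qform_ge0// integral_ge0// => w' _; rewrite lee_fin qform_ge0.
  - by apply/measurable_EFinP; exact: mqv.
  - by move=> w' _; rewrite lee_fin qform_ge0.
  - apply/measurable_EFinP; apply: measurable_qform => i; under eq_fun do rewrite mxE.
    by apply: measurable_funD => //; exact: mvs.
  - by move=> w' _; rewrite lee_fin qform_ge0.
rewrite (eq_integral _ _ (fun w _ => inner w)).
rewrite ge0_integralD//; first last.
- apply/measurable_EFinP; apply: measurable_funM => //; apply: measurable_qform => i.
  exact: (measurableT_comp (mX t i) (measurable_loop_state _)).
- by move=> w _; rewrite lee_fin mulr_ge0// qform_ge0.
- by move=> w _; apply: integral_ge0 => w' _; rewrite lee_fin mulr_ge0// qform_ge0.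
by rewrite integral_cst//= probability_setT mule1.
Qed.

End one_loop.
Section two_loops.
Variables (g gs : nat -> 'M[R]_(p, m)) (u0 u1 : nat -> T -> 'cV[R]_m)
  (y0 y1 : nat -> T -> 'cV[R]_p).
Hypotheses (g_0 : g 0%N = 0%R) (gs_0 : gs 0%N = 0%R)
  (uy0 : closed_loop_data g gu v r u0 y0) (uy1 : closed_loop_data gs gu v r u1 y1).

(** Density of y_n under g relative to gs given the past: both conditional laws are Gaussian with
    covariance S and differ only in their means, the two predictions. *)
Let e n (s : St) := expR (qform (invmx S) (sy s n - conv gs (su s) n) / 2
  - qform (invmx S) (sy s n - conv g (su s) n) / 2).

Let L n s := (\prod_(t < n) e t s)%R.

Let me n : measurable_fun setT (e n).
Proof.
apply: measurableT_comp => //; apply: measurable_funB; apply: measurable_funM => //;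
  apply: measurable_qform => i.
  exact: (msignalB (fun n s => sy s n) (fun n s => conv gs (su s) n) msy
    (msignal_conv gs _ msu) n i).
exact: (msignalB (fun n s => sy s n) (fun n s => conv g (su s) n) msy
  (msignal_conv g _ msu) n i).
Qed.

Let mL n : measurable_fun setT (L n).
Proof. by apply: measurable_prod => t _; exact: me. Qed.

Let e_insert n t s x : (t < n)%N -> (n <= N)%N -> e t (insert n (s, x)) = e t s.
Proof.
move=> tn nN; rewrite /e (sy_insert _ _ _ _ tn nN).
have su_eq k : (k <= t)%N -> su (insert n (s, x)) k = su s k.
  by move=> kt; rewrite su_insert// (leq_ltn_trans kt).
by rewrite !(eq_conv _ _ _ _ su_eq).
Qed.

Let L_insert n s x : (n <= N)%N ->
  L n.+1 (insert n (s, x)) = (L n s * e n (insert n (s, x)))%R.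
Proof.
move=> nN; have -> : L n s = (\prod_(t < n) e t (insert n (s, x)))%R.
  by apply: eq_bigr => t _; rewrite (e_insert _ _ _ _ (ltn_ord t) nN).
exact: big_ord_recr.
Qed.

Let conv_insert (h : nat -> 'M[R]_(p, m)) n s x : h 0%N = 0%R -> (n <= N)%N ->
  conv h (su (insert n (s, x))) n = conv h (su s) n.
Proof. by move=> h0 nN; apply: eq_conv_strict => // t tn; rewrite su_insert. Qed.

Let L_Rec s : L N.+1 s = expR (rec_loss S gs (Rec s) - rec_loss S g (Rec s)).
Proof.
have uE t k : (t < N)%N -> (k < t.+1)%N -> su s k = rec_u (Rec s) k.
  move=> tN kt; have kN : (k < N)%N by exact: leq_trans kt tN.
  by rewrite /rec_u /= nth_mktuple tupK.
(* At time 0 both predictions vanish and the factor is 1, so the N + 1 factors leave exactly the N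
   terms of the losses. *)
rewrite /L big_ord_recl {1}/e !conv_at0// subrr expR0 mul1r.
rewrite /rec_loss -sumrB expR_sum; apply: eq_bigr => t _; rewrite /e /=.
rewrite !(eq_conv_strict _ _ _ _ _ (fun k => uE t k (ltn_ord t)))//.
by rewrite /rec_y/= nth_mktuple tupK.
Qed.

Lemma closed_loop_density (F : N.-tuple (m.-tuple R) * N.-tuple (p.-tuple R) -> \bar R) :
  measurable_fun setT F -> (forall z, 0 <= F z) ->
  \int[P]_w F (input_record N u0 w, output_record N y0 w) =
  \int[P]_w (F (input_record N u1 w, output_record N y1 w) *
    (expR (rec_loss S gs (input_record N u1 w, output_record N y1 w)
      - rec_loss S g (input_record N u1 w, output_record N y1 w)))%:E).
Proof.
move=> mF F0.
under eq_integral do rewrite -(Rec_state g u0 y0 uy0).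
under [in RHS]eq_integral do rewrite -(Rec_state gs u1 y1 uy1) -L_Rec.
apply: (@likelihood_ratio _ _ _ P _ _ St V (state y0) (state y1)
  (fun t w => tup (v t w)) (step g) (step gs) e L N.+1 _ _ _ _ _ _ _ _ _ _ _ _ _ _ _ _ _
  N.+1 (F \o Rec)) => //.
- exact: (measurable_loop_state g u0 y0 g_0 uy0).
- exact: (measurable_loop_state gs u1 y1 gs_0 uy1).
- exact: measurable_step.
- exact: measurable_step.
- by move=> n s; exact: expR_ge0.
- by move=> n s; apply: prodr_ge0 => t _; exact: expR_ge0.
- by move=> n w nN; exact: (stateS g u0 y0 g_0 uy0).
- by move=> n w nN; exact: (stateS gs u1 y1 gs_0 uy1).
- by move=> n nN; exact: (indep_state g u0 y0 g_0 uy0).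
- by move=> n nN; exact: (indep_state gs u1 y1 gs_0 uy1).
- by move=> s; rewrite /L big_ord0.
- by move=> n w w' nN; exact: L_insert.
- move=> n x G nN mG G0.
  pose H y := G (insert n (x, untup y + conv gs (su x) n)%R).
  have mH : measurable_fun setT H.
    apply: (measurableT_comp mG); apply: measurable_insert => // i.
    under eq_fun do rewrite 2!mxE; apply: measurable_funD => //.
    exact: measurable_tnth_comp.
  have H0 y : 0 <= H y by exact: G0.
  (* Shifting the noise by the difference of the two predictions turns a step of gs into a step of
     g. *)
  have := gaussian_shift P p S (v n) SP (vG n) (conv g (su x) n - conv gs (su x) n)%R H mH H0.
  under eq_integral => w _.
    rewrite /H tupK -addrA subrK; over.
  move=> h; under eq_integral do rewrite /step /= tupK.
  rewrite h; apply: eq_integral => w _; rewrite /H/step/= tupK; congr (_ * (expR _)%:E).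
  by rewrite sy_insertn// !conv_insert// addrK opprB addrA addrAC.
- exact: (measurableT_comp mF mRec).
- by move=> s; exact: F0.
Qed.

End two_loops.
End closed_loop.

(** * Disintegration and the expected divergence *)

Section countable_generation.

(** A kernel identity is first proved for one event at a time, outside a null set that depends on
    the event; countably many generating events leave a single null set. *)
Definition countably_generated {d} (T : measurableType d) : Prop :=
  exists C : nat -> set T, @measurable _ T = <<s range C >>.

Lemma countably_generated_R (R : realType) : countably_generated R.
Proof.
pose C n : set R := oapp (fun q : rat => `]ratr q, +oo[%classic) setT (unpickle n).
exists C; apply/seteqP; split; last first.
  apply: smallest_sub; first exact: sigma_algebra_measurable.
  by move=> _ [n _ <-]; rewrite /C; case: unpickle => //= q; exact: measurable_itv.
rewrite [X in X `<=` _](RGenOInfty.measurableE R).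
apply: smallest_sub; first exact: smallest_sigma_algebra.
move=> _ [x ->].
have -> : `]x, +oo[%classic = \bigcup_n (if unpickle n is Some q then
    (if x < ratr q then `]ratr q, +oo[%classic else set0) else set0) :> set R.
  apply/seteqP; split=> y /=.
    rewrite in_itv/= andbT => xy; have [q] := rat_in_itvoo xy.
    rewrite in_itv/= => /andP[xq qy]; exists (pickle q); first by [].
    by rewrite pickleK xq /= in_itv/= qy.
  move=> [n _]; case: unpickle => // q; case: ifP => // xq /=.
  by rewrite !in_itv/= !andbT; exact: lt_trans.
apply: (@sigma_algebra_bigcup _ setT (range C)) => n.
case E : (unpickle n) => [q|]; last exact: sigma_algebra0.
case: ifP => _; last exact: sigma_algebra0.
by apply: sub_sigma_algebra; exists n => //; rewrite /C E.
Qed.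

Lemma countably_generated_tuple {d} (T : measurableType d) n :
  countably_generated T -> countably_generated (n.-tuple T).
Proof.
move=> [C CE].
pose C' k : set (n.-tuple T) := oapp (fun ij : 'I_n * nat =>
  (fun x : n.-tuple T => tnth x ij.1) @^-1` C ij.2) setT (unpickle k).
have mC k : measurable (C k) by rewrite CE; apply: sub_sigma_algebra; exists k.
exists C'; apply/seteqP; split; last first.
  apply: smallest_sub; first exact: sigma_algebra_measurable.
  move=> _ [k _ <-]; rewrite /C'; case: unpickle => //= -[i j] /=.
  by rewrite -[X in measurable X]setTI; exact: measurable_tnth.
apply: smallest_sub; first exact: smallest_sigma_algebra.
rewrite -bigcup_seq; apply: bigcup_sub => i _.
rewrite CE -[X in X `<=` _]g_sigma_preimageE.
apply: smallest_sub; first exact: smallest_sigma_algebra.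
move=> _ [_ [k _ <-] <-]; apply: sub_sigma_algebra.
by exists (pickle (i, k)) => //; rewrite /C' pickleK setTI.
Qed.

(** Finite intersections of the generators are indexed by finite sequences of integers, hence still
    countable. *)
Lemma countably_generated_pi {d} (T : measurableType d) :
  countably_generated T ->
  exists G : nat -> set T, [/\ @measurable _ T = <<s range G >>,
    setI_closed (range G), range G setT & forall n, measurable (G n)].
Proof.
move=> [C CE].
pose Cs (s : seq nat) := foldr (fun k => setI (C k)) setT s.
pose G n := Cs (odflt [::] (unpickle n)).
have mC k : measurable (C k) by rewrite CE; apply: sub_sigma_algebra; exists k.
have mCs s : measurable (Cs s) by elim: s => //= k s IH; exact: measurableI.
have GCs s : range G (Cs s) by exists (pickle s) => //; rewrite /G pickleK.
have CsD s t : Cs s `&` Cs t = Cs (s ++ t).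
  by elim: s => [|k s IH] /=; rewrite ?setTI// -setIA IH.
exists G; split.
- apply/seteqP; split; last first.
    apply: smallest_sub; first exact: sigma_algebra_measurable.
    by move=> _ [n _ <-]; rewrite /G; exact: mCs.
  rewrite CE; apply: smallest_sub; first exact: smallest_sigma_algebra.
  move=> _ [k _ <-]; apply: sub_sigma_algebra.
  by have := GCs [:: k]; rewrite /= setIT.
- by move=> _ _ [i _ <-] [j _ <-]; rewrite /G CsD.
- exact: (GCs [::]).
- by move=> n; exact: mCs.
Qed.

End countable_generation.

Section disintegration.
Context {R : realType} {dU dY : measure_display} {TU : measurableType dU}
  {TY : measurableType dY}.
Local Open Scope ereal_scope.
Variable K : TU -> probability TY R.
Hypothesis mK : forall B, measurable B -> measurable_fun [set: TU] (K ^~ B).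

(** A name for K to which the kernel structures can be attached. *)
Definition kernel_measure (u : TU) : {measure set TY -> \bar R} := K u.

HB.instance Definition _ := isKernel.Build _ _ _ _ _ kernel_measure mK.
HB.instance Definition _ := Kernel_isProbability.Build _ _ _ _ _ kernel_measure
  (fun u => probability_setT (K u)).

Let pair_with (u : TU) : {mfun TY >-> (TU * TY)%type} :=
  HB.pack (pair u : TY -> TU * TY)%type
    (isMeasurableFun.Build _ _ _ _ _ (pair1_measurable u)).

(** The law of (u, y) when y is drawn from K u. The dummy factor [unit] gives it the shape required
    by the composition [kcomp]. *)
Definition joint_kernel (z : unit * TU) : {measure set (TU * TY) -> \bar R} :=
  distribution (K z.2) (pair_with z.2).

Let joint_kernel_measurable A : measurable A ->
  measurable_fun setT (joint_kernel ^~ A).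
Proof.
move=> mA.
have h : measurable_fun setT (fun u => kernel_measure u (xsection A u)).
  by apply: measurable_fun_xsection_finite_kernel; rewrite inE.
rewrite (_ : joint_kernel ^~ A =
    (fun u => kernel_measure u (xsection A u)) \o (@snd unit TU)).
  exact: (measurableT_comp h measurable_snd).
apply/funext => -[[] u] /=; rewrite /joint_kernel /= /distribution /pushforward.
by congr (K u _); apply/seteqP; split=> y /=; rewrite /xsection/= inE.
Qed.

HB.instance Definition _ := isKernel.Build _ _ _ _ _ joint_kernel joint_kernel_measurable.
HB.instance Definition _ := Kernel_isProbability.Build _ _ _ _ _ joint_kernel
  (fun z => probability_setT (distribution (K z.2) (pair_with z.2))).

Let integral_joint_kernel z (F : TU * TY -> \bar R) :
  measurable_fun setT F -> (forall x, 0 <= F x) ->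
  \int[joint_kernel z]_x F x = \int[K z.2]_y F (z.2, y).
Proof. by move=> mF F0; exact: (ge0_integral_distribution (pair_with z.2) mF F0). Qed.

Lemma measurable_kernel_integral (F : TU * TY -> \bar R) :
  measurable_fun setT F -> (forall x, 0 <= F x) ->
  measurable_fun setT (fun u => \int[K u]_y F (u, y)).
Proof.
move=> mF F0.
rewrite (_ : (fun u => _) = fun u => \int[joint_kernel (tt, u)]_x F x); last first.
  by apply/funext => u; rewrite integral_joint_kernel.
apply: (measurable_fun_integral_kernel (l := fun u => joint_kernel (tt, u))) => // A mA.
exact: (measurableT_comp (joint_kernel_measurable A mA) (pair1_measurable tt)).
Qed.

Context {d : measure_display} {T : measurableType d}.
Variables (P : probability T R) (U : T -> TU) (Y : T -> TY).
Hypotheses (mU : measurable_fun setT U) (mY : measurable_fun setT Y)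
  (KP : conditional_law P U Y K).

(** [conditional_law] says that the law of (U, Y) and the composition of the law of U with
    [joint_kernel] agree on rectangles; hence they are equal, and so are the integrals. *)
Lemma integral_disintegration (F : TU * TY -> \bar R) :
  measurable_fun setT F -> (forall x, 0 <= F x) ->
  \int[P]_w F (U w, Y w) = \int[P]_w \int[K (U w)]_y F (U w, y).
Proof.
move=> mF F0.
pose U' : {mfun T >-> TU} := HB.pack U (isMeasurableFun.Build _ _ _ _ U mU).
have mUY : measurable_fun setT (fun w => (U w, Y w)) by exact: measurable_fun_pair.
pose Z : {mfun T >-> (TU * TY)%type} :=
  HB.pack (fun w => (U w, Y w)) (isMeasurableFun.Build _ _ _ _ _ mUY).
pose l : R.-pker unit ~> TU := kprobability (measurable_cst (distribution P U' : pprobability TU R)).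
have law : forall A, measurable A -> distribution P Z A = kcomp l joint_kernel tt A.
  move=> A mA.
  apply: (measure_unique (prod_rectangles measurable measurable) (fun=> setT)
    _ _ _ _ (distribution P Z) (mkcomp l joint_kernel tt)) => //.
  - exact: measurable_prod_measurableType.
  - by apply: prod_rectanglesI; exact: measurableI.
  - by move=> _; exact: prod_rectanglesT.
  - by rewrite bigcup_const.
  - move=> _ [B mB [C mC <-]].
    transitivity (\int[P]_(w in U @^-1` B) K (U w) C).
      exact: KP.2 B C mB mC.
    rewrite integral_mkcond.
    transitivity (\int[distribution P U']_u ((fun u => K u C) \_ B) u); last first.
      apply: eq_integral => u _; rewrite patchE /joint_kernel/= /distribution/pushforward.
      case: ifPn => [/set_mem|/negP] uB.
        by congr (K u _); apply/seteqP; split=> y //= [].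
      transitivity (K u set0); first by rewrite measure0.
      congr (K u _); apply/seteqP; split=> y //= -[Bu _].
      by apply: uB; rewrite inE.
    rewrite ge0_integral_distribution//.
    + by apply/(measurable_restrictT _ mB); apply: measurable_funTS; exact: mK.
    + by move=> u; rewrite patchE; case: ifP.
  - by move=> _; rewrite /= ltey_eq fin_num_measure.
rewrite -[LHS](ge0_integral_distribution Z mF F0).
rewrite (eq_measure_integral (kcomp l joint_kernel tt)); last by move=> A mA _; exact: law.
rewrite integral_kcomp//.
rewrite [LHS](ge0_integral_distribution U')//.
- by apply: eq_integral => w _; exact: (integral_joint_kernel (tt, U w) F mF F0).
- apply: (measurable_fun_integral_kernel (l := fun u => joint_kernel (tt, u))) => // A mA.
  exact: (measurableT_comp (joint_kernel_measurable A mA) (pair1_measurable tt)).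
- by move=> u; exact: integral_ge0.
Qed.

End disintegration.

Section density_extension.
Context {R : realType} {d : measure_display} {T : measurableType d}.
Local Open Scope ereal_scope.
Variables (Q1 : {measure set T -> \bar R}) (f : T -> \bar R).
Hypotheses (mf : measurable_fun setT f) (f0 : forall x, 0 <= f x).

Definition density_measure (A : set T) : \bar R := \int[Q1]_(x in A) f x.

Let density_measure0 : density_measure set0 = 0.
Proof. exact: integral_set0. Qed.

Let density_measure_ge0 A : 0 <= density_measure A.
Proof. exact: integral_ge0. Qed.

HB.instance Definition _ := isMeasure.Build _ _ _ density_measure
  density_measure0 density_measure_ge0 (semi_sigma_additive_nng_induced mf f0).

Lemma density_unique (Q0 : probability T R) (G : set (set T)) :
  @measurable _ T = <<s G >> -> setI_closed G -> G setT ->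
  (forall A, G A -> Q0 A = \int[Q1]_(x in A) f x) ->
  forall A, measurable A -> Q0 A = \int[Q1]_(x in A) f x.
Proof.
move=> GE GI GT Q0E A mA.
have := measure_unique G (fun=> setT) GE GI (fun=> GT) _ Q0 density_measure.
apply => //; first by rewrite bigcup_const.
by move=> _; rewrite ltey_eq fin_num_measure.
Qed.

End density_extension.

Lemma integral_cst_probability {R : realType} {d} {T : measurableType d}
  (P : probability T R) (r : \bar R) : (\int[P]_x r)%E = r.
Proof.
rewrite (integral_cst _ measurableT).
by rewrite -[RHS]mule1; congr (_ * _)%E; exact: probability_setT.
Qed.

Section KL_density.
Context {R : realType} {d : measure_display} {T : measurableType d}.
Local Open Scope ereal_scope.
Variables (Q0 Q1 : probability T R) (q : T -> R).
Hypotheses (mq : measurable_fun setT q)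
  (Q0E : forall A, measurable A -> Q0 A = \int[Q1]_(x in A) (expR (q x))%:E).

Let mexp : measurable_fun setT (fun x => (expR (q x))%:E).
Proof. by apply/measurable_EFinP; exact: measurableT_comp. Qed.

(** The Radon-Nikodym derivative equals e^q almost everywhere for Q1, hence also for Q0, which is
    dominated by Q1. *)
Lemma KL_density : KL Q0 Q1 = \int[Q0]_x (q x)%:E.
Proof.
have Q01 : Q0 `<< Q1.
  apply/null_content_dominatesP => A mA A0.
  by rewrite Q0E// null_set_integral//; exact: measurable_funTS.
rewrite /KL; case: pselect => [?|//].
set f := Radon_Nikodym _ _.
have fi : Q1.-integrable setT f by exact: Radon_Nikodym_integrable.
have fE : ae_eq Q1 setT f (fun x => (expR (q x))%:E).
  by apply: integral_ae_eq => // A _ mA; rewrite -Q0E// -Radon_Nikodym_integral.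
have {}fE : ae_eq Q0 setT f (fun x => (expR (q x))%:E).
  exact: null_dominates_ae_eq fE.
apply: ae_eq_integral => //.
- apply/measurable_EFinP; apply: measurableT_comp => //.
  exact: (measurableT_comp (fine_measurable _) (measurable_int _ fi)).
- exact/measurable_EFinP.
- by apply: filterS fE => x /= h _; rewrite h//= expRK.
Qed.

(** Gibbs' inequality: q >= 1 - e^-q, and e^-q has Q0-mean Q1(T) = 1. *)
Lemma KL_density_ge0 : Q0.-integrable setT (EFin \o q) -> 0 <= KL Q0 Q1.
Proof.
move=> iq; rewrite KL_density.
have mN : measurable_fun setT (fun x => (expR (- q x))%:E).
  by apply/measurable_EFinP; apply: measurableT_comp => //; exact: measurableT_comp.
have N0 x : 0 <= (expR (- q x))%:E by rewrite lee_fin expR_ge0.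
have int1 : \int[Q0]_x (expR (- q x))%:E = 1.
  rewrite (ge0_integral_density Q0 Q1 (fun x => (expR (q x))%:E))//.
  under eq_integral do rewrite -EFinM -expRD addNr expR0.
  by exact: (integral_cst_probability Q1).
have iN : Q0.-integrable setT (fun x => (expR (- q x))%:E).
  apply/integrableP; split => //.
  by under eq_integral do rewrite gee0_abs//; rewrite int1 ltry.
have i1 : Q0.-integrable setT (cst 1 \- (fun x => (expR (- q x))%:E)).
  by apply: integrableB => //; exact: finite_measure_integrable_cst.
have <- : \int[Q0]_x (cst 1 \- (fun x => (expR (- q x))%:E)) x = 0.
  rewrite integralB//; last exact: finite_measure_integrable_cst.
  by rewrite int1 integral_cst_probability subee.
apply: le_integral => // x _ /=; rewrite lee_fin.
by have := expR_ge1Dx (- q x); lra.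
Qed.

End KL_density.

Section nonmeasurable.
Context {R : realType} {d : measure_display} {T : measurableType d}.
Variable mu : {measure set T -> \bar R}.
Local Open Scope ereal_scope.

Import HBNNSimple.

(** No measurability is asked of f: the integral of its positive part is a supremum over simple
    functions below it, each of which is almost everywhere below g. This serves for the divergence
    as a function of the inputs. *)
Lemma ae_le_integral (f g : T -> \bar R) :
  measurable_fun setT g -> (forall x, 0 <= g x) ->
  {ae mu, forall x, f x <= g x} -> \int[mu]_x f x <= \int[mu]_x g x.
Proof.
move=> mg g0 fg; rewrite integralE.
apply: (@le_trans _ _ (\int[mu]_x (f ^\+) x)).
  by rewrite -[leRHS]sube0 leeB// integral_ge0.
rewrite ge0_integralTE//; apply: ge_ereal_sup => _ [h /= hf <-].
rewrite -integralT_nnsfun; apply: ae_ge0_le_integral => //.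
- by move=> x _; rewrite lee_fin fun_ge0.
- exact/measurable_EFinP.
- apply: filterS fg => x /= fgx _; apply: (le_trans (hf x)).
  by rewrite funeposE ge_max fgx g0.
Qed.

End nonmeasurable.

(** * The expected divergence of conditional laws, from a density of the joint laws *)

Section expected_KL_bound.
Context {R : realType} {d dU dY : measure_display} {T : measurableType d}
  {TU : measurableType dU} {TY : measurableType dY}.
Local Open Scope ereal_scope.
Variables (P : probability T R) (U0 U1 : T -> TU) (Y0 Y1 : T -> TY)
  (K0 K1 : TU -> probability TY R) (a b : TU * TY -> R).
Hypotheses (mU0 : measurable_fun setT U0) (mU1 : measurable_fun setT U1)
  (mY0 : measurable_fun setT Y0) (mY1 : measurable_fun setT Y1)
  (K0P : conditional_law P U0 Y0 K0) (K1P : conditional_law P U1 Y1 K1)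
  (ma : measurable_fun setT a) (mb : measurable_fun setT b)
  (a0 : forall z, (0 <= a z)%R) (b0 : forall z, (0 <= b z)%R)
  (TYC : countably_generated TY)
  (dens : forall F : TU * TY -> \bar R, measurable_fun setT F -> (forall z, 0 <= F z) ->
    \int[P]_w F (U0 w, Y0 w) =
    \int[P]_w (F (U1 w, Y1 w) * (expR (a (U1 w, Y1 w) - b (U1 w, Y1 w)))%:E)).

Let ell z := (expR (a z - b z))%:E.
(** By [law_input], the density of the law of U0 relative to the law of U1. *)
Let c u := \int[K1 u]_y ell (u, y).

Let ell0 z : 0 <= ell z. Proof. by rewrite lee_fin expR_ge0. Qed.

Let mell : measurable_fun setT ell.
Proof. by apply/measurable_EFinP; apply: measurableT_comp => //; exact: measurable_funB. Qed.

Let c0 u : 0 <= c u. Proof. exact: integral_ge0. Qed.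

Let mc : measurable_fun setT c.
Proof. exact: (measurable_kernel_integral K1 K1P.1 ell mell ell0). Qed.

Let law_input (F : TU -> \bar R) : measurable_fun setT F -> (forall u, 0 <= F u) ->
  \int[P]_w F (U0 w) = \int[P]_w (F (U1 w) * c (U1 w)).
Proof.
move=> mF F0; have mF1 : measurable_fun setT (F \o @fst TU TY) by exact: measurableT_comp.
rewrite (dens (F \o fst) mF1 (fun z => F0 z.1)).
have mFe : measurable_fun setT (fun z : TU * TY => F z.1 * ell z).
  by apply: emeasurable_funM.
have Fe0 z : 0 <= F z.1 * ell z by rewrite mule_ge0.
rewrite (integral_disintegration K1 K1P.1 P U1 Y1 mU1 mY1 K1P _ mFe Fe0).
apply: eq_integral => w _ /=; rewrite ge0_integralZl//.
by exact: (measurableT_comp mell (pair1_measurable _)).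
Qed.

Let mu1 := distribution P (HB.pack U1 (isMeasurableFun.Build _ _ _ _ U1 mU1) : {mfun T >-> TU}).

Let integral_mu1 (F : TU -> \bar R) : measurable_fun setT F -> (forall u, 0 <= F u) ->
  \int[mu1]_u F u = \int[P]_w F (U1 w).
Proof. by move=> mF F0; rewrite ge0_integral_distribution. Qed.

Let int_c : \int[mu1]_u c u = 1.
Proof.
rewrite integral_mu1//; apply/esym; have := law_input (cst 1) (measurable_cst _) (fun=> lee01).
rewrite [LHS](_ : _ = 1); last exact: integral_cst_probability.
by move=> ->; apply: eq_integral => w _; rewrite mul1e.
Qed.

(** The law of U0 has a density relative to [mu1], so it does not charge the null sets of [mu1]. *)
Let ae_input (Q : TU -> Prop) : {ae mu1, forall u, Q u} -> {ae P, forall w, Q (U0 w)}.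
Proof.
move=> [N [mN N0 NQ]]; have mUN : measurable (U0 @^-1` N).
  by rewrite -[X in measurable X]setTI; exact: mU0.
exists (U0 @^-1` N); split => //; last by move=> w /= nQ; exact: NQ.
have mN1 : measurable_fun setT (fun u : TU => (\1_N u : R)%:E).
  exact/measurable_EFinP.
have N10 u : 0 <= (\1_N u : R)%:E by [].
have := law_input _ mN1 N10.
rewrite -(integral_mu1 (fun u => (\1_N u)%:E * c u)); last 2 first.
- exact: emeasurable_funM.
- by move=> u; rewrite mule_ge0.
have -> : \int[mu1]_u ((\1_N u)%:E * c u) = 0.
  transitivity (\int[mu1]_(u in N) c u).
    rewrite [RHS]integral_mkcond; apply: eq_integral => u _.
    by rewrite patchE indicE; case: ifP => _; rewrite ?mul1e ?mul0e.
  by apply: null_set_integral => //; exact: measurable_funTS.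
rewrite -[LHS](_ : P (U0 @^-1` N) = _)//.
have := integral_indic P measurableT mUN.
by rewrite setIT => <-.
Qed.

(** Bayes' formula for one event B: both sides have the same integral over every measurable set A of
    inputs, namely the probability that U0 is in A and Y0 in B. *)
Let kernel_density B : measurable B ->
  {ae mu1, forall u, c u * K0 u B = \int[K1 u]_(y in B) ell (u, y)}.
Proof.
move=> mB.
have mK0 : measurable_fun setT (K0 ^~ B) by exact: K0P.1.
have mF A : measurable A ->
    measurable_fun setT (fun z : TU * TY => (\1_(A `*` B) z)%:E * ell z).
  by move=> mA; apply: emeasurable_funM => //; apply/measurable_EFinP;
    apply: measurable_indic; exact: measurableX.
have FB0 A z : 0 <= (\1_(A `*` B) z : R)%:E * ell z by rewrite mule_ge0.
have indic_section A u : \int[K1 u]_y ((\1_(A `*` B) (u, y) : R)%:E * ell (u, y)) =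
    (\1_A u : R)%:E * \int[K1 u]_(y in B) ell (u, y).
  rewrite -ge0_integralZl//=; last first.
    apply: measurable_funTS.
    exact: (measurableT_comp mell (pair1_measurable _)).
  rewrite [RHS]integral_mkcond; apply: eq_integral => y _.
  rewrite patchE !indicE in_setX /=.
  by case: (u \in A); case: (y \in B); rewrite ?mul1e ?mul0e.
have mk : measurable_fun setT (fun u => \int[K1 u]_(y in B) ell (u, y)).
  have := measurable_kernel_integral K1 K1P.1 _ (mF setT measurableT) (FB0 setT).
  rewrite (_ : (fun u => \int[K1 u]_(y in B) ell (u, y)) =
    fun u => \int[K1 u]_y ((\1_(setT `*` B) (u, y) : R)%:E * ell (u, y)))//; last first.
  by apply/funext => u; rewrite indic_section indicT mul1e.
have mcK : measurable_fun setT (fun u => c u * K0 u B) by exact: emeasurable_funM.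
have : ae_eq mu1 setT (fun u => c u * K0 u B) (fun u => \int[K1 u]_(y in B) ell (u, y)).
  apply: integral_ae_eq => //.
  - apply/integrableP; split => //.
    apply: (@le_lt_trans _ _ (\int[mu1]_u c u)); last by rewrite int_c ltry.
    apply: ge0_le_integral => //; first exact: measurableT_comp.
    by move=> u _; rewrite gee0_abs ?mule_ge0// -[leRHS]mule1 lee_wpmul2l ?probability_le1.
  - move=> A _ mA; have mUA : measurable (U0 @^-1` A).
      by rewrite -[X in measurable X]setTI; exact: mU0.
    have indicI (F : TU -> \bar R) : \int[mu1]_(u in A) F u = \int[mu1]_u ((\1_A u : R)%:E * F u).
      rewrite integral_mkcond; apply: eq_integral => u _.
      by rewrite patchE indicE; case: ifP => _; rewrite ?mul1e ?mul0e.
    have mA1 : measurable_fun setT (fun u : TU => (\1_A u : R)%:E) by exact/measurable_EFinP.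
    rewrite !indicI !integral_mu1//; last 4 first.
    + by apply: emeasurable_funM.
    + by move=> u; rewrite mule_ge0// integral_ge0.
    + by apply: emeasurable_funM.
    + by move=> u; rewrite !mule_ge0.
    transitivity (\int[P]_w ((\1_A (U0 w) : R)%:E * K0 (U0 w) B)).
      rewrite (law_input (fun u => (\1_A u : R)%:E * K0 u B)).
      * by apply: eq_integral => w _; rewrite -muleA [c _ * _]muleC.
      * exact: emeasurable_funM.
      * by move=> u; rewrite mule_ge0.
    transitivity (\int[P]_(w in U0 @^-1` A) K0 (U0 w) B).
      rewrite [RHS]integral_mkcond; apply: eq_integral => w _.
      rewrite patchE indicE [in RHS](_ : (w \in _) = (U0 w \in A)); last first.
        by apply/idP/idP; rewrite !inE.
      by case: ifP => _; rewrite ?mul1e ?mul0e.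
    rewrite -(K0P.2 A B mA mB).
    have mYB : measurable (Y0 @^-1` B) by rewrite -[X in measurable X]setTI; exact: mY0.
    have := integral_indic P measurableT (measurableI _ _ mUA mYB).
    rewrite setIT => <-.
    have mAB1 : measurable_fun setT (fun z : TU * TY => (\1_(A `*` B) z : R)%:E).
      by apply/measurable_EFinP; apply: measurable_indic; exact: measurableX.
    have AB0 z : 0 <= (\1_(A `*` B) z : R)%:E by [].
    transitivity (\int[P]_w (\1_(A `*` B) (U0 w, Y0 w) : R)%:E) => //.
    rewrite (dens _ mAB1 AB0).
    rewrite (integral_disintegration K1 K1P.1 P U1 Y1 mU1 mY1 K1P _ (mF A mA) (FB0 A)).
    by apply: eq_integral => w _; rewrite indic_section.
by apply: filterS => u; apply.
Qed.

Let Ka u := \int[K0 u]_y (a (u, y))%:E.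
Let Kb u := \int[K0 u]_y (b (u, y))%:E.

(** A measurable version of the conditional divergence. Where the integrals are infinite or c
    vanishes, [fine] and [ln] return default values; the maximum with 0 keeps k nonnegative there
    and changes nothing elsewhere. *)
Let k u := Num.max 0%R (fine (Ka u) - fine (Kb u) - ln (fine (c u)))%R.

Let ma' : measurable_fun setT (EFin \o a). Proof. exact/measurable_EFinP. Qed.
Let mb' : measurable_fun setT (EFin \o b). Proof. exact/measurable_EFinP. Qed.

Let mKa : measurable_fun setT Ka.
Proof. by apply: (measurable_kernel_integral K0 K0P.1 (EFin \o a)) => // z; rewrite lee_fin. Qed.
Let mKb : measurable_fun setT Kb.
Proof. by apply: (measurable_kernel_integral K0 K0P.1 (EFin \o b)) => // z; rewrite lee_fin. Qed.

Let mk : measurable_fun setT k.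
Proof.
have mf (F : TU -> \bar R) : measurable_fun setT F -> measurable_fun setT (fun u => fine (F u)).
  by move=> mF; exact: (measurableT_comp (fine_measurable _) mF).
apply: measurable_maxr => //; apply: measurable_funB.
  by apply: measurable_funB; exact: mf.
by apply: measurableT_comp => //; exact: mf.
Qed.

Let c_pos : {ae P, forall w, c (U0 w) != 0}.
Proof.
pose N := c @^-1` [set 0].
have mN : measurable N by rewrite -[N]setTI; exact: mc.
have mUN : measurable (U0 @^-1` N) by rewrite -[X in measurable X]setTI; exact: mU0.
exists (U0 @^-1` N); split => //; last by move=> w /= /negP; rewrite negbK => /eqP.
have mN1 : measurable_fun setT (fun u : TU => (\1_N u : R)%:E) by exact/measurable_EFinP.
have N10 u : 0 <= (\1_N u : R)%:E by [].
have := integral_indic P measurableT mUN; rewrite setIT => <-.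
transitivity (\int[P]_w (\1_N (U0 w) : R)%:E) => //.
rewrite (law_input _ mN1 N10); apply: integral0_eq => w _.
rewrite indicE; case: (boolP (U1 w \in N)); last by rewrite mul0e.
by rewrite inE => ->; rewrite mule0.
Qed.

(** The second claim adds 1 - ln c <= 1/c to the formula for the divergence. It is kept in additive
    form so that both sides can be integrated as sums of nonnegative functions. *)
Let good w : c (U0 w) != 0 -> c (U0 w) \is a fin_num -> Ka (U0 w) < +oo -> Kb (U0 w) < +oo ->
  (forall B, measurable B -> c (U0 w) * K0 (U0 w) B = \int[K1 (U0 w)]_(y in B) ell (U0 w, y)) ->
  KL (K0 (U0 w)) (K1 (U0 w)) = (k (U0 w))%:E /\
  (k (U0 w))%:E + Kb (U0 w) + 1 <= Ka (U0 w) + ((fine (c (U0 w)))^-1)%:E.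
Proof.
move: (U0 w) => u cu cfin Kau Kbu dens_u.
have cu0 : (0 < fine (c u))%R by rewrite fine_gt0// lt0e cu c0 ltey_eq cfin.
have au0 : 0 <= Ka u by apply: integral_ge0 => y _; rewrite lee_fin.
have bu0 : 0 <= Kb u by apply: integral_ge0 => y _; rewrite lee_fin.
pose q y := (a (u, y) - b (u, y) - ln (fine (c u)))%R.
have mau : measurable_fun setT (fun y => a (u, y)).
  exact: (measurableT_comp ma (pair1_measurable u)).
have mbu : measurable_fun setT (fun y => b (u, y)).
  exact: (measurableT_comp mb (pair1_measurable u)).
have mq : measurable_fun setT q by apply: measurable_funB => //; exact: measurable_funB.
have K0E B : measurable B -> K0 u B = \int[K1 u]_(y in B) (expR (q y))%:E.
  move=> mB.
  have -> : \int[K1 u]_(y in B) (expR (q y))%:E =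
      ((fine (c u))^-1)%:E * \int[K1 u]_(y in B) ell (u, y).
    rewrite -ge0_integralZl//; last 2 first.
    - apply: measurable_funTS; exact: (measurableT_comp mell (pair1_measurable u)).
    - by rewrite lee_fin invr_ge0 ltW.
    apply: eq_integral => y _; rewrite /ell -EFinM /q expRD expRN lnK ?posrE//.
    by rewrite mulrC.
  rewrite -dens_u// -[c u in RHS]fineK// muleA -EFinM mulVf ?mul1e// gt_eqF//.
have ia : (K0 u).-integrable setT (fun y => (a (u, y))%:E).
  apply/integrableP; split; first exact/measurable_EFinP.
  by under eq_integral do rewrite gee0_abs ?lee_fin//.
have ib : (K0 u).-integrable setT (fun y => (b (u, y))%:E).
  apply/integrableP; split; first exact/measurable_EFinP.
  by under eq_integral do rewrite gee0_abs ?lee_fin//.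
have ic : (K0 u).-integrable setT (fun=> (ln (fine (c u)))%:E).
  exact: finite_measure_integrable_cst.
have iab : (K0 u).-integrable setT ((fun y => (a (u, y))%:E) \- (fun y => (b (u, y))%:E)).
  exact: integrableB.
have iq : (K0 u).-integrable setT (EFin \o q).
  by have := integrableB measurableT iab ic.
have KLE : KL (K0 u) (K1 u) = (fine (Ka u) - fine (Kb u) - ln (fine (c u)))%:E.
  rewrite (KL_density _ _ q mq K0E) EFinB EFinB !fineK ?ge0_fin_numE//.
  have h := integralB measurableT iab ic; rewrite (integralB measurableT ia ib) in h.
  by apply: (etrans h); congr (_ - _); exact: integral_cst_probability.
have KL0 := KL_density_ge0 _ _ q mq K0E iq.
have kE : k u = (fine (Ka u) - fine (Kb u) - ln (fine (c u)))%R.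
  by rewrite /k max_r// -lee_fin -KLE.
split; first by rewrite kE.
rewrite kE -[Kb u]fineK ?ge0_fin_numE// -[Ka u in leRHS]fineK ?ge0_fin_numE//.
rewrite -!EFinD lee_fin.
have := expR_ge1Dx (- ln (fine (c u))); rewrite expRN lnK ?posrE//; lra.
Qed.

(** Integrating the second claim of [good] leaves an extra 1 on the left and E(1/c) on the right;
    the latter is at most 1, so they cancel. *)
Lemma expected_KL_le :
  \int[P]_w (a (U0 w, Y0 w))%:E < +oo -> \int[P]_w (b (U0 w, Y0 w))%:E < +oo ->
  \int[P]_w KL (K0 (U0 w)) (K1 (U0 w)) + \int[P]_w (b (U0 w, Y0 w))%:E <=
  \int[P]_w (a (U0 w, Y0 w))%:E.
Proof.
rewrite (integral_disintegration K0 K0P.1 P U0 Y0 mU0 mY0 K0P (EFin \o a))//.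
rewrite (integral_disintegration K0 K0P.1 P U0 Y0 mU0 mY0 K0P (EFin \o b))//.
move=> Ea Eb.
have a0' u : 0 <= Ka u by apply: integral_ge0 => y _; rewrite lee_fin.
have b0' u : 0 <= Kb u by apply: integral_ge0 => y _; rewrite lee_fin.
have mKa0 : measurable_fun setT (fun w => Ka (U0 w)) by exact: measurableT_comp.
have mKb0 : measurable_fun setT (fun w => Kb (U0 w)) by exact: measurableT_comp.
have mk0 : measurable_fun setT (fun w => (k (U0 w))%:E).
  by apply/measurable_EFinP; exact: measurableT_comp.
have k0 w : 0 <= (k (U0 w))%:E by rewrite lee_fin le_max lexx.
have aea : {ae P, forall w, Ka (U0 w) < +oo}.
  have iKa : P.-integrable setT (fun w => Ka (U0 w)).
    by apply/integrableP; split => //; under eq_integral do rewrite gee0_abs//.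
  apply: filterS (integrable_ae measurableT iKa) => w /(_ I).
  by rewrite ge0_fin_numE.
have aeb : {ae P, forall w, Kb (U0 w) < +oo}.
  have iKb : P.-integrable setT (fun w => Kb (U0 w)).
    by apply/integrableP; split => //; under eq_integral do rewrite gee0_abs//.
  apply: filterS (integrable_ae measurableT iKb) => w /(_ I).
  by rewrite ge0_fin_numE.
have aec : {ae P, forall w, c (U0 w) \is a fin_num}.
  apply: (ae_input (fun u => c u \is a fin_num)).
  have ic : mu1.-integrable setT c.
    apply/integrableP; split => //; under eq_integral do rewrite gee0_abs//.
    by rewrite int_c ltry.
  by apply: filterS (integrable_ae measurableT ic) => u; apply.
have [G [GE GI GT mG]] := countably_generated_pi TY TYC.
(* Bayes' formula on the countable pi-system outside one null set; [density_unique] extends it below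
   to all events. *)
have aeG : {ae P, forall w, forall n,
    c (U0 w) * K0 (U0 w) (G n) = \int[K1 (U0 w)]_(y in G n) ell (U0 w, y)}.
  apply: (ae_input (fun u => forall n, c u * K0 u (G n) = \int[K1 u]_(y in G n) ell (u, y))).
  by apply/ae_foralln => n; exact: kernel_density.
have aegood : {ae P, forall w, KL (K0 (U0 w)) (K1 (U0 w)) = (k (U0 w))%:E /\
    (k (U0 w))%:E + Kb (U0 w) + 1 <= Ka (U0 w) + ((fine (c (U0 w)))^-1)%:E}.
  near=> w; apply: good.
  - by near: w; exact: c_pos.
  - by near: w; exact: aec.
  - by near: w; exact: aea.
  - by near: w; exact: aeb.
  - have cw : c (U0 w) != 0 by near: w; exact: c_pos.
    have cfin : c (U0 w) \is a fin_num by near: w; exact: aec.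
    have Gw n : c (U0 w) * K0 (U0 w) (G n) = \int[K1 (U0 w)]_(y in G n) ell (U0 w, y).
      by move: n; near: w; exact: aeG.
    move: (U0 w) cw cfin Gw => u cw cfin Gw B mB.
    have cu0 : (0 < fine (c u))%R by rewrite fine_gt0// lt0e cw c0 ltey_eq cfin.
    have mellu : measurable_fun setT (fun y => ell (u, y)).
      exact: (measurableT_comp mell (pair1_measurable u)).
    pose f y := ((fine (c u))^-1)%:E * ell (u, y).
    have mfu : measurable_fun setT f by exact: emeasurable_funM.
    have f0 y : 0 <= f y by rewrite mule_ge0// lee_fin invr_ge0 ltW.
    have fE A : measurable A -> \int[K1 u]_(y in A) f y =
        ((fine (c u))^-1)%:E * \int[K1 u]_(y in A) ell (u, y).
      move=> mA; rewrite ge0_integralZl//; last by rewrite lee_fin invr_ge0 ltW.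
      exact: measurable_funTS.
    rewrite (density_unique (K1 u) f mfu f0 (K0 u) (range G) GE GI GT)//.
      rewrite fE// muleA -[c u]fineK// -EFinM mulfV ?mul1e// gt_eqF//.
    move=> _ [n _ <-]; rewrite fE// -Gw -[c u in RHS]fineK// muleA -EFinM mulVf ?mul1e//.
    by rewrite gt_eqF.
apply: (@le_trans _ _ (\int[P]_w (k (U0 w))%:E + \int[P]_w Kb (U0 w))).
  rewrite leeD2r// ae_le_integral//.
  by apply: filterS aegood => w [-> _].
pose ic u := ((fine (c u))^-1)%:E.
have ic0 u : 0 <= ic u by rewrite lee_fin invr_ge0 fine_ge0.
have mic : measurable_fun setT ic.
  rewrite (_ : ic = fun u => (fine (c u) `^ (- 1))%:E).
    apply/measurable_EFinP; apply: (measurableT_comp (measurable_powR _)).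
    exact: (measurableT_comp (fine_measurable _) mc).
  by apply/funext => u; rewrite powR_inv1// fine_ge0.
(* Changing to the law of U1 multiplies by c, and c^-1 c is 1, or 0 where c is 0 or infinite because
   [fine] and the inverse then give 0. *)
have Eic : \int[P]_w ic (U0 w) <= 1.
  rewrite (law_input ic mic ic0) -[leRHS](integral_cst_probability P).
  apply: ge0_le_integral => //.
  - by move=> w _; rewrite mule_ge0.
  - by apply: emeasurable_funM; exact: measurableT_comp.
  - move=> w _; have := c0 (U1 w); rewrite /ic; case: (c (U1 w)) => [r| |]//= r0.
      by rewrite -EFinM lee_fin; have [->|r0'] := eqVneq r 0%R; rewrite ?mulr0// mulVf.
    by rewrite invr0 mul0e.
have : \int[P]_w ((k (U0 w))%:E + Kb (U0 w) + 1) <= \int[P]_w (Ka (U0 w) + ic (U0 w)).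
  apply: ae_ge0_le_integral => //.
  - by move=> w _; apply: adde_ge0 => //; exact: adde_ge0.
  - by apply: emeasurable_funD => //; exact: emeasurable_funD.
  - by move=> w _; rewrite adde_ge0.
  - by apply: emeasurable_funD => //; exact: measurableT_comp.
  - by apply: filterS aegood => w [_ h] _.
have mic0 : measurable_fun setT (fun w => ic (U0 w)) by exact: measurableT_comp.
have -> : \int[P]_w ((k (U0 w))%:E + Kb (U0 w) + 1) =
    \int[P]_w (k (U0 w))%:E + \int[P]_w Kb (U0 w) + 1.
  rewrite ge0_integralD//; first last.
  - exact: emeasurable_funD.
  - by move=> w _; exact: adde_ge0.
  by rewrite ge0_integralD// integral_cst_probability.
rewrite [in leRHS]ge0_integralD// => h.
have : \int[P]_w (k (U0 w))%:E + \int[P]_w Kb (U0 w) + 1 <= \int[P]_w Ka (U0 w) + 1.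
  by apply: (le_trans h); rewrite leeD2l.
by rewrite leeD2rE.
Unshelve. all: by end_near. Qed.

End expected_KL_bound.

(** * Trigonometric integrals and the power spectrum *)

Section complex_facts.
Context {R : realType}.
Implicit Types (z w : CC R) (x y : R).

Lemma ReD z w : complex.Re (z + w) = complex.Re z + complex.Re w.
Proof. by case: z w => [a b] [c d]. Qed.

Lemma cReM z w : complex.Re (z * w) =
  complex.Re z * complex.Re w - complex.Im z * complex.Im w.
Proof. by case: z w => [a b] [c d]. Qed.

Lemma ImD z w : complex.Im (z + w) = complex.Im z + complex.Im w.
Proof. by case: z w => [a b] [c d]. Qed.

Lemma cImM z w : complex.Im (z * w) =
  complex.Re z * complex.Im w + complex.Im z * complex.Re w.
Proof. by case: z w => [a b] [c d]. Qed.

Lemma Re_sum (I : Type) (s : seq I) (Q : pred I) (F : I -> CC R) :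
  complex.Re (\sum_(i <- s | Q i) F i) = \sum_(i <- s | Q i) complex.Re (F i).
Proof. by elim/big_rec2: _ => // i x y _ <-; rewrite ReD. Qed.

Lemma ReB z w : complex.Re (z - w) = complex.Re z - complex.Re w.
Proof. by case: z w => [a b] [c d]. Qed.

Lemma ImB z w : complex.Im (z - w) = complex.Im z - complex.Im w.
Proof. by case: z w => [a b] [c d]. Qed.

Lemma Im_sum (I : Type) (s : seq I) (Q : pred I) (F : I -> CC R) :
  complex.Im (\sum_(i <- s | Q i) F i) = \sum_(i <- s | Q i) complex.Im (F i).
Proof. by elim/big_rec2: _ => // i x y _ <-; case: (F i) y => [a b] [c d]. Qed.

Lemma Im_toCM x z : complex.Im (toC x * z) = x * complex.Im z.
Proof. by case: z => a b /=; rewrite mul0r addr0. Qed.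

Lemma Re_toCM x z : complex.Re (toC x * z) = x * complex.Re z.
Proof. by rewrite cReM /= mul0r subr0. Qed.

Lemma Re_conjM z w : complex.Re (z * conjc w) =
  complex.Re z * complex.Re w + complex.Im z * complex.Im w.
Proof. by case: z w => [a b] [c d] /=; rewrite mulrN opprK. Qed.

Lemma cabs_sqr z : cabs z ^+ 2 = complex.Re z ^+ 2 + complex.Im z ^+ 2.
Proof. by case: z => a b; rewrite /cabs /= sqr_sqrtr// addr_ge0 ?sqr_ge0. Qed.

Lemma cReV z : complex.Re z^-1 = complex.Re z * (cabs z ^+ 2)^-1.
Proof. by rewrite cabs_sqr; case: z. Qed.

Lemma cImV z : complex.Im z^-1 = - (complex.Im z * (cabs z ^+ 2)^-1).
Proof. by rewrite cabs_sqr; case: z. Qed.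

Lemma cabs_sqrE z : cabs z ^+ 2 = complex.Re (z * conjc z).
Proof. by rewrite cabs_sqr Re_conjM -!expr2. Qed.

Lemma cabs_ge0 z : 0 <= cabs z.
Proof. by case: z => a b; rewrite /cabs /= sqrtr_ge0. Qed.

Lemma cabsM z w : cabs (z * w) = cabs z * cabs w.
Proof. exact: Normc.normcM. Qed.

Lemma cabsV z : cabs z^-1 = (cabs z)^-1.
Proof. exact: Normc.normcV. Qed.

Lemma cabsD z w : cabs (z + w) <= cabs z + cabs w.
Proof. exact: le_normcD. Qed.

Lemma cabsN z : cabs (- z) = cabs z.
Proof. exact: normcN. Qed.

Lemma cabs0 : cabs (0 : CC R) = 0. Proof. exact: Normc.normc0. Qed.
Lemma cabs1 : cabs (1 : CC R) = 1. Proof. exact: Normc.normc1. Qed.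

Lemma cabs_eq0 z : (cabs z == 0) = (z == 0).
Proof. by apply/eqP/eqP => [/Normc.eq0_normc//|->]; rewrite cabs0. Qed.

Lemma cabsX z n : cabs (z ^+ n) = cabs z ^+ n.
Proof. by elim: n => [|n IH]; rewrite ?expr0 ?cabs1// !exprS cabsM IH. Qed.

Lemma cabsJ z : cabs (conjc z) = cabs z.
Proof. by case: z => a b; rewrite /cabs /= sqrrN. Qed.

Lemma cabs_sum (I : Type) (s : seq I) (Q : pred I) (F : I -> CC R) :
  cabs (\sum_(i <- s | Q i) F i) <= \sum_(i <- s | Q i) cabs (F i).
Proof.
elim/big_rec2: _ => [|i x y _ h]; first by rewrite cabs0.
by apply: (le_trans (cabsD _ _)); rewrite lerD2l.
Qed.

Lemma Re_le_cabs z : `|complex.Re z| <= cabs z.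
Proof.
rewrite -(@ler_pXn2r _ 2)// ?nnegrE ?cabs_ge0// cabs_sqr real_normK ?num_real//.
by rewrite lerDl sqr_ge0.
Qed.

Lemma cabs_toC x : cabs (toC x) = `|x|.
Proof. by rewrite /cabs /toC /= expr0n/= addr0 sqrtr_sqr. Qed.

Lemma conjcM z w : conjc (z * w) = conjc z * conjc w.
Proof. by case: z w => [a b] [c d]; congr Complex => /=; ring. Qed.

Lemma conjcD z w : conjc (z + w) = conjc z + conjc w.
Proof. by case: z w => [a b] [c d]; apply/eqP; rewrite eq_complex /= opprD !eqxx. Qed.

Lemma conjc_sum (I : Type) (s : seq I) (Q : pred I) (F : I -> CC R) :
  conjc (\sum_(i <- s | Q i) F i) = \sum_(i <- s | Q i) conjc (F i).
Proof.
elim/big_rec2: _ => [|i a y _ <-]; last exact: conjcD.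
by rewrite -[RHS]/(Complex (0 : R) 0) -[0 in LHS]/(Complex (0 : R) 0)/= oppr0.
Qed.

Lemma conjc_toC x : conjc (toC x) = toC x.
Proof. by rewrite /toC /conjc /= oppr0. Qed.

Lemma toCM x y : toC (x * y) = toC x * toC y.
Proof. by congr Complex => /=; ring. Qed.

Lemma toCX x n : toC (x ^+ n) = toC x ^+ n.
Proof. by elim: n => // n IH; rewrite !exprS toCM IH. Qed.

Lemma toCV x : toC x^-1 = (toC x)^-1.
Proof. exact: (fmorphV (real_complex R)). Qed.

Lemma mul_conjc z : z * conjc z = toC (cabs z ^+ 2).
Proof.
by apply/eqP; rewrite eq_complex cabs_sqr; case: z => a b; apply/andP; split;
  apply/eqP => /=; ring.
Qed.

Lemma expiD x y : expi (x + y) = expi x * expi y.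
Proof. by congr Complex; [rewrite cosD|rewrite sinD addrC]. Qed.

Lemma expi0 : expi (0 : R) = 1.
Proof. by rewrite /expi cos0 sin0. Qed.

Lemma conjc_expi x : conjc (expi x) = expi (- x).
Proof. by rewrite /expi cosN sinN. Qed.

Lemma cabs_expi x : cabs (expi x) = 1.
Proof. by rewrite /cabs /expi /= cos2Dsin2 sqrtr1. Qed.

Lemma expi_neq0 x : expi x != 0 :> CC R.
Proof. by rewrite -cabs_eq0 cabs_expi oner_eq0. Qed.

Lemma expiV x : (expi x)^-1 = expi (- x).
Proof. by apply: (mulfI (expi_neq0 x)); rewrite mulfV ?expi_neq0// -expiD subrr expi0. Qed.

Lemma expiX x n : expi x ^+ n = expi (n%:R * x).
Proof.
elim: n => [|n IH]; first by rewrite mul0r expi0.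
by rewrite exprS IH -expiD -natr1 mulrDl mul1r addrC.
Qed.

End complex_facts.

Section has_integral.
Context {R : realType} {d : measure_display} {T : measurableType d}.
Variables (mu : {measure set T -> \bar R}) (D : set T).
Hypothesis mD : measurable D.

(** Bundling integrability with the value lets finite linear combinations be integrated without
    repeating side conditions. *)
Definition has_integral (f : T -> R) (c : R) : Prop :=
  mu.-integrable D (EFin \o f) /\ (\int[mu]_(w in D) (f w)%:E = c%:E)%E.

Lemma has_integralD f g a b : has_integral f a -> has_integral g b ->
  has_integral (fun w => f w + g w) (a + b).
Proof.
move=> [fi fa] [gi gb]; split; first exact: (integrableD _ fi gi).
by under eq_integral do rewrite EFinD; rewrite (integralD _ fi gi)// fa gb.
Qed.

Lemma has_integralZ f a k : has_integral f a ->
  has_integral (fun w => k * f w) (k * a).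
Proof.
move=> [fi fa]; split; first exact: (integrableZl _ k fi).
by under eq_integral do rewrite EFinM; rewrite (integralZl _ fi)// fa.
Qed.

Lemma has_integral0 : has_integral (fun=> 0) 0.
Proof.
split; last by rewrite integral0.
exact: (@integrable0 _ _ _ mu D).
Qed.

Lemma has_integral_sum (J : Type) (s : seq J) (F : J -> T -> R) (a : J -> R) :
  (forall j, has_integral (F j) (a j)) ->
  has_integral (fun w => \sum_(j <- s) F j w) (\sum_(j <- s) a j).
Proof.
move=> Fa; elim: s => [|j s IH].
  by rewrite big_nil; under eq_fun do rewrite big_nil; exact: has_integral0.
rewrite big_cons; under eq_fun do rewrite big_cons.
exact: has_integralD.
Qed.

Lemma eq_has_integral f g a b : (forall w, f w = g w) -> a = b ->
  has_integral f a -> has_integral g b.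
Proof. by move=> /funext -> ->. Qed.

Lemma le_has_integral f g a b : (forall w, D w -> f w <= g w) ->
  has_integral f a -> has_integral g b -> a <= b.
Proof.
move=> fg [fi fa] [gi gb]; rewrite -lee_fin -fa -gb.
by apply: le_integral => // x; rewrite inE => Dx; rewrite lee_fin fg.
Qed.

End has_integral.

Section trig_integrals.
Context {R : realType}.
Local Notation mu := (@lebesgue_measure R).
Local Notation I := `[- pi, pi]%classic.
Local Notation has_trig_integral := (@has_integral R _ _ mu I).

Let piN : - (pi : R) < pi. Proof. by rewrite gtrN// (pi_gt0 R). Qed.

Lemma has_trig_integral_derive (f F : R -> R) : (forall x, is_derive x (1 : R) F (f x)) ->
  continuous f -> has_trig_integral f (F pi - F (- pi)).
Proof.
move=> Ff cf; have cF : continuous F.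
  by move=> x; apply/differentiable_continuous/derivable1_diffP; have [] := Ff x.
split.
  apply: continuous_compact_integrable; first exact: segment_compact.
  exact: continuous_subspaceT.
rewrite EFinB; apply: continuous_FTC2 => //.
- exact: continuous_subspaceT.
- split.
  + by move=> x _; have [] := Ff x.
  + exact/cvg_at_right_filter/cF.
  + exact/cvg_at_left_filter/cF.
- by move=> x _; rewrite derive1E; have [_ ->] := Ff x.
Qed.

Lemma has_trig_integral_cst c : has_trig_integral (fun=> c) (2 * pi * c).
Proof.
apply: (eq_has_integral mu I (fun=> c) _ (c * pi - c * - pi)); [by []|ring|].
apply: (has_trig_integral_derive _ (fun x => c * x)); last by move=> x; exact: cvg_cst.
move=> x; by apply: is_derive_eq; rewrite /GRing.scale /= mulr1.
Qed.

Lemma sin_intpi (n : int) : sin (n%:~R * pi) = 0 :> R.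
Proof.
have H (k : nat) : sin (k%:R * pi) = 0 :> R.
  elim: k => [|k IH]; first by rewrite mul0r sin0.
  by rewrite -natr1 mulrDl mul1r sinD IH sinpi mul0r mulr0 addr0.
by case: n => n; rewrite ?NegzE ?mulrNz ?mulNr ?sinN H ?oppr0.
Qed.

Lemma has_trig_integral_cos (n : int) :
  has_trig_integral (fun w => cos (n%:~R * w)) (if n == 0 then 2 * pi else 0).
Proof.
have [->|n0] := eqVneq n 0.
  apply: (eq_has_integral mu I (fun=> 1) _ (2 * pi * 1)) (has_trig_integral_cst 1).
    by move=> w; rewrite mul0r cos0.
  by rewrite mulr1.
have n0' : n%:~R != 0 :> R by rewrite intr_eq0.
pose F (w : R) := n%:~R^-1 * sin (n%:~R * w).
apply: (eq_has_integral mu I (fun w => cos (n%:~R * w)) _ (F pi - F (- pi))) => //.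
  by rewrite /F mulrN sinN sin_intpi oppr0 subrr.
apply: has_trig_integral_derive.
  move=> x; apply: is_derive_eq.
  by rewrite /GRing.scale /= ?mulr0 ?addr0 !mulr1 mulrCA mulVf// mulr1.
move=> x; apply: (@continuous_comp _ _ _ (fun w : R => n%:~R * w) cos).
  exact: mulrl_continuous.
exact: continuous_cos.
Qed.

Lemma has_trig_integral_sin (n : int) : has_trig_integral (fun w => sin (n%:~R * w)) 0.
Proof.
have [->|n0] := eqVneq n 0.
  apply: (eq_has_integral mu I (fun=> 0) _ 0) (has_integral0 mu I) => //.
  by move=> w; rewrite mul0r sin0.
have n0' : n%:~R != 0 :> R by rewrite intr_eq0.
pose F (w : R) := - n%:~R^-1 * cos (n%:~R * w).
apply: (eq_has_integral mu I (fun w => sin (n%:~R * w)) _ (F pi - F (- pi))) => //.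
  by rewrite /F mulrN cosN subrr.
apply: has_trig_integral_derive.
  move=> x; apply: is_derive_eq.
  by rewrite /GRing.scale /= ?mulr0 ?addr0 !mulr1; field.
move=> x; apply: (@continuous_comp _ _ _ (fun w : R => n%:~R * w) sin).
  exact: mulrl_continuous.
exact: continuous_sin.
Qed.

Lemma has_trig_integral_expi (n : int) (c : CC R) :
  has_trig_integral (fun w => complex.Re (c * expi (n%:~R * w)))
    (if n == 0 then 2 * pi * complex.Re c else 0).
Proof.
apply: (eq_has_integral mu I
  (fun w => complex.Re c * cos (n%:~R * w) + (- complex.Im c) * sin (n%:~R * w)) _
  (complex.Re c * (if n == 0 then 2 * pi else 0) + (- complex.Im c) * 0)).
- by move=> w; rewrite cReM /= mulNr.
- by case: (n == 0); rewrite !mulr0 addr0// mulrC.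
apply: has_integralD => //; apply: has_integralZ => //.
- exact: has_trig_integral_cos.
- exact: has_trig_integral_sin.
Qed.

Lemma has_trig_integral_sesqui (J : finType) (nu : J -> int) (nui : injective nu)
    (a b : J -> CC R) :
  has_trig_integral
    (fun w => complex.Re ((\sum_j a j * expi ((nu j)%:~R * w)) *
                  conjc (\sum_j b j * expi ((nu j)%:~R * w))))
    (2 * pi * \sum_j complex.Re (a j * conjc (b j))).
Proof.
apply: (eq_has_integral mu I
  (fun w => \sum_j \sum_k complex.Re (a j * conjc (b k) *
      expi ((nu j - nu k)%:~R * w))) _
  (\sum_j \sum_k if nu j - nu k == 0 then 2 * pi * complex.Re (a j * conjc (b k)) else 0)).
- move=> w; rewrite conjc_sum mulr_suml Re_sum; apply: eq_bigr => j _.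
  rewrite mulr_sumr Re_sum; apply: eq_bigr => k _; congr complex.Re.
  by rewrite conjcM conjc_expi -mulNr intrB mulrDl expiD; ring.
- rewrite mulr_sumr; apply: eq_bigr => j _.
  rewrite (bigD1 j)//= subrr eqxx big1 ?addr0// => k kj.
  by rewrite subr_eq0 (inj_eq nui) eq_sym (negbTE kj).
- apply: has_integral_sum => // j; apply: has_integral_sum => // k.
  exact: has_trig_integral_expi.
Qed.

Lemma has_trig_integral_parseval (J : finType) (nu : J -> int) (nui : injective nu)
    (a : J -> CC R) :
  has_trig_integral (fun w => cabs (\sum_j a j * expi ((nu j)%:~R * w)) ^+ 2)
    (2 * pi * \sum_j cabs (a j) ^+ 2).
Proof.
apply: (eq_has_integral mu I _ _ _ _ _ _ (has_trig_integral_sesqui J nu nui a a)).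
  by move=> w; rewrite cabs_sqrE.
by congr (_ * _); apply: eq_bigr => j _; rewrite cabs_sqrE.
Qed.

End trig_integrals.

Section cauchy_schwarz.
Context {R : realType}.

Lemma sum_mul_le_sqrt (I : finType) (x y : I -> R) :
  \sum_i x i * y i <= Num.sqrt (\sum_i x i ^+ 2) * Num.sqrt (\sum_i y i ^+ 2).
Proof.
have sq0 (z : I -> R) : 0 <= \sum_i z i ^+ 2 by apply: sumr_ge0 => i _; exact: sqr_ge0.
have z0 (z : I -> R) : \sum_i z i ^+ 2 = 0 -> forall i, z i = 0.
  move=> /eqP; rewrite psumr_eq0 => [/allP h i|i _]; last exact: sqr_ge0.
  by apply/eqP; rewrite -sqrf_eq0; apply: h; rewrite mem_index_enum.
set X := \sum_i x i ^+ 2; set Y := \sum_i y i ^+ 2.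
have [X0|Xn] := eqVneq X 0.
  by rewrite X0 sqrtr0 mul0r big1// => i _; rewrite (z0 _ X0) mul0r.
have [Y0|Yn] := eqVneq Y 0.
  by rewrite Y0 sqrtr0 mulr0 big1// => i _; rewrite (z0 _ Y0) mulr0.
have F0 : 0 < Num.sqrt X by rewrite sqrtr_gt0 lt_neqAle eq_sym Xn sq0.
have S0 : 0 < Num.sqrt Y by rewrite sqrtr_gt0 lt_neqAle eq_sym Yn sq0.
set F := Num.sqrt X in F0 *; set S := Num.sqrt Y in S0 *.
have FX : F ^+ 2 = X by rewrite /F sqr_sqrtr// sq0.
have SY : S ^+ 2 = Y by rewrite /S sqr_sqrtr// sq0.
(* A weighted arithmetic-geometric mean inequality; with these weights each of the two sums
   contributes F S / 2. *)
have h i : x i * y i <= S / (2 * F) * x i ^+ 2 + F / (2 * S) * y i ^+ 2.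
  rewrite -subr_ge0.
  have -> : S / (2 * F) * x i ^+ 2 + F / (2 * S) * y i ^+ 2 - x i * y i =
    (S * x i - F * y i) ^+ 2 / (2 * F * S).
    by field; rewrite !gt_eqF.
  by rewrite divr_ge0 ?sqr_ge0// !mulr_ge0// ltW.
apply: (le_trans (ler_sum _ (fun i _ => h i))).
rewrite big_split/= -!mulr_sumr -/X -/Y -FX -SY le_eqVlt; apply/orP; left; apply/eqP.
by field; rewrite !gt_eqF.
Qed.

(** Cauchy-Schwarz for matrices: the rank-one matrix with entries H_i conj(H_j) has Frobenius norm
    |H|^2. *)
Lemma Re_sesqui_le (m : nat) (M : 'M[CC R]_m) (H : 'I_m -> CC R) :
  complex.Re (\sum_i \sum_j H i * conjc (H j) * M i j) <=
  frobC M * \sum_i cabs (H i) ^+ 2.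
Proof.
apply: (le_trans (ler_norm _)); apply: (le_trans (Re_le_cabs _)).
rewrite (pair_big xpredT xpredT (fun i j => H i * conjc (H j) * M i j))/=.
apply: (le_trans (cabs_sum _ _ _ _)).
rewrite (eq_bigr (fun q => cabs (M q.1 q.2) * cabs (H q.1 * conjc (H q.2)))); last first.
  by move=> q _; rewrite cabsM mulrC.
apply: (le_trans (sum_mul_le_sqrt _ (fun q => cabs (M q.1 q.2)) _)).
rewrite /frobC -(pair_big xpredT xpredT (fun i j => cabs (M i j) ^+ 2))/=.
apply: ler_wpM2l; first exact: sqrtr_ge0.
rewrite -(pair_big xpredT xpredT (fun i j => cabs (H i * conjc (H j)) ^+ 2))/=.
under eq_bigr do (under eq_bigr do rewrite cabsM cabsJ exprMn; rewrite -mulr_sumr).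
rewrite -mulr_suml -expr2 sqrtr_sqr ger0_norm// sumr_ge0// => i _; exact: sqr_ge0.
Qed.

End cauchy_schwarz.

Section ae_le_integral_in.
Context {R : realType} {d : measure_display} {T : measurableType d}.
Variables (mu : {measure set T -> \bar R}) (D : set T).
Hypothesis mD : measurable D.

Lemma ae_le_integral_in (f g : T -> R) : measurable_fun D f -> measurable_fun D g ->
  (forall x, D x -> 0 <= g x) -> {ae mu, forall x, D x -> f x <= g x} ->
  (\int[mu]_(x in D) (f x)%:E <= \int[mu]_(x in D) (g x)%:E)%E.
Proof.
move=> mf mg g0 fg; rewrite integralE.
apply: (@le_trans _ _ (\int[mu]_(x in D) ((EFin \o f) ^\+ x))%E).
  by rewrite -[leRHS]sube0 leeB// integral_ge0.
apply: ae_ge0_le_integral => //.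
- by apply: measurable_funepos; exact/measurable_EFinP.
- exact/measurable_EFinP.
- apply: filterS fg => x /= fgx Dx.
  by rewrite funeposE ge_max !lee_fin fgx// g0.
Qed.

End ae_le_integral_in.

Section ess_sup_norm.
Context {R : realType} {m : nat} (Phi : R -> 'M[CC R]_m).

Lemma ess_sup_norm_ae : (ess_sup_norm Phi < +oo)%E ->
  {ae lebesgue_measure, forall w, `[- pi, pi]%classic w ->
    frobC (Phi w) <= fine (ess_sup_norm Phi)}.
Proof.
move=> fin; have := ess_sup_ge (mrestr lebesgue_measure (measurable_itv `[- pi, pi : R]))
  (fun w => (frobC (Phi w))%:E).
rewrite -/(ess_sup_norm Phi) => -[A [mA A0 hA]].
exists (A `&` `[- pi, pi]); split=> //; first exact: measurableI.
move=> w /= /not_implyP[Iw nle]; split=> //; apply: hA => /= le; apply: nle.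
by case: (ess_sup_norm Phi) le fin.
Qed.

Lemma ess_sup_norm_ge0 : 0 <= fine (ess_sup_norm Phi).
Proof.
apply: fine_ge0; apply: ess_sup_ger => [|w]; last by rewrite lee_fin sqrtr_ge0.
suff : (0 < lebesgue_measure ([set: R] `&` `[(- pi)%R, pi%R]%classic))%E by [].
rewrite setTI lebesgue_measure_itv/= lte_fin.
have p0 := pi_gt0 R.
by rewrite (gtrN p0) -EFinD lte_fin opprK addr_gt0.
Qed.

End ess_sup_norm.

(** * Quadratic forms of the covariances are bounded by the spectrum *)

Section spectral_bound.
Context {R : realType} {d : measure_display} {T : measurableType d}.
Variables (P : probability T R) (m : nat) (u : nat -> T -> 'cV[R]_m).
Hypotheses (mu : forall t i, measurable_fun setT (fun w => u t w i 0))
  (su : stationary P u).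

(** The sequence in the limit is constant from n = a on: there the time n - (a - b) is nonnegative
    and stationarity applies. *)
Lemma stationary_autocov a b i j :
  autocov P u (a%:Z - b%:Z) i j =
  fine (expectation P (fun w => u a w i 0 * u b w j 0)).
Proof.
rewrite /autocov mxE; apply: cvg_lim => //; apply: cvg_near_cst.
exists a => // n /= an.
have -> : n%:Z - (a%:Z - b%:Z) = (b + (n - a))%N%:Z by lia.
rewrite /from_time0 -{1}(subnKC an).
by case: su => _ _ ->.
Qed.

Lemma stationary_integrableM a b i j :
  P.-integrable setT (fun w => (u a w i 0 * u b w j 0)%:E).
Proof.
have [i2 _ _] := su.
apply: (@le_integrable _ _ _ P setT measurableT _
  (fun w => (u a w i 0 ^+ 2)%:E + (u b w j 0 ^+ 2)%:E)%E).
- by apply/measurable_EFinP; apply: measurable_funM.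
- move=> w _ /=; rewrite lee_fin.
  rewrite [leRHS]ger0_norm ?addr_ge0 ?sqr_ge0// normrM.
  rewrite -(real_normK (num_real (u a w i 0))) -(real_normK (num_real (u b w j 0))).
  set x := `|_|; set y := `|_|.
  by have := sqr_ge0 (x - y / 2); have := sqr_ge0 y; nra.
- exact: integrableD.
Qed.

Lemma has_integral_autocov a b i j :
  has_integral P setT (fun w => u a w i 0 * u b w j 0) (autocov P u (a%:Z - b%:Z) i j).
Proof.
have h := stationary_integrableM a b i j.
split=> //; rewrite stationary_autocov unlock fineK//.
exact: integrable_fin_num.
Qed.

Variables (n : nat) (s : 'I_n -> nat) (si : injective s) (c : 'I_n -> 'I_m -> R).

Let quad : R := \sum_k \sum_i \sum_l \sum_j c k i * c l j *
  autocov P u ((s k)%:Z - (s l)%:Z) i j.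

Lemma has_integral_stationary_sqr :
  has_integral P setT (fun w => (\sum_k \sum_i c k i * u (s k) w i 0) ^+ 2) quad.
Proof.
apply: (eq_has_integral P setT (fun w => \sum_k \sum_i \sum_l \sum_j
   c k i * c l j * (u (s k) w i 0 * u (s l) w j 0)) _ quad) => //.
  move=> w; rewrite expr2 mulr_suml; apply: eq_bigr => k _.
  rewrite mulr_suml; apply: eq_bigr => i _.
  rewrite mulr_sumr; apply: eq_bigr => l _.
  by rewrite mulr_sumr; apply: eq_bigr => j _; ring.
do 4 (apply: has_integral_sum => // ?).
apply: has_integralZ => //; exact: has_integral_autocov.
Qed.

(** Frequency response of the linear combination of samples with coefficients c at the times s. *)
Let H w (i : 'I_m) : CC R := \sum_k toC (c k i) * expi ((- (s k)%:Z)%:~R * w).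

Local Notation has_trig_integral := (@has_integral R _ _ lebesgue_measure `[- pi, pi]%classic).

Lemma has_trig_integral_filter_norm :
  has_trig_integral (fun w => \sum_i cabs (H w i) ^+ 2)
    (2 * pi * \sum_i \sum_k c k i ^+ 2).
Proof.
rewrite mulr_sumr; apply: has_integral_sum => // i.
apply: (eq_has_integral _ _ _ _ _ _ _ _ (has_trig_integral_parseval _
   (fun k => - (s k)%:Z) _ (fun k => toC (c k i)))) => //.
- by congr (_ * _); apply: eq_bigr => k _; rewrite cabs_toC real_normK ?num_real.
- by move=> k l /oppr_inj [] /si.
Qed.

(** Each lag s k - s l lies between -K and K and is met by exactly one term of the sum, so the value
    no longer depends on K. *)
Lemma has_trig_integral_spectral_sum K : (forall k, (s k <= K)%N) ->
  has_trig_integral (fun w => complex.Re (\sum_i \sum_j H w i * conjc (H w j) *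
    spectral_sum P u K w i j)) (2 * pi * quad).
Proof.
move=> sK.
apply: (eq_has_integral lebesgue_measure `[- pi, pi]%classic (fun w => \sum_k \sum_i \sum_l \sum_j
  \sum_(q < K.*2.+1) complex.Re (toC (c k i * c l j * autocov P u (q%:Z - K%:Z) i j) *
    expi ((q%:Z - K%:Z - (s k)%:Z + (s l)%:Z)%:~R * w))) _
  (\sum_k \sum_i \sum_l \sum_j \sum_(q < K.*2.+1)
    if q%:Z - K%:Z - (s k)%:Z + (s l)%:Z == 0 then
      2 * pi * (c k i * c l j * autocov P u (q%:Z - K%:Z) i j) else 0)).
- move=> w; rewrite Re_sum exchange_big; apply: eq_bigr => i _.
  rewrite Re_sum; under eq_bigr do rewrite exchange_big; rewrite exchange_big.
  apply: eq_bigr => j _; rewrite conjc_sum mulr_suml mulr_suml Re_sum.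
  apply: eq_bigr => k _; rewrite mulr_sumr mulr_suml Re_sum; apply: eq_bigr => l _.
  rewrite /spectral_sum summxE mulr_sumr Re_sum; apply: eq_bigr => q _.
  congr (complex.Re _); rewrite !mxE conjcM conjc_expi conjc_toC !toCM.
  have -> : expi ((q%:Z - K%:Z - (s k)%:Z + (s l)%:Z)%:~R * w) =
    expi ((- (s k)%:Z)%:~R * w) * expi (- ((- (s l)%:Z)%:~R * w)) *
    expi ((q%:Z - K%:Z)%:~R * w) :> CC R.
    by rewrite -!expiD; congr (expi _); rewrite !intrD !intrN; ring.
  ring.
- rewrite mulr_sumr; apply: eq_bigr => k _.
  rewrite mulr_sumr; apply: eq_bigr => i _.
  rewrite mulr_sumr; apply: eq_bigr => l _.
  rewrite mulr_sumr; apply: eq_bigr => j _.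
  (* K + s k - s l is the only index q whose frequency cancels; s l <= K keeps the natural
     subtraction exact. *)
  have qP : (K + s k - s l < K.*2.+1)%N.
    by rewrite ltnS -addnn; apply: (leq_trans (leq_subr _ _)); rewrite leq_add2l.
  have lK : (s l <= K + s k)%N by apply: (leq_trans (sK l)); rewrite leq_addr.
  have qE : (Ordinal qP)%:Z - K%:Z = (s k)%:Z - (s l)%:Z :> int.
    by rewrite /= -subzn// PoszD; ring.
  rewrite (bigD1 (Ordinal qP))//= -[X in X%:Z - K%:Z - _]/(val (Ordinal qP)).
  rewrite big1 ?addr0 => [|q qn].
    by rewrite qE ifT//; apply/eqP; ring.
  case: ifP => // /eqP e; case/negP: qn; apply/eqP/val_inj => /=.
  have : (q : nat)%:Z = (K + s k - s l)%N%:Z by rewrite -subzn// PoszD; lia.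
  by case.
- do 5 (apply: has_integral_sum => // ?).
  exact: has_trig_integral_expi.
Qed.


Variable Phi : R -> 'M[CC R]_m.
Hypotheses (PhiP : power_spectrum P u Phi) (Phib : (ess_sup_norm Phi < +oo)%E).

Let filter_norm_bound : exists2 B, 0 < B & forall w, \sum_i cabs (H w i) ^+ 2 <= B.
Proof.
exists (\sum_i (\sum_k `|c k i|) ^+ 2 + 1).
  by rewrite ltr_wpDl// sumr_ge0// => i _; exact: sqr_ge0.
move=> w; apply: (@le_trans _ _ (\sum_i (\sum_k `|c k i|) ^+ 2)); last by rewrite lerDl.
apply: ler_sum => i _; rewrite ler_pXn2r ?nnegrE ?cabs_ge0 ?sumr_ge0//.
apply: (le_trans (cabs_sum _ _ _ _)); apply: ler_sum => k _.
by rewrite cabsM cabs_expi mulr1 cabs_toC.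
Qed.

Let measurable_spectral_error K : measurable_fun `[- pi, pi]
  (fun w => frobC (spectral_sum P u K w - Phi w) ^+ 2).
Proof.
have mE i j : measurable_fun `[- pi, pi] (fun w => cabs ((spectral_sum P u K w - Phi w) i j) ^+ 2).
  have [mre mim] := PhiP.1 i j.
  rewrite (_ : (fun w => _) = (fun w =>
    (\sum_(l < K.*2.+1) cos (((l : nat)%:Z - K%:Z)%:~R * w) * autocov P u ((l : nat)%:Z - K%:Z) i j
      - complex.Re (Phi w i j)) ^+ 2 +
    (\sum_(l < K.*2.+1) sin (((l : nat)%:Z - K%:Z)%:~R * w) * autocov P u ((l : nat)%:Z - K%:Z) i j
      - complex.Im (Phi w i j)) ^+ 2)).
    apply: measurable_funD; apply: measurable_funX; apply: measurable_funB => //;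
    apply: measurable_sum => l; apply: measurable_funM => //;
    apply: measurable_funTS; apply: continuous_measurable_fun => x.
    - by apply: (@continuous_comp _ _ _ (fun w : R => _ * w) cos);
        [exact: mulrl_continuous|exact: continuous_cos].
    - by apply: (@continuous_comp _ _ _ (fun w : R => _ * w) sin);
        [exact: mulrl_continuous|exact: continuous_sin].
  apply/funext => w; rewrite cabs_sqr; congr (_ ^+ 2 + _ ^+ 2).
  - rewrite !mxE ReB /spectral_sum summxE Re_sum; congr (_ - _).
    by apply: eq_bigr => l _; rewrite !mxE mulrC Re_toCM mulrC.
  - rewrite !mxE ImB /spectral_sum summxE Im_sum; congr (_ - _).
    by apply: eq_bigr => l _; rewrite !mxE mulrC Im_toCM mulrC.
rewrite (_ : (fun w => _) = (fun w => \sum_i \sum_j cabs ((spectral_sum P u K w - Phi w) i j) ^+ 2)).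
  by apply: measurable_sum => i; apply: measurable_sum => j; exact: mE.
apply/funext => w; rewrite sqr_sqrtr//; apply: sumr_ge0 => i _.
by apply: sumr_ge0 => j _; exact: sqr_ge0.
Qed.

(** The integral of H against the spectral sums is 2 pi times the form for all large K, while
    against Phi it is controlled by the essential supremum. An excess e would contradict the
    mean-square convergence of the sums to Phi. *)
Lemma spectral_quad_le :
  quad <= fine (ess_sup_norm Phi) * \sum_i \sum_k c k i ^+ 2.
Proof.
have [B B0 HB] := filter_norm_bound.
set Ph := fine _; set S := \sum_i _.
apply/ler_addgt0Pr => e e0.
rewrite leNgt; apply/negP => lt_quad.
(* This makes B eps half of the assumed excess, and the integral a stays positive. *)
pose eps := e / B / 2; have eps0 : 0 < eps by rewrite !divr_gt0.
pose a : R := 2 * pi * quad + (- Ph) * (2 * pi * S) + 2 * pi * (- (B * eps)).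
have pi0 : 0 < pi :> R by exact: pi_gt0.
have a0 : 0 < a.
  rewrite /a /eps (_ : B * (e / B / 2) = e / 2); last by field; rewrite gt_eqF.
  rewrite (_ : _ + _ = 2 * pi * (quad - Ph * S - e / 2)); last by ring.
  rewrite !mulr_gt0// subr_gt0 ltrBrDl; apply: lt_trans lt_quad.
  by rewrite ltrD2l ltr_pdivrMr// mulr2n mulrDr mulr1 ltrDl.
have [_ /fine_cvgP[fn cv]] := PhiP.
(* The mean-square error at which (B / eps) r = a; a K with a smaller error yields the
   contradiction. *)
pose r := a * eps / B; have r0 : 0 < r by exact: divr_gt0 (mulr_gt0 a0 eps0) B0.
pose K0 := \max_k s k.
have [K [sK [Kfin Klt]]] : exists K, (forall k, (s k <= K)%N) /\
   (\int[lebesgue_measure]_(w in `[(- pi)%R, pi])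
     (frobC (spectral_sum P u K w - Phi w)%R ^+ 2)%:E \is a fin_num /\
   \int[lebesgue_measure]_(w in `[(- pi)%R, pi])
     (frobC (spectral_sum P u K w - Phi w)%R ^+ 2)%:E < r%:E)%E.
  have : \forall K \near \oo, (K0 <= K)%N by exact: nbhs_infty_ge.
  move=> h2; have h1 := cvgr_lt _ cv _ r0.
  near \oo => K; exists K; split.
    move=> k; apply: (@leq_trans K0); last by near: K.
    by rewrite /K0; exact: leq_bigmax.
  have Kf : (\int[lebesgue_measure]_(w in `[(- pi)%R, pi])
     (frobC (spectral_sum P u K w - Phi w)%R ^+ 2)%:E \is a fin_num)%E by near: K.
  split => //; rewrite -[ltLHS]fineK// lte_fin; near: K; exact: h1.
have [qi qa] : has_integral lebesgue_measure `[- pi, pi]%classic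
   (fun w => complex.Re (\sum_i \sum_j H w i * conjc (H w j) * spectral_sum P u K w i j)
     + (- Ph) * (\sum_i cabs (H w i) ^+ 2) + (- (B * eps))) a.
  apply: has_integralD => //; last exact: has_trig_integral_cst.
  apply: has_integralD => //; first exact: has_trig_integral_spectral_sum.
  by apply: has_integralZ => //; exact: has_trig_integral_filter_norm.
have : (a%:E <= (B / eps)%:E * \int[lebesgue_measure]_(w in `[(- pi)%R, pi])
     (frobC (spectral_sum P u K w - Phi w)%R ^+ 2)%:E)%E.
  rewrite -qa -ge0_integralZl_EFin//; last 3 first.
  - by move=> w _; rewrite lee_fin sqr_ge0.
  - by apply/measurable_EFinP; exact: measurable_spectral_error.
  - by rewrite divr_ge0// ltW.
  apply: ae_le_integral_in => //.
  - by apply/measurable_EFinP; exact: (measurable_int _ qi).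
  - exact: (measurable_funM (measurable_cst (B / eps)) (measurable_spectral_error K)).
  - by move=> w _; rewrite mulr_ge0 ?sqr_ge0// divr_ge0// ltW.
  have [A [mA A0 hA]] := ess_sup_norm_ae Phi Phib; exists A; split=> // w /= nw.
  apply: hA => /= bw; apply: nw => Iw.
  have {bw} := bw Iw; rewrite -/Ph => bw.
  set Q := complex.Re _.
  have -> : Q = complex.Re (\sum_i \sum_j H w i * conjc (H w j) * Phi w i j) +
    complex.Re (\sum_i \sum_j H w i * conjc (H w j) * (spectral_sum P u K w - Phi w) i j).
    rewrite -ReD /Q -big_split/=; congr (complex.Re _); apply: eq_bigr => i _.
    rewrite -big_split/=; apply: eq_bigr => j _; rewrite !mxE; ring.
  have h1 := Re_sesqui_le m (Phi w) (H w).
  have h2 := Re_sesqui_le m (spectral_sum P u K w - Phi w) (H w).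
  set F := frobC (_ - _) in h2 *.
  set N : R := \sum_i cabs (H w i) ^+ 2 in h1 h2 *.
  have F0 : 0 <= F by exact: sqrtr_ge0.
  have NB : N <= B by exact: HB.
  have N0 : 0 <= N by apply: sumr_ge0 => i _; exact: sqr_ge0.
  have h3 : frobC (Phi w) * N <= Ph * N by exact: ler_wpM2r.
  have h4 : F * N <= F * B by exact: ler_wpM2l.
  (* Young's inequality trades the error F, small only in mean square, for its square plus a
     constant. *)
  have h5 : F * B <= B / eps * F ^+ 2 + B * eps.
    rewrite -subr_ge0 (_ : _ - _ = B / eps * ((F - eps / 2) ^+ 2 + 3 / 4 * eps ^+ 2)).
      apply: mulr_ge0; first by rewrite divr_ge0 ?ltW.
      by have := sqr_ge0 (F - eps / 2); have := sqr_ge0 eps; lra.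
    by field; rewrite gt_eqF.
  lra.
rewrite leNgt => /negP; apply.
rewrite -[X in (_ < X%:E)%E](_ : B / eps * r = a); last first.
  by rewrite /r; field; rewrite !gt_eqF.
by rewrite [ltRHS]EFinM lte_pmul2l// lte_fin divr_gt0.
Unshelve. all: by end_near.
Qed.

End spectral_bound.

Section filtered_energy.
Context {R : realType} {d : measure_display} {T : measurableType d}.
Variables (P : probability T R) (p m : nat) (u : nat -> T -> 'cV[R]_m).
Variables (Phi : R -> 'M[CC R]_m) (h : nat -> 'M[R]_(p, m)) (t : nat).
Hypotheses (mu : forall t i, measurable_fun setT (fun w => u t w i 0))
  (su : stationary P u) (PhiP : power_spectrum P u Phi)
  (Phib : (ess_sup_norm Phi < +oo)%E).

Lemma frob_sqr (a b : nat) (A : 'M[R]_(a, b)) :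
  frob A ^+ 2 = \sum_i \sum_j A i j ^+ 2.
Proof.
rewrite sqr_sqrtr//; apply: sumr_ge0 => i _; apply: sumr_ge0 => j _; exact: sqr_ge0.
Qed.

Lemma expected_filtered_energy_le :
  (\int[P]_w (\sum_i conv h (fun s => u s w) t i 0 ^+ 2)%:E <=
   (fine (ess_sup_norm Phi) * \sum_(k < t.+1) frob (h k) ^+ 2)%:E)%E.
Proof.
have si : injective (fun k : 'I_t.+1 => (t - k)%N).
  by move=> k l kl; apply: val_inj => /=; have := ltn_ord k; have := ltn_ord l; lia.
have xE w i : conv h (fun s => u s w) t i 0 =
    \sum_(k < t.+1) \sum_j h k i j * u (t - k)%N w j 0.
  by rewrite summxE; apply: eq_bigr => k _; rewrite mxE.
have [_ ->] : has_integral P setT (fun w => \sum_i conv h (fun s => u s w) t i 0 ^+ 2)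
  (\sum_i \sum_(k < t.+1) \sum_j \sum_(l < t.+1) \sum_j' h k i j * h l i j' *
    autocov P u ((t - k)%N%:Z - (t - l)%N%:Z) j j').
  apply: has_integral_sum => // i.
  apply: (eq_has_integral _ _ _ _ _ _ _ _
    (has_integral_stationary_sqr P m u mu su _ (fun k : 'I_t.+1 => (t - k)%N)
       (fun k j => h k i j))) => // w.
  by rewrite xE.
rewrite lee_fin.
apply: (@le_trans _ _ (\sum_i fine (ess_sup_norm Phi) * \sum_j \sum_(k < t.+1) h k i j ^+ 2)).
  apply: ler_sum => i _.
  exact: (spectral_quad_le P m u _ _ si (fun k j => h k i j) _ PhiP Phib).
rewrite -mulr_sumr; apply: ler_wpM2l; first exact: ess_sup_norm_ge0.
under [leRHS]eq_bigr do rewrite frob_sqr.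
rewrite [leRHS]exchange_big/=; apply: ler_sum => i _.
by rewrite exchange_big.
Qed.

End filtered_energy.

(** * Impulse responses *)

Section complex_continuity.
Context {R : realType}.
Implicit Types f g : R -> CC R.

(** Stated for the two parts so that the real integrals apply directly. *)
Definition ccont f : Prop := 
  continuous (fun w => complex.Re (f w)) /\ continuous (fun w => complex.Im (f w)).

Lemma ccont_cst c : ccont (fun=> c).
Proof. by split=> x; exact: cvg_cst. Qed.

Lemma ccontD f g : ccont f -> ccont g -> ccont (fun w => f w + g w).
Proof.
move=> [f1 f2] [g1 g2]; split=> x /=.
- rewrite (_ : (fun w => _) = fun w => complex.Re (f w) + complex.Re (g w)).
    by apply: cvgD; [exact: f1|exact: g1].
  by apply/funext => w /=; rewrite ReD.
- rewrite (_ : (fun w => _) = fun w => complex.Im (f w) + complex.Im (g w)).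
    by apply: cvgD; [exact: f2|exact: g2].
  by apply/funext => w /=; rewrite ImD.
Qed.

Lemma ccontM f g : ccont f -> ccont g -> ccont (fun w => f w * g w).
Proof.
move=> [f1 f2] [g1 g2]; split=> x /=.
- rewrite (_ : (fun w => _) = fun w => complex.Re (f w) * complex.Re (g w) -
    complex.Im (f w) * complex.Im (g w)).
    by apply: cvgB; apply: cvgM; [exact: f1|exact: g1|exact: f2|exact: g2].
  by apply/funext => w /=; rewrite cReM.
- rewrite (_ : (fun w => _) = fun w => complex.Re (f w) * complex.Im (g w) +
    complex.Im (f w) * complex.Re (g w)).
    by apply: cvgD; apply: cvgM; [exact: f1|exact: g2|exact: f2|exact: g1].
  by apply/funext => w /=; rewrite cImM.
Qed.

Lemma ccontB f g : ccont f -> ccont g -> ccont (fun w => f w - g w).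
Proof.
move=> cf cg; apply: ccontD => //.
rewrite (_ : (fun w => _) = fun w => (-1) * g w); first exact/ccontM/cg/ccont_cst.
by apply/funext => w; rewrite mulN1r.
Qed.

Lemma ccont_expi : ccont (@expi R).
Proof. by split=> x; [exact: continuous_cos|exact: continuous_sin]. Qed.

Lemma continuous_cabs_sqr f : ccont f -> continuous (fun w => cabs (f w) ^+ 2).
Proof.
move=> [f1 f2] x; under eq_fun do rewrite cabs_sqr !expr2.
by apply: cvgD; apply: cvgM; (exact: f1 || exact: f2).
Qed.

Lemma ccontV f : (forall w, f w != 0) -> ccont f -> ccont (fun w => (f w)^-1).
Proof.
move=> f0 cf; have := continuous_cabs_sqr f cf; case: cf => f1 f2 fs.
have n0 w : cabs (f w) ^+ 2 != 0 by rewrite sqrf_eq0 cabs_eq0.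
have fi (w : R) : (fun x => (cabs (f x) ^+ 2)^-1) @ w --> (cabs (f w) ^+ 2)^-1.
  by apply: cvgV => //; exact: fs.
split=> x /=.
- rewrite (_ : (fun w => _) = fun w => complex.Re (f w) * (cabs (f w) ^+ 2)^-1).
    by apply: cvgM; [exact: f1|exact: fi].
  by apply/funext => w /=; rewrite cReV.
- rewrite (_ : (fun w => _) = fun w => - (complex.Im (f w) * (cabs (f w) ^+ 2)^-1)).
    by apply: cvgN; apply: cvgM; [exact: f2|exact: fi].
  by apply/funext => w /=; rewrite cImV.
Qed.

End complex_continuity.

Section tame.
Context {R : realType}.
Implicit Types f g : CC R -> CC R.

(* A form of being holomorphic in a neighbourhood of |z| >= 1 and vanishing at
   infinity that is easy to check for partial fractions. *)
Definition tame f : Prop := exists C : R, [/\ 0 <= C,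
  forall z, 1 <= cabs z -> cabs (f z) <= C / cabs z,
  forall z r, cabs z = 1 -> 1 <= r -> cabs (f (toC r * z) - f z) <= C * (r - 1)
  & ccont (f \o expi)].

Lemma tame0 : tame (fun=> 0).
Proof.
exists 0; split=> //; last exact: ccont_cst.
- by move=> z _; rewrite cabs0 mul0r.
- by move=> z r _ _; rewrite subrr cabs0 mul0r.
Qed.

Lemma tameD f g : tame f -> tame g -> tame (fun z => f z + g z).
Proof.
move=> [C [C0 fb fl fc]] [C' [C0' gb gl gc]]; exists (C + C'); split.
- exact: addr_ge0.
- move=> z z1; apply: (le_trans (cabsD _ _)); rewrite mulrDl.
  by apply: lerD; [exact: fb|exact: gb].
- move=> z r z1 r1; rewrite opprD addrACA mulrDl; apply: (le_trans (cabsD _ _)).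
  by apply: lerD; [exact: fl|exact: gl].
- exact: ccontD fc gc.
Qed.

Lemma tameZ c f : tame f -> tame (fun z => f z * c).
Proof.
move=> [C [C0 fb fl fc]]; exists (C * cabs c); split.
- by rewrite mulr_ge0 ?cabs_ge0.
- by move=> z z1; rewrite cabsM mulrAC ler_wpM2r ?cabs_ge0 ?fb.
- by move=> z r z1 r1; rewrite -mulrBl cabsM mulrAC ler_wpM2r ?cabs_ge0 ?fl.
- exact: ccontM fc (ccont_cst c).
Qed.

Lemma tame_sum (I : Type) (s : seq I) (F : I -> CC R -> CC R) :
  (forall i, tame (F i)) -> tame (fun z => \sum_(i <- s) F i z).
Proof.
move=> tF; elim: s => [|i s IH].
  by under eq_fun do rewrite big_nil; exact: tame0.
by under eq_fun do rewrite big_cons; exact: tameD.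
Qed.

Lemma tameM f g : tame f -> tame g -> tame (fun z => f z * g z).
Proof.
move=> [C [C0 fb fl fc]] [C' [C0' gb gl gc]]; exists (2 * (C * C')); split.
- by rewrite !mulr_ge0.
- move=> z z1; have z0 : 0 < cabs z by exact: lt_le_trans z1.
  rewrite cabsM; apply: (@le_trans _ _ (C / cabs z * (C' / cabs z))).
    by apply: ler_pM; rewrite ?cabs_ge0 ?fb ?gb.
  rewrite mulrACA [leRHS]mulrC mulrA [leLHS]mulrC.
  apply: ler_wpM2l; first by rewrite invr_ge0 cabs_ge0.
  by rewrite ler_pdivrMr//; have := mulr_ge0 C0 C0'; nra.
- move=> z r z1 r1; set zr := toC r * z.
  have zr1 : 1 <= cabs zr by rewrite cabsM cabs_toC z1 mulr1 ger0_norm// (le_trans _ r1).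
  have -> : f zr * g zr - f z * g z = f zr * (g zr - g z) + (f zr - f z) * g z by ring.
  have fC : cabs (f zr) <= C.
    apply: (le_trans (fb _ zr1)); rewrite ler_pdivrMr ?(lt_le_trans _ zr1)//.
    by rewrite ler_peMr.
  have gC : cabs (g z) <= C' by have := gb z; rewrite z1 divr1 => ->.
  apply: (le_trans (cabsD _ _)); rewrite !cabsM.
  apply: (@le_trans _ _ (C * (C' * (r - 1)) + C * (r - 1) * C')); last by lra.
  by apply: lerD; apply: ler_pM; rewrite ?cabs_ge0 ?fl ?gl.
- exact: ccontM fc gc.
Qed.

Lemma cabsB_ge (z l : CC R) : cabs z - cabs l <= cabs (z - l).
Proof. by rewrite lerBlDr; apply: le_trans (cabsD _ _); rewrite subrK. Qed.

(** The pole stays at distance at least a = 1 - |l| from the region |z| >= 1. Decay costs 1/a and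
    the radial increment 1/a^2; as a <= 1, the second constant serves both. *)
Lemma tame_frac (l : CC R) : cabs l < 1 -> tame (fun z => (z - l)^-1).
Proof.
move=> l1; set a := 1 - cabs l; have a0 : 0 < a by rewrite subr_gt0.
have za z : 1 <= cabs z -> a * cabs z <= cabs (z - l).
  move=> z1; apply: le_trans (cabsB_ge _ _).
  by have := cabs_ge0 l; rewrite /a; nra.
have za1 z : 1 <= cabs z -> a <= cabs (z - l).
  by move=> z1; apply: le_trans (za _ z1); rewrite ler_peMr// ltW.
have zn z : 1 <= cabs z -> z - l != 0.
  by move=> z1; rewrite -cabs_eq0 gt_eqF// (lt_le_trans a0) ?za1.
have a1 : a <= 1 by rewrite /a gerBl cabs_ge0.
exists (a ^- 2); split.
- by rewrite invr_ge0 exprn_ge0// ltW.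
- move=> z z1; have z0 : 0 < cabs z by exact: lt_le_trans z1.
  rewrite cabsV -invfM lef_pV2 ?posrE ?mulr_gt0 ?exprn_gt0//; last first.
    by apply: lt_le_trans (za1 _ z1).
  apply: le_trans (za _ z1); rewrite ler_wpM2r ?cabs_ge0// expr2.
  by rewrite ler_piMr// ltW.
- move=> z r z1 r1; set zr := toC r * z.
  have zr1 : 1 <= cabs zr by rewrite cabsM cabs_toC z1 mulr1 ger0_norm// (le_trans _ r1).
  have z1' : 1 <= cabs z by rewrite z1.
  have -> : (zr - l)^-1 - (z - l)^-1 = - ((r - 1)%:C%C * z * (zr - l)^-1 * (z - l)^-1).
    rewrite -[(r - 1)%:C%C]/(toC (r - 1)).
    have -> : toC (r - 1) = toC r - 1 by rewrite /toC; apply/eqP; rewrite eq_complex /= subr0 !eqxx.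
    rewrite /zr; field; rewrite zn//= -/zr zn//.
  rewrite cabsN !cabsM z1 mulr1 -[(r - 1)%:C%C]/(toC (r - 1)) cabs_toC ger0_norm ?subr_ge0//.
  rewrite !cabsV -mulrA [leRHS]mulrC ler_wpM2l ?subr_ge0// expr2 invfM.
  apply: ler_pM; rewrite ?invr_ge0 ?cabs_ge0// lef_pV2 ?posrE ?za1//;
   exact: lt_le_trans (za1 _ _).
- apply: ccontV => [w|]; first by rewrite /= zn ?cabs_expi.
  by apply: ccontB; [exact: ccont_expi|exact: ccont_cst].
Qed.

Lemma tame_frac_exp (l : CC R) n : cabs l < 1 -> (0 < n)%N ->
  tame (fun z => ((z - l) ^+ n)^-1).
Proof.
move=> l1; case: n => // n _; elim: n => [|n IH].
  by under eq_fun do rewrite expr1; exact: tame_frac.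
under eq_fun do rewrite exprS invfM.
by apply: tameM => //; exact: tame_frac.
Qed.

End tame.

Section bernoulli.
Context {R : realType}.

Lemma sum_geometric_le (x : R) n : 0 <= x < 1 -> \sum_(k < n) x ^+ k <= (1 - x)^-1.
Proof.
move=> /andP[x0 x1]; rewrite -[leRHS]mulr1 -ler_pdivrMl ?invr_gt0 ?subr_gt0// invrK.
rewrite -[leLHS]opprK -mulNr opprB -subrX1 opprB gerBl exprn_ge0//.
Qed.

Lemma bernoulli_le (t : R) n : 0 <= t <= 1 -> 1 - n%:R * t <= (1 - t) ^+ n.
Proof.
move=> /andP[t0 t1]; elim: n => [|n IH]; first by rewrite mul0r subr0 expr0.
rewrite exprS; apply: (@le_trans _ _ ((1 - t) * (1 - n%:R * t))); last first.
  by rewrite ler_wpM2l// subr_ge0.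
rewrite -natr1; have : 0 <= n%:R * t ^+ 2 by rewrite mulr_ge0 ?sqr_ge0.
by lra.
Qed.

Lemma geometric_lt (x A e : R) : 0 <= x < 1 -> 0 < e ->
  exists n0, forall n, (n0 <= n)%N -> A * x ^+ n < e.
Proof.
move=> /andP[x0 x1] e0.
have cv : (fun n => A * x ^+ n) @ \oo --> A * 0.
  by apply: cvgMr; apply: cvg_expr; rewrite ger0_norm.
rewrite mulr0 in cv; have [n0 _ h] := cvgr_lt _ cv _ e0.
by exists n0 => n hn; exact: h.
Qed.

End bernoulli.

(** * Coefficients of a series in 1/z that converges pointwise on |z| >= 1 *)

Section scalar_impulse_response.
Context {R : realType}.
Variables (f : CC R -> CC R) (h : nat -> R).
Hypothesis hP : forall z : CC R, 1 <= cabs z ->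
  (fun K : nat => \sum_(k < K) z ^- k * toC (h k)) @ \oo --> f z.

Lemma cvg_cabs (u : nat -> CC R) (l : CC R) (e : R) : u @ \oo --> l -> 0 < e ->
  exists n0, forall n, (n0 <= n)%N -> cabs (l - u n) < e.
Proof.
move=> /cvgrPdist_lt ul e0.
have [|n0 _ H] := ul e%:C%C; first by rewrite ltcR.
by exists n0 => n /H /=; rewrite /Num.norm/= ltcR.
Qed.

Let S z K : CC R := \sum_(k < K) z ^- k * toC (h k).

(** At z = 1 the coefficients are differences of consecutive partial sums of a convergent series, so
    all but finitely many are at most 2; the sum covers the others. *)
Lemma impulse_bounded : exists2 A : R, 0 <= A & forall k, `|h k| <= A.
Proof.
have z1 : 1 <= cabs (1 : CC R) by rewrite cabs1.
have [n0 Hn] := cvg_cabs _ _ 1 (hP 1 z1) ltr01.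
exists (2 + \sum_(k < n0) `|h k|) => [|k].
  by rewrite addr_ge0// sumr_ge0.
have [kn|nk] := ltnP k n0.
  rewrite (bigD1 (Ordinal kn))//= addrCA lerDl addr_ge0// sumr_ge0//.
apply: (@le_trans _ _ 2); last by rewrite lerDl sumr_ge0.
have e : toC (h k) = (f 1 - S 1 k) - (f 1 - S 1 k.+1).
  rewrite /S big_ord_recr/= expr1n invr1 mul1r; ring.
rewrite -cabs_toC e; apply: (le_trans (cabsD _ _)); rewrite cabsN.
by rewrite mulr2n lerD// ltW// Hn// leqW.
Qed.

Lemma impulse_tail A z L : (forall k, `|h k| <= A) -> 1 < cabs z ->
  cabs (f z - S z L) <= A / (1 - (cabs z)^-1) * (cabs z)^-1 ^+ L.
Proof.
move=> hA z1; set x := (cabs z)^-1.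
have A0 : 0 <= A by apply: le_trans (hA 0%N).
have zp : 0 < cabs z by exact: lt_trans z1.
have x0 : 0 <= x by rewrite invr_ge0 ltW.
have x1 : x < 1 by rewrite invf_lt1.
apply/ler_addgt0Pr => e e0.
have [n0 Hn] := cvg_cabs _ _ _ (hP z (ltW z1)) e0.
set n := (L + n0)%N.
rewrite -(subrK (S z n) (f z)) -addrA addrC.
apply: (le_trans (cabsD _ _)); apply: lerD; last by rewrite ltW// Hn// leq_addl.
have -> : S z n - S z L = \sum_(k < n0) z ^- (L + k) * toC (h (L + k)%N).
  by rewrite /S /n big_split_ord/= [X in X - _]addrC addrK.
apply: (le_trans (cabs_sum _ _ _ _)).
apply: (@le_trans _ _ (\sum_(k < n0) A * x ^+ L * x ^+ k)).
  apply: ler_sum => k _; rewrite cabsM cabs_toC cabsV cabsX -exprVn -/x exprD mulrC mulrA.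
  by rewrite ler_wpM2r ?exprn_ge0// ler_wpM2r ?exprn_ge0.
rewrite -mulr_sumr [leRHS]mulrAC ler_wpM2l ?mulr_ge0 ?exprn_ge0//.
by apply: sum_geometric_le; rewrite x0.
Qed.

Hypothesis tf : tame f.

(** Let z tend to infinity along the reals: both f z and the tail of the series after its first term
    are O(1/|z|). *)
Lemma impulse_response0 : h 0%N = 0.
Proof.
have [C [C0 fb _ _]] := tf; have [A A0 hA] := impulse_bounded.
apply/eqP; rewrite -normr_le0; apply/ler_addgt0Pr => e e0; rewrite add0r.
(* With 1/z = x = e/B one has x <= 1/2, hence 1/(1 - x) <= 2, and (C + 2 A) x <= e. *)
set B := C + 2 * A + 2 * e; have B0 : 0 < B by rewrite /B; lra.
set x := e / B.
have x0 : 0 < x by rewrite divr_gt0.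
have x2 : x <= 1 / 2 by rewrite ler_pdivrMr// /B; lra.
have zE : cabs (toC x^-1) = x^-1 by rewrite cabs_toC ger0_norm// invr_ge0 ltW.
have z1 : 1 < cabs (toC x^-1) by rewrite zE invf_gt1//; lra.
have t := impulse_tail A _ 1 hA z1.
rewrite zE invrK expr1 /S big_ord1 expr0 invr1 mul1r in t.
have fz := fb _ (ltW z1); rewrite zE invrK in fz.
have i2 : (1 - x)^-1 <= 2.
  by rewrite -[leRHS]invrK lef_pV2 ?posrE ?invr_gt0 ?subr_gt0//; lra.
rewrite -cabs_toC -[toC (h 0%N)](subKr (f (toC x^-1))).
apply: (le_trans (cabsD _ _)); rewrite cabsN.
apply: (@le_trans _ _ (C * x + A * 2 * x)).
  by apply: lerD => //; apply: (le_trans t); rewrite ler_wpM2r ?(ltW x0)// ler_wpM2l.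
rewrite -mulrDl /x mulrCA -[leRHS]mulr1 ler_wpM2l ?(ltW e0)// ler_pdivrMr// mul1r /B.
lra.
Qed.

(** Bessel's inequality for a series that need not converge uniformly on the circle: on radius 1/(1
    - t) a truncation is uniformly close to f on the unit circle, Parseval is exact for it, and t
    then tends to 0. *)
Lemma impulse_energy_le K c :
  has_integral lebesgue_measure `[- pi, pi]%classic (fun w => cabs (f (expi w)) ^+ 2) c ->
  2 * pi * \sum_(k < K) h k ^+ 2 <= c.
Proof.
move=> fc; have [C [C0 fb fl _]] := tf; have [A A0 hA] := impulse_bounded.
have p0 : 0 < 2 * pi :> R by rewrite mulr_gt0// (pi_gt0 R).
set E := \sum_(k < K) _.
set B := \sum_(k < K) 2 * k%:R * h k ^+ 2.
have B0 : 0 <= B by apply: sumr_ge0 => k _; rewrite mulr_ge0 ?sqr_ge0.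
(* For t <= 1/2, leaving the unit circle costs C (r - 1) <= 2 C t, and L is taken so large that
   truncating costs at most t. *)
pose D := 2 * C + 1.
have key t : 0 < t <= 1 / 2 ->
    2 * pi * (E - t * B) <= c + 2 * pi * (2 * C * (D * t) + (D * t) ^+ 2).
  move=> /andP[t0 t2]; set x := 1 - t.
  have x0 : 0 < x by rewrite /x; lra.
  have x1 : x < 1 by rewrite /x; lra.
  have xb : 0 <= x < 1 by rewrite (ltW x0).
  set r := x^-1; have r1 : 1 < r by rewrite invf_gt1.
  have [L0 HL] := geometric_lt x (A / (1 - x)) t xb t0.
  pose L := (K + L0)%N.
  pose T (w : R) : CC R := \sum_(k < L) toC (h k * x ^+ k) * expi ((- (k : nat)%:Z)%:~R * w).
  have Tint : has_integral lebesgue_measure `[- pi, pi]%classic (fun w => cabs (T w) ^+ 2)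
      (2 * pi * \sum_(k < L) cabs (toC (h k * x ^+ k)) ^+ 2).
    apply: (has_trig_integral_parseval _ (fun k : 'I_L => - (k : nat)%:Z)) => k l.
    by move=> /oppr_inj [] /val_inj.
  have Tf w : cabs (T w) <= cabs (f (expi w)) + D * t.
    have zE : cabs (toC r * expi w) = r.
      by rewrite cabsM cabs_expi mulr1 cabs_toC ger0_norm// ltW// (lt_trans _ r1).
    have := impulse_tail A (toC r * expi w) L hA; rewrite zE => /(_ r1).
    rewrite invrK => tl.
    have SE : S (toC r * expi w) L = T w.
      rewrite /S /T; apply: eq_bigr => k _.
      have -> : (toC r * expi w) ^- k = toC (x ^+ k) * expi ((- (k : nat)%:Z)%:~R * w).
        rewrite -exprVn invfM -toCV /r invrK expiV exprMn -toCX expiX.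
        by congr (_ * expi _); rewrite intrN mulNr mulrN.
      by rewrite toCM; ring.
    rewrite SE in tl.
    have l1 := fl (expi w) r (cabs_expi w) (ltW r1).
    set z := toC r * expi w in l1 tl.
    have -> : T w = (f z - f (expi w)) + f (expi w) - (f z - T w) by ring.
    have rt : C * (r - 1) <= C * (2 * t).
      rewrite ler_wpM2l// lerBlDr -[r]mul1r -/x /r ler_pdivrMr//.
      by have := mulr_gt0 t0 t0; rewrite /x; nra.
    have tt : A / (1 - x) * x ^+ L < t by rewrite HL// leq_addl.
    have := cabsD (f z - f (expi w) + f (expi w)) (- (f z - T w)).
    have := cabsD (f z - f (expi w)) (f (expi w)).
    by rewrite cabsN /D; lra.
  have fC w : cabs (f (expi w)) <= C by have := fb (expi w); rewrite cabs_expi divr1 => ->.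
  have Dt : 0 <= D * t by rewrite mulr_ge0 ?(ltW t0)// /D; lra.
  have fcD := has_integralD lebesgue_measure _ (measurable_itv _) _ _ _ _ fc
    (has_trig_integral_cst (2 * C * (D * t) + (D * t) ^+ 2)).
  apply: le_trans (le_has_integral lebesgue_measure _ (measurable_itv _) _ _ _ _ _ Tint fcD);
    last first.
    move=> w _; apply: (@le_trans _ _ ((cabs (f (expi w)) + D * t) ^+ 2)).
      by rewrite ler_pXn2r ?nnegrE ?cabs_ge0 ?addr_ge0 ?cabs_ge0.
    rewrite sqrrD -addrA lerD2l lerD2r -mulr_natl -mulrA ler_wpM2l// ler_wpM2r//.
  rewrite ler_pM2l// /L big_split_ord/=.
  apply: (@le_trans _ _ (\sum_(k < K) cabs (toC (h k * x ^+ k)) ^+ 2)); last first.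
    by rewrite lerDl sumr_ge0// => k _; exact: sqr_ge0.
  (* Bernoulli's inequality (1 - t)^(2k) >= 1 - 2 k t: the damping of the first K coefficients costs
     at most t B. *)
  rewrite /E /B mulr_sumr -sumrB; apply: ler_sum => k _.
  rewrite cabs_toC real_normK ?num_real// exprMn -exprM mulnC.
  have := bernoulli_le t (2 * k); rewrite (ltW t0) (le_trans t2) ?ler_pdivrMr ?mul1r ?ler1n//.
  move=> /(_ isT); rewrite -/x natrM => /(ler_wpM2l (sqr_ge0 (h k))); lra.
apply/ler_addgt0Pr => e e0.
(* Since t^2 <= t, the total error is at most t times the first summand of Q. With t = e/Q it is at
   most e, and the summand 2 e ensures t <= 1/2. *)
set Q := 2 * pi * (B + 2 * C * D + D ^+ 2) + 2 * e.
have D0 : 0 <= D by rewrite /D; lra.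
have Q0 : 0 <= 2 * pi * (B + 2 * C * D + D ^+ 2).
  by rewrite mulr_ge0 ?(ltW p0)// !addr_ge0 ?sqr_ge0// !mulr_ge0.
have Q1 : 0 < Q by rewrite /Q; lra.
pose t := e / Q.
have t0 : 0 < t by rewrite divr_gt0.
have t2 : t <= 1 / 2 by rewrite ler_pdivrMr// /Q; lra.
have := key t; rewrite t0 t2 => /(_ isT).
have tt : t ^+ 2 <= t by rewrite expr2 ler_piMl ?(ltW t0)//; lra.
have tQ : t * (2 * pi * (B + 2 * C * D + D ^+ 2)) <= e.
  rewrite /t mulrAC ler_pdivrMr// ler_wpM2l ?(ltW e0)// /Q; lra.
have : 2 * pi * D ^+ 2 * t ^+ 2 <= 2 * pi * D ^+ 2 * t.
  by rewrite ler_wpM2l// mulr_ge0 ?sqr_ge0// ltW.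
lra.
Qed.

End scalar_impulse_response.

Section matrix_impulse_response.
Context {R : realType} (p m : nat).
Local Notation has_trig_integral := (@has_integral R _ _ lebesgue_measure `[- pi, pi]%classic).

Lemma continuous_has_trig_integral (f : R -> R) : continuous f ->
  exists c, has_trig_integral f c.
Proof.
move=> cf; have fi : lebesgue_measure.-integrable `[- pi, pi] (EFin \o f).
  apply: continuous_compact_integrable; first exact: segment_compact.
  exact: continuous_subspaceT.
exists (fine (\int[lebesgue_measure]_(w in `[(- pi)%R, pi%R]) (f w)%:E)); split => //.
by rewrite fineK// integrable_fin_num.
Qed.

Lemma frobC_sqr (a b : nat) (A : 'M[CC R]_(a, b)) :
  frobC A ^+ 2 = \sum_i \sum_j cabs (A i j) ^+ 2.
Proof.
rewrite sqr_sqrtr//; apply: sumr_ge0 => i _; apply: sumr_ge0 => j _; exact: sqr_ge0.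
Qed.

Lemma h2norm_sqE (F : CC R -> 'M[CC R]_(p, m)) c :
  has_trig_integral (fun w => frobC (F (expi w)) ^+ 2) c ->
  h2norm_sq F = (2 * pi)^-1 * c.
Proof.
move=> [_ Fc]; congr (_ * _); rewrite /Rintegral.
under eq_integral => w _.
  rewrite (_ : complex.Re _ = frobC (F (expi w)) ^+ 2); first over.
  rewrite frobC_sqr /mxtrace Re_sum; apply: eq_bigr => i _.
  rewrite mxE Re_sum; apply: eq_bigr => j _.
  by rewrite !mxE cabs_sqrE.
by rewrite Fc.
Qed.

Variables (F : CC R -> 'M[CC R]_(p, m)) (h : nat -> 'M[R]_(p, m)).
Hypotheses (tF : forall i j, tame (fun z => F z i j)) (hP : impulse_response F h).

Lemma tame_has_trig_integral : exists c : 'I_p -> 'I_m -> R,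
  (forall i j, has_trig_integral (fun w => cabs (F (expi w) i j) ^+ 2) (c i j)) /\
  has_trig_integral (fun w => frobC (F (expi w)) ^+ 2) (\sum_i \sum_j c i j).
Proof.
have /choice [c Hc] : forall ij : 'I_p * 'I_m, exists c,
    has_trig_integral (fun w => cabs (F (expi w) ij.1 ij.2) ^+ 2) c.
  move=> [i j]; apply: continuous_has_trig_integral.
  by have [_ [_ _ _ cF]] := tF i j; exact: (continuous_cabs_sqr _ cF).
exists (fun i j => c (i, j)); split=> [i j|]; first exact: (Hc (i, j)).
apply: (eq_has_integral lebesgue_measure `[- pi, pi]%classic
  (fun w => \sum_i \sum_j cabs (F (expi w) i j) ^+ 2) _ (\sum_i \sum_j c (i, j))) => //.
  by move=> w; rewrite frobC_sqr.
by apply: has_integral_sum => // i; apply: has_integral_sum => // j; exact: (Hc (i, j)).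
Qed.

Lemma matrix_impulse_response0 : h 0%N = 0.
Proof.
apply/matrixP => i j; rewrite mxE.
exact: (impulse_response0 (fun z => F z i j) (fun k => h k i j) (fun z z1 => hP z z1 i j)).
Qed.

Lemma matrix_impulse_energy_le K : \sum_(k < K) frob (h k) ^+ 2 <= h2norm_sq F.
Proof.
have [c [Hc Hs]] := tame_has_trig_integral.
have p0 : 0 < 2 * pi :> R by rewrite mulr_gt0// (pi_gt0 R).
rewrite (h2norm_sqE _ _ Hs).
rewrite ler_pdivlMl//.
under eq_bigr do rewrite frob_sqr.
rewrite exchange_big/= mulr_sumr; apply: ler_sum => i _.
rewrite exchange_big/= mulr_sumr; apply: ler_sum => j _.
exact: (impulse_energy_le (fun z => F z i j) (fun k => h k i j)
  (fun z z1 => hP z z1 i j) (tF i j) K _ (Hc i j)).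
Qed.

End matrix_impulse_response.

(** * The mean of the Poisson kernel *)

Section poisson.
Context {R : realType}.
Local Notation has_trig_integral := (@has_integral R _ _ lebesgue_measure `[- pi, pi]%classic).

Lemma expi_sub_neq0 (l : CC R) w : cabs l < 1 -> expi w - l != 0.
Proof.
move=> l1; rewrite subr_eq0; apply: contraTneq l1 => <-.
by rewrite cabs_expi ltxx.
Qed.

Lemma poisson_kernelE (l : CC R) w : cabs l < 1 ->
  (1 - cabs l ^+ 2) * cabs ((expi w - l)^-1) ^+ 2 = 1 + 2 * complex.Re (l * (expi w - l)^-1).
Proof.
move=> l1; set z := expi w; set d := z - l.
have d0 : d != 0 by exact: expi_sub_neq0.
have s0 : cabs d ^+ 2 != 0 by rewrite sqrf_eq0 cabs_eq0.
have z1 : complex.Re z ^+ 2 + complex.Im z ^+ 2 = 1 by rewrite -cabs_sqr cabs_expi expr1n.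
rewrite cabsV exprVn cReM cReV cImV.
apply: (mulIf s0); rewrite divfK// mulrDl mul1r -mulrA mulrBl mulrN mulNr opprK.
transitivity (cabs d ^+ 2 + 2 * (complex.Re l * complex.Re d + complex.Im l * complex.Im d));
  last by rewrite -!(mulrA _ (_ / _)) !divfK.
rewrite !cabs_sqr /d; case: (l) (z) z1 => [a b] [x y] /= z1.
rewrite -{1}z1; ring.
Qed.

Lemma frac_geometric (l z : CC R) K : z != 0 -> z - l != 0 ->
  l / (z - l) = \sum_(k < K) l ^+ k.+1 * z ^- k.+1 + l ^+ K.+1 * z ^- K / (z - l).
Proof.
move=> z0 zl; elim: K => [|K IH]; first by rewrite big_ord0 add0r expr0 invr1 mulr1 expr1.
rewrite IH big_ord_recr/= -addrA; congr (_ + _).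
rewrite !exprS; have zK : z ^+ K != 0 by rewrite expf_neq0.
by field; rewrite ?zl ?z0 ?zK.
Qed.

(** The kernel is 1 + 2 Re(l/(z - l)); in the geometric expansion of the last term every character
    has mean 0, and the remainder is uniformly small. *)
Lemma poisson_le (l : CC R) c : cabs l < 1 ->
  has_trig_integral (fun w => cabs ((expi w - l)^-1) ^+ 2) c ->
  (1 - cabs l ^+ 2) * c <= 2 * pi.
Proof.
move=> l1 ci; have p0 : 0 < pi :> R by exact: pi_gt0.
have a0 : 0 < 1 - cabs l by rewrite subr_gt0.
apply/ler_addgt0Pr => e e0.
(* The remainder enters doubled and is integrated over a length 2 pi, so it contributes e in all. *)
have e0' : 0 < e / (4 * pi) by rewrite divr_gt0// mulr_gt0.
have lb : 0 <= cabs l < 1 by rewrite cabs_ge0.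
have [K HK] := geometric_lt (cabs l) (1 / (1 - cabs l)) _ lb e0'.
have hs : has_trig_integral (fun w => 1 + 2 * (\sum_(k < K)
     complex.Re (l ^+ k.+1 * expi ((- (k.+1)%:Z)%:~R * w))) + 2 * (e / (4 * pi)))
   (2 * pi * 1 + 2 * (\sum_(k < K) 0) + 2 * pi * (2 * (e / (4 * pi)))).
  apply: has_integralD => //; last exact: has_trig_integral_cst.
  apply: has_integralD => //; first exact: has_trig_integral_cst.
  apply: has_integralZ => //; apply: has_integral_sum => // k.
  exact: (has_trig_integral_expi (- (k.+1)%:Z)).
apply: (@le_trans _ _ (2 * pi * 1 + 2 * (\sum_(k < K) 0) + 2 * pi * (2 * (e / (4 * pi))))).
  apply: (le_has_integral lebesgue_measure _ (measurable_itv _) _ _ _ _ _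
    (has_integralZ lebesgue_measure _ (measurable_itv _) _ _ (1 - cabs l ^+ 2) ci) hs) => w _.
  rewrite poisson_kernelE// -!addrA lerD2l -mulrDr ler_wpM2l//.
  rewrite (frac_geometric _ _ K) ?expi_neq0 ?expi_sub_neq0// ReD Re_sum.
  apply: lerD.
    apply: ler_sum => k _; rewrite -exprVn expiV expiX.
    by rewrite intrN mulNr mulrN.
  apply: (le_trans (ler_norm _)); apply: (le_trans (Re_le_cabs _)).
  rewrite !cabsM !cabsV !cabsX cabs_expi expr1n invr1 mulr1 mulrC.
  apply: (le_trans _ (ltW (HK K.+1 (leqnSn K)))).
  rewrite ler_wpM2r ?exprn_ge0 ?cabs_ge0// div1r lef_pV2 ?posrE//.
    by apply: le_trans (cabsB_ge _ _); rewrite cabs_expi.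
  by rewrite lt_neqAle cabs_ge0 andbT eq_sym cabs_eq0 expi_sub_neq0.
rewrite big1// mulr0 addr0 mulr1 lerD2l le_eqVlt; apply/orP; left; apply/eqP.
by move: p0; generalize (pi : R) => q q0; field; rewrite gt_eqF.
Qed.

End poisson.

(** * Interpolation by partial fractions *)

Section partial_fraction_span.
Context {R : realType}.
Implicit Types (mu : nat -> CC R) (q : {poly CC R}).

(** The counterpart of [pole_order] for infinite sequences (see [node_orderE]), which allows
    induction on the number of nodes. *)
Definition node_order mu k : nat := count_mem (mu k) (mkseq mu k.+1).

Lemma prod_sub_count (s : seq (CC R)) (a z : CC R) :
  \prod_(x <- s) (z - x) =
  (z - a) ^+ count_mem a s * \prod_(x <- s | x != a) (z - x).
Proof.
elim: s => [|x s IH]; first by rewrite !big_nil expr0 mulr1.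
rewrite !big_cons /=; case: (eqVneq x a) => [->|xa] /=.
  by rewrite add1n exprS IH mulrA.
by rewrite add0n IH mulrCA.
Qed.

(** Partial fractions with multiplicities, without sorting the nodes: one term with the last node in
    its full order is removed, and what is left loses a factor z - a. The coefficients b do not
    depend on z. *)
Lemma partial_fraction_span mu N q : (size q <= N)%N ->
  exists b : nat -> CC R, forall z, (forall k, (k < N)%N -> z - mu k != 0) ->
    q.[z] / \prod_(x <- mkseq mu N) (z - x) =
    \sum_(k < N) ((z - mu k) ^+ node_order mu k)^-1 * b k.
Proof.
elim: N q => [|N IH] q qN.
  exists (fun=> 0) => z _; move: qN; rewrite leqn0 size_poly_eq0 => /eqP ->.
  by rewrite horner0 mul0r big_ord0.
set a := mu N; set s := mkseq mu N.+1.
have sN : s = rcons (mkseq mu N) a by rewrite /s mkseqS.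
(* W gathers the nodes other than a, so W over the full product is 1/(z - a) to the order of a, and
   W(a) is nonzero. *)
pose W : {poly CC R} := \prod_(x <- [seq x <- s | x != a]) ('X - x%:P).
have Wa : W.[a] != 0.
  rewrite horner_prod prodf_seq_neq0; apply/allP => x.
  by rewrite mem_filter => /andP[xa _]; rewrite hornerXsubC subr_eq0 eq_sym.
have sW : (size W <= N.+1)%N.
  rewrite size_prod_XsubC ltnS size_filter.
  have : (count_mem a s + count (fun x => x != a) s)%N = N.+1.
    by rewrite -[RHS](size_mkseq mu) -/s -(count_predC (pred1 a)).
  have : (0 < count_mem a s)%N by rewrite -has_count has_pred1 sN mem_rcons inE eqxx.
  lia.
(* Chosen so that q - c W vanishes at a and can be divided by X - a. *)
pose c := q.[a] / W.[a].
have : root (q - c *: W) a.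
  by rewrite /root hornerD hornerN hornerZ /c divfK// subrr.
move=> /factor_theorem[q' qE].
have sq' : (size q' <= N)%N.
  have [->|q'0] := eqVneq q' 0; first by rewrite size_poly0.
  rewrite -ltnS.
  have : size (q' * ('X - a%:P)) = (size q').+1.
    by rewrite size_Mmonic ?monicXsubC// size_XsubC addn2.
  rewrite -qE => <-; apply: (leq_trans (size_polyD _ _)).
  by rewrite geq_max qN size_polyN (leq_trans (size_scale_leq _ _)).
have [b Hb] := IH _ sq'.
exists (fun k => if k == N then c else b k) => z zn.
have zN : z - a != 0 by exact: zn.
have zP : \prod_(x <- mkseq mu N) (z - x) != 0.
  rewrite prodf_seq_neq0; apply/allP => x /mapP[k]; rewrite mem_iota => /= kN ->.
  by apply: zn; rewrite ltnS ltnW.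
rewrite big_ord_recr/= eqxx.
rewrite (eq_bigr (fun k : 'I_N => ((z - mu k) ^+ node_order mu k)^-1 * b k)); last first.
  by move=> k _; rewrite ltn_eqF.
rewrite -Hb; last by move=> k kN; apply: zn; rewrite ltnS ltnW.
have PE : \prod_(x <- s) (z - x) = \prod_(x <- mkseq mu N) (z - x) * (z - a).
  by rewrite sN -cats1 big_cat big_seq1.
have WE : \prod_(x <- s) (z - x) = (z - a) ^+ node_order mu N * W.[z].
  rewrite (prod_sub_count s a) horner_prod big_filter; congr (_ * _).
  by apply: eq_bigr => x _; rewrite hornerXsubC.
have -> : q.[z] = c * W.[z] + q'.[z] * (z - a).
  rewrite -[q in LHS](subrK (c *: W)) qE hornerD hornerM hornerXsubC hornerZ; ring.
have P0 : \prod_(x <- s) (z - x) != 0 by rewrite PE mulf_neq0.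
rewrite mulrDl [LHS]addrC -/a; congr (_ + _).
  by rewrite PE; field; rewrite zN zP.
have W0 : W.[z] != 0 by move: P0; rewrite WE mulf_eq0 negb_or => /andP[].
have o0 : (z - a) ^+ node_order mu N != 0 by rewrite expf_neq0.
by apply: (mulIf P0); rewrite divfK// WE mulrACA mulVf// mul1r.
Qed.

(** The reciprocal of the usual Blaschke product: its poles are the nodes. *)
Definition blaschke mu N (z : CC R) : CC R :=
  \prod_(k < N) ((1 - conjc (mu k) * z) / (z - mu k)).

Definition blaschke_at_pole mu N (l : CC R) : CC R :=
  \prod_(k < N) ((l - mu k) / (1 - conjc (mu k) * l)).

(** For l distinct from the nodes, the constant is the reciprocal of [blaschke] at l, which gives
    the residue 1 at l and cancels the pole of 1/(z - l); if l is a node, the error is 0. *)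
Definition interpolation_error mu N (l z : CC R) : CC R :=
  blaschke_at_pole mu N l / (z - l) * blaschke mu N z.

Lemma conj_one_sub_neq0 (a l : CC R) : cabs a < 1 -> cabs l <= 1 -> 1 - conjc a * l != 0.
Proof.
move=> a1 l1; rewrite subr_eq0; apply/eqP => /(congr1 (@cabs R)).
rewrite cabs1 cabsM cabsJ => /eqP; apply/negP; rewrite gt_eqF//.
by apply: le_lt_trans a1; rewrite ler_piMr ?cabs_ge0.
Qed.

(* The increments telescope because
   (1 - mu' l) (z - mu) - (l - mu) (1 - mu' z) = (z - l) (1 - mu mu'), mu' = conj mu. *)
Lemma interpolation_span mu N (l : CC R) : (forall k, cabs (mu k) < 1) -> cabs l < 1 ->
  exists b : nat -> CC R, forall z, cabs z = 1 ->
    (z - l)^-1 - interpolation_error mu N l z =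
    \sum_(k < N) ((z - mu k) ^+ node_order mu k)^-1 * b k.
Proof.
move=> mu1 l1; have zn (z x : CC R) : cabs z = 1 -> cabs x < 1 -> z - x != 0.
  by move=> z1 x1; rewrite subr_eq0; apply: contraTneq x1 => <-; rewrite z1 ltxx.
elim: N => [|N [b Hb]].
  exists (fun=> 0) => z z1; rewrite big_ord0 /interpolation_error /blaschke /blaschke_at_pole.
  by rewrite !big_ord0 mul1r mulr1 subrr.
set a := mu N.
pose c := blaschke_at_pole mu N l * (1 - conjc a * a) / (1 - conjc a * l).
pose cm k : CC R := conjc (mu k).
(* The increment from N to N + 1 nodes is q over the product of all z - mu k, and q has degree at
   most N. *)
pose q : {poly CC R} := c *: \prod_(k < N) (1 - (cm k)%:P * 'X).
have sq : (size q <= N.+1)%N.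
  apply: (leq_trans (size_scale_leq _ _)).
  elim: (N) => [|n IH]; first by rewrite big_ord0 size_poly1.
  rewrite big_ord_recr/=; apply: (leq_trans (size_polyMleq _ _)).
  have s2 : (size (1 - (cm n)%:P * 'X)%R <= 2)%N.
    apply: (leq_trans (size_polyD _ _)); rewrite geq_max size_poly1 size_polyN/=.
    by rewrite mul_polyC; apply: (leq_trans (size_scale_leq _ _)); rewrite size_polyX.
  apply: (@leq_trans (n.+1 + 2).-1); last by rewrite addn2.
  by rewrite -!subn1 leq_sub2r// leq_add.
have [b' Hb'] := partial_fraction_span mu _ _ sq.
exists (fun k => (if (k < N)%N then b k else 0) + b' k) => z z1.
have -> : \sum_(k < N.+1) ((z - mu k) ^+ node_order mu k)^-1 *
      ((if (k < N)%N then b k else 0) + b' k) =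
   \sum_(k < N) ((z - mu k) ^+ node_order mu k)^-1 * b k +
   \sum_(k < N.+1) ((z - mu k) ^+ node_order mu k)^-1 * b' k.
  under eq_bigr do rewrite mulrDr; rewrite big_split/=; congr (_ + _).
  rewrite big_ord_recr/= ltnn mulr0 addr0; apply: eq_bigr => k _.
  by rewrite ltn_ord.
rewrite -Hb// -Hb'; last by move=> k _; exact: zn (mu1 k).
rewrite -[LHS](subrKA (interpolation_error mu N l z)); congr (_ + _).
have za : z - a != 0 by exact: zn (mu1 N).
have zl : z - l != 0 by exact: zn l1.
have al : 1 - conjc a * l != 0 by exact: conj_one_sub_neq0 _ _ (mu1 N) (ltW l1).
have P0 : \prod_(k < N) (z - mu k) != 0.
  by rewrite prodf_seq_neq0; apply/allP => k _ /=; exact: zn (mu1 k).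
rewrite /interpolation_error /blaschke /blaschke_at_pole !big_ord_recr/= -!/(blaschke_at_pole _ _ _).
have -> : q.[z] = c * \prod_(k < N) (1 - conjc (mu k) * z).
  rewrite hornerZ horner_prod; congr (_ * _); apply: eq_bigr => k _.
  by rewrite hornerD hornerN hornerM hornerX !hornerC.
rewrite big_map -/(index_iota 0 N.+1) big_mkord big_ord_recr/=.
rewrite !prodf_div /c -/a -/(blaschke_at_pole mu N l).
move: (\prod_(k < N) (z - mu k)) P0 (\prod_(k < N) (1 - conjc (mu k) * z))
  (blaschke_at_pole mu N l) => P P0 Q B.
by field; rewrite ?za ?zl ?al ?P0.
Qed.

Lemma cabs_blaschke mu N z : (forall k, cabs (mu k) < 1) -> cabs z = 1 ->
  cabs (blaschke mu N z) = 1.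
Proof.
move=> mu1 z1; apply: (big_ind (fun x => cabs x = 1)); first exact: cabs1.
  by move=> x y x1 y1; rewrite cabsM x1 y1 mulr1.
move=> k _; have -> : 1 - conjc (mu k) * z = z * conjc (z - mu k).
  rewrite conjcD mulrDr -[X in _ + z * X]/(conjc (- mu k)).
  rewrite mul_conjc z1 expr1n -[toC 1]/(1 : CC R).
  by rewrite rmorphN mulrN [z * _]mulrC.
rewrite !cabsM z1 mul1r cabsJ cabsV mulfV// cabs_eq0 subr_eq0.
by apply: contraTneq (mu1 k) => <-; rewrite z1 ltxx.
Qed.


End partial_fraction_span.

(** * The mean-square error of the best residues *)

Section surrogate_error.
Context {R : realType} {p m n : nat}.
Implicit Types (lam mu : 'I_n -> CC R) (A : 'I_n -> 'M[CC R]_(p, m)).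

Lemma pole_order_gt0 lam k : (0 < pole_order lam k)%N.
Proof. by apply/card_gt0P; exists k; rewrite inE leqnn eqxx. Qed.

Lemma pole_order_inj lam k : injective lam -> pole_order lam k = 1%N.
Proof.
move=> li; apply/eqP/cards1P; exists k; apply/finset.setP => i.
rewrite !inE (inj_eq li); case: eqVneq => [->|_]; last by rewrite andbF.
by rewrite leqnn.
Qed.

Lemma partial_fractions_tame lam A : (forall k, cabs (lam k) < 1) ->
  forall i j, tame (fun z => partial_fractions lam A z i j).
Proof.
move=> l1 i j; rewrite (_ : (fun z => _) = fun z =>
   \sum_k ((z - lam k) ^+ pole_order lam k)^-1 * A k i j); last first.
  by apply/funext => z; rewrite summxE; apply: eq_bigr => k _; rewrite mxE.
by apply: tame_sum => k; apply: tameZ; apply: tame_frac_exp => //; exact: pole_order_gt0.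
Qed.

(** The default 0 lies in the unit disc, so a bound on the nodes holds for the whole sequence. *)
Definition extend_nodes mu (k : nat) : CC R := oapp mu 0 (insub k).

Lemma extend_nodesE mu (k : 'I_n) : extend_nodes mu k = mu k.
Proof. by rewrite /extend_nodes valK. Qed.

Lemma node_orderE mu (k : 'I_n) : node_order (extend_nodes mu) k = pole_order mu k.
Proof.
rewrite /node_order /pole_order extend_nodesE count_map -sum1_count cardsE -sum1_card.
rewrite -/(index_iota 0 k.+1) big_mkord.
rewrite (big_ord_widen_cond n (fun i => extend_nodes mu i == mu k) (fun=> 1%N))//.
by apply: eq_bigl => i; rewrite /= extend_nodesE ltnS unfold_in andbC.
Qed.

(** Weighting by the norms of the residues produces the square of their sum, where equal weights
    would produce n times the sum of their squares. *)
Lemma weighted_cauchy_schwarz (A : 'I_n -> 'M[CC R]_(p, m)) (e : 'I_n -> CC R) :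
  frobC (\sum_j e j *: A j) ^+ 2 <=
  (\sum_j frobC (A j)) * \sum_j frobC (A j) * cabs (e j) ^+ 2.
Proof.
set r := fun j => frobC (A j).
have r0 j : 0 <= r j by exact: sqrtr_ge0.
(* A residue of norm 0 has zero entries, so the quotients by r j below are harmless. *)
have A0 j a b : r j = 0 -> cabs (A j a b) = 0.
  move=> /(congr1 (fun x => x ^+ 2)); rewrite frobC_sqr expr0n/= => /eqP.
  rewrite psumr_eq0 => [/allP /(_ a)|i _]; last by apply: sumr_ge0 => k _; exact: sqr_ge0.
  rewrite mem_index_enum => /(_ isT)/=.
  rewrite psumr_eq0 => [/allP /(_ b)|i _]; last exact: sqr_ge0.
  by rewrite mem_index_enum => /(_ isT)/=; rewrite sqrf_eq0 => /eqP.
set S := \sum_j r j * cabs (e j) ^+ 2.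
have S0 : 0 <= S by apply: sumr_ge0 => j _; rewrite mulr_ge0 ?sqr_ge0.
have ab a b : cabs ((\sum_j e j *: A j) a b) ^+ 2 <= (\sum_j cabs (A j a b) ^+ 2 / r j) * S.
  have T0 : 0 <= \sum_j cabs (A j a b) ^+ 2 / r j.
    by apply: sumr_ge0 => j _; rewrite divr_ge0 ?sqr_ge0.
  rewrite -[leRHS]sqr_sqrtr ?mulr_ge0// ler_pXn2r ?nnegrE ?cabs_ge0 ?sqrtr_ge0//.
  rewrite summxE; apply: (le_trans (cabs_sum _ _ _ _)).
  rewrite sqrtrM//; have := sum_mul_le_sqrt _ (fun j => cabs (A j a b) / Num.sqrt (r j))
    (fun j => Num.sqrt (r j) * cabs (e j)).
  under eq_bigr => j _.
    rewrite (_ : _ / _ * _ = cabs ((e j *: A j) a b)); first over.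
    rewrite mxE cabsM mulrCA; have [rj|rj] := eqVneq (r j) 0.
      by rewrite (A0 _ _ _ rj) !(mul0r, mulr0).
    by field; rewrite sqrtr_eq0 -ltNge lt_neqAle eq_sym rj r0.
  move=> /le_trans; apply; rewrite le_eqVlt; apply/orP; left; apply/eqP.
  congr (Num.sqrt _ * Num.sqrt _); apply: eq_bigr => j _.
    by rewrite expr_div_n sqr_sqrtr.
  by rewrite exprMn sqr_sqrtr.
rewrite frobC_sqr; apply: (@le_trans _ _ (\sum_a \sum_b (\sum_j cabs (A j a b) ^+ 2 / r j) * S)).
  by apply: ler_sum => a _; apply: ler_sum => b _; exact: ab.
under eq_bigr do rewrite -mulr_suml exchange_big/=.
rewrite -mulr_suml ler_wpM2r// exchange_big/=; apply: ler_sum => j _.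
under eq_bigr do rewrite -mulr_suml.
rewrite -mulr_suml -frobC_sqr -/(r j); have [->|rj] := eqVneq (r j) 0; first by rewrite invr0 mulr0.
by rewrite expr2 mulfK.
Qed.

Lemma best_residues_le lam mu (A As : 'I_n -> 'M[CC R]_(p, m)) (M rho : R) :
  injective lam -> (forall k, cabs (lam k) < 1) -> (forall k, cabs (mu k) < 1) ->
  best_residues (partial_fractions lam A) mu As ->
  0 <= rho < 1 -> (forall k, cabs (lam k) <= rho) ->
  (forall k, hyp_prod mu (lam k) <= M) ->
  h2norm_sq (fun z => partial_fractions lam A z - partial_fractions mu As z) <=
  (\sum_j frobC (A j)) ^+ 2 * M ^+ 2 / (1 - rho ^+ 2).
Proof.
move=> li l1 m1 best /andP[rho0 rho1] lr lM.
set mu' := extend_nodes mu.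
have m1' k : cabs (mu' k) < 1.
  by rewrite /mu' /extend_nodes; case: insub => [i|]; [exact: m1|rewrite -[oapp _ _ _]/(0 : CC R) cabs0].
have /choice [b Hb] := fun j => interpolation_span mu' n (lam j) m1' (l1 j).
(* The competitor: interpolate each 1/(z - lam j) separately and combine with the true residues.
   Minimality of As leaves only the error of this choice to be bounded. *)
pose B k := \sum_j b j k *: A j.
apply: (le_trans (best (fun k : 'I_n => B k))).
pose F z := partial_fractions lam A z - partial_fractions mu (fun k : 'I_n => B k) z.
have tF i j : tame (fun z => F z i j).
  rewrite (_ : (fun z => _) = fun z => partial_fractions lam A z i j +
    partial_fractions mu (fun k : 'I_n => B k) z i j * (-1)); last first.
    by apply/funext => z; rewrite !mxE mulrN1.
  by apply: tameD; last apply: tameZ; exact: partial_fractions_tame.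
pose e j w := interpolation_error mu' n (lam j) (expi w).
have FE w : F (expi w) = \sum_j e j w *: A j.
  rewrite /F /partial_fractions.
  have -> : \sum_(k < n) ((expi w - mu k) ^+ pole_order mu k)^-1 *: B k =
     \sum_j (\sum_(k < n) ((expi w - mu k) ^+ pole_order mu k)^-1 * b j k) *: A j.
    under eq_bigr do rewrite /B scaler_sumr.
    rewrite exchange_big; apply: eq_bigr => j _; rewrite scaler_suml.
    by apply: eq_bigr => k _; rewrite scalerA.
  rewrite -sumrB; apply: eq_bigr => j _; rewrite -scalerBl; congr (_ *: _).
  rewrite pole_order_inj// expr1.
  under eq_bigr do rewrite -node_orderE -extend_nodesE.
  by rewrite -Hb ?cabs_expi// opprB addrC subrK.
have ce j w : cabs (e j w) ^+ 2 <= M ^+ 2 * cabs ((expi w - lam j)^-1) ^+ 2.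
  rewrite -exprMn ler_pXn2r ?nnegrE ?cabs_ge0//; last first.
    rewrite mulr_ge0 ?cabs_ge0//; apply: le_trans (lM j).
    by apply: prodr_ge0 => k _; exact: cabs_ge0.
  rewrite /e /interpolation_error !cabsM cabs_blaschke ?cabs_expi// mulr1.
  rewrite ler_wpM2r ?cabs_ge0//; apply: le_trans (lM j).
  rewrite /blaschke_at_pole /hyp_prod (big_morph (@cabs R) cabsM cabs1).
  rewrite le_eqVlt; apply/orP; left; apply/eqP; apply: eq_bigr => k _.
  by rewrite /mu' extend_nodesE.
have [c [_ Fc]] := tame_has_trig_integral _ _ F tF.
rewrite (h2norm_sqE _ _ _ _ Fc).
have /choice [d Hd] : forall j, exists d, has_integral lebesgue_measure `[- pi, pi]%classic
    (fun w => cabs ((expi w - lam j)^-1) ^+ 2) d.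
  move=> j; apply: continuous_has_trig_integral.
  by have [_ [_ _ _ cF]] := tame_frac _ (l1 j); exact: (continuous_cabs_sqr _ cF).
have p0 : 0 < 2 * pi :> R by rewrite mulr_gt0// (pi_gt0 R).
have rr : 0 < 1 - rho ^+ 2 by rewrite subr_gt0 expr_lt1.
have dle j : d j <= 2 * pi / (1 - rho ^+ 2).
  have h := poisson_le _ _ (l1 j) (Hd j).
  have d0 : 0 <= d j.
    apply: (le_has_integral lebesgue_measure _ (measurable_itv _) _ _ _ _ _
      (has_integral0 lebesgue_measure _) (Hd j)) => w _; exact: sqr_ge0.
  rewrite ler_pdivlMr// mulrC; apply: le_trans h; rewrite ler_wpM2r// lerD2l lerN2.
  by rewrite ler_pXn2r ?nnegrE ?cabs_ge0.
set r := \sum_j frobC (A j).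
have r0 : 0 <= r by apply: sumr_ge0 => j _; exact: sqrtr_ge0.
have cle : \sum_i \sum_j c i j <= r * \sum_j frobC (A j) * (M ^+ 2 * d j).
  apply: (le_has_integral lebesgue_measure _ (measurable_itv _) _ _ _ _ _ Fc
    (has_integralZ lebesgue_measure _ (measurable_itv _) _ _ r
      (has_integral_sum lebesgue_measure _ (measurable_itv _) _ _ _ _ (fun j =>
        has_integralZ lebesgue_measure _ (measurable_itv _) _ _ (frobC (A j))
         (has_integralZ lebesgue_measure _ (measurable_itv _) _ _ (M ^+ 2) (Hd j)))))) => w _.
  rewrite FE; apply: (le_trans (weighted_cauchy_schwarz _ _)); rewrite ler_wpM2l//.
  by apply: ler_sum => j _; rewrite ler_wpM2l ?sqrtr_ge0.
rewrite ler_pdivrMl//; apply: (le_trans cle).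
apply: (@le_trans _ _ (r * \sum_j frobC (A j) * (M ^+ 2 * (2 * pi / (1 - rho ^+ 2))))).
  rewrite ler_wpM2l//; apply: ler_sum => j _; rewrite ler_wpM2l ?sqrtr_ge0//.
  by rewrite ler_wpM2l ?sqr_ge0.
rewrite -mulr_suml -/r le_eqVlt; apply/orP; left; apply/eqP.
by move: (2 * pi : R) => q; field; rewrite gt_eqF.
Qed.

End surrogate_error.

(** * Hyperbolic Chebyshev constants *)

Section maximum_modulus.
Context {R : realType}.
Implicit Types (P N Q : {poly CC R}) (z w : CC R).

Lemma horner_lipschitz P z0 : exists2 C : R, 0 <= C &
  forall z, cabs (z - z0) <= 1 -> cabs (P.[z] - P.[z0]) <= C * cabs (z - z0).
Proof.
elim/poly_ind: P => [|P c [C C0 HC]].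
  by exists 0 => // z _; rewrite !horner0 subrr cabs0 mul0r.
exists (C * (cabs z0 + 1) + cabs P.[z0]) => [|z z1].
  by rewrite addr_ge0 ?cabs_ge0// mulr_ge0// addr_ge0 ?cabs_ge0.
rewrite !hornerMXaddC.
have -> : P.[z] * z + c - (P.[z0] * z0 + c) = (P.[z] - P.[z0]) * z + P.[z0] * (z - z0) by ring.
apply: (le_trans (cabsD _ _)); rewrite !cabsM mulrDl lerD2r mulrAC.
apply: ler_pM; rewrite ?cabs_ge0 ?HC//.
have := cabsD (z - z0) z0; rewrite subrK; lra.
Qed.

(* Moving from z0 in the direction that aligns the first nonconstant term with w
   increases the modulus. *)
Lemma maximum_modulus_local N Q z0 w (r : R) : 0 < r -> w != 0 ->
  Q.[z0] != 0 -> N.[z0] = w * Q.[z0] ->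
  (forall z, cabs (z - z0) < r -> cabs N.[z] <= cabs w * cabs Q.[z]) -> N = w *: Q.
Proof.
move=> r0 w0 Q0 NQ H; apply/eqP; rewrite -subr_eq0; apply/negPn/negP => g0.
have [k [s]] := multiplicity_XsubC (N - w *: Q) z0; rewrite g0/= => s0 gE.
have k0 : (0 < k)%N.
  rewrite lt0n; apply/eqP => kE; move: s0 gE; rewrite kE expr0 mulr1 => s0 /(congr1 (horner^~ z0)).
  rewrite /= hornerD hornerN hornerZ NQ subrr => /esym/eqP h.
  by move: s0; rewrite /root h.
have s0' : s.[z0] != 0 by [].
(* With k the order of vanishing of N - w Q at z0, this direction makes N - w Q equal to t^k w Q(z0)
   to leading order at z0 + t x. *)
pose x : CC R := k.-root (w * Q.[z0] / s.[z0]).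
have xk : x ^+ k * s.[z0] = w * Q.[z0] by rewrite rootCK// divfK.
have [C1 C10 H1] := horner_lipschitz s z0.
have [C2 C20 H2] := horner_lipschitz Q z0.
set a := cabs (w * Q.[z0]); have a0 : 0 < a.
  by rewrite lt_neqAle cabs_ge0 andbT eq_sym cabs_eq0 mulf_neq0.
(* t E bounds the error of replacing the cofactor s and Q by their values at z0. *)
set E := (cabs x ^+ k * C1 + cabs w * C2) * cabs x.
have E0 : 0 <= E by rewrite mulr_ge0 ?cabs_ge0// addr_ge0 ?mulr_ge0 ?exprn_ge0 ?cabs_ge0.
set m := Num.min 1 (Num.min r a).
have m0 : 0 < m by rewrite !lt_min ltr01 r0 a0.
have [m1 [mr ma]] : m <= 1 /\ m <= r /\ m <= a.
  by rewrite /m; split; [|split]; rewrite !ge_min lexx ?orbT.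
(* With t B = m/2, the point stays within distance 1 and r of z0, and t E < a/2 leaves the gain t^k
   |w Q(z)| larger than the error. *)
set B := cabs x + E + 1; have B0 : 0 < B by rewrite /B; have := cabs_ge0 x; lra.
pose t := m / (2 * B); have t0 : 0 < t by rewrite divr_gt0// mulr_gt0.
have tB : t * B = m / 2 by rewrite /t; field; rewrite gt_eqF.
pose z := z0 + toC t * x.
have zz : cabs (z - z0) = t * cabs x.
  by rewrite /z addrC addKr cabsM cabs_toC gtr0_norm.
have tx : t * cabs x <= m / 2.
  by rewrite -tB ler_wpM2l ?(ltW t0)// /B; lra.
have tE : t * E < m / 2.
  by rewrite -tB ltr_pM2l// /B; have := cabs_ge0 x; lra.
have z1 : cabs (z - z0) <= 1 by rewrite zz; lra.
have zr : cabs (z - z0) < r by rewrite zz; lra.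
have := H z zr; apply/negP; rewrite -ltNge.
pose dl := x ^+ k * (s.[z] - s.[z0]) - w * (Q.[z] - Q.[z0]).
have Nz : N.[z] = (1 + toC (t ^+ k)) * (w * Q.[z]) + toC (t ^+ k) * dl.
  have -> : N.[z] = w * Q.[z] + s.[z] * (toC t * x) ^+ k.
    rewrite -[N in LHS](subrK (w *: Q)) gE hornerD hornerZ hornerM horner_exp hornerXsubC.
    by rewrite addrC; congr (_ + _ * _ ^+ _); rewrite /z addrC addKr.
  rewrite exprMn -toCX /dl; set T := toC _; set X := x ^+ k in xk *.
  have -> : w * (Q.[z] - Q.[z0]) = w * Q.[z] - X * s.[z0] by rewrite mulrBr xk.
  ring.
have hs := H1 z z1; have hQ := H2 z z1; rewrite zz in hs hQ.
have dle : cabs dl <= t * E.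
  apply: (le_trans (cabsD _ _)); rewrite cabsN !cabsM cabsX /E.
  have -> : t * ((cabs x ^+ k * C1 + cabs w * C2) * cabs x) =
    cabs x ^+ k * (C1 * (t * cabs x)) + cabs w * (C2 * (t * cabs x)) by ring.
  by apply: lerD; rewrite ler_wpM2l ?exprn_ge0 ?cabs_ge0.
have wQ : a - t * E <= cabs (w * Q.[z]).
  rewrite lerBlDr; have -> : w * Q.[z] = w * Q.[z0] + w * (Q.[z] - Q.[z0]) by ring.
  have e1 : cabs (w * (Q.[z] - Q.[z0])) <= t * E.
    rewrite cabsM; apply: (@le_trans _ _ (cabs w * (C2 * (t * cabs x)))).
      by rewrite ler_wpM2l ?cabs_ge0.
    rewrite /E mulrDl mulrDr; have : 0 <= t * (cabs x ^+ k * C1 * cabs x).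
      apply: mulr_ge0; first exact: ltW.
      by rewrite !mulr_ge0 ?exprn_ge0 ?cabs_ge0.
    lra.
  have := cabsD (w * Q.[z0] + w * (Q.[z] - Q.[z0])) (- (w * (Q.[z] - Q.[z0]))).
  by rewrite addrK cabsN -/a; lra.
have tk0 : 0 < t ^+ k by rewrite exprn_gt0.
have h3 : (1 + t ^+ k) * cabs (w * Q.[z]) - t ^+ k * cabs dl <= cabs N.[z].
  rewrite lerBlDr.
  have -> : (1 + t ^+ k) * cabs (w * Q.[z]) = cabs ((1 + toC (t ^+ k)) * (w * Q.[z])).
    rewrite [in RHS]cabsM; congr (_ * _).
    have -> : (1 + toC (t ^+ k) : CC R) = toC (1 + t ^+ k).
      by apply/eqP; rewrite eq_complex /= addr0 !eqxx.
    by rewrite cabs_toC gtr0_norm// addr_gt0.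
  have -> : t ^+ k * cabs dl = cabs (- (toC (t ^+ k) * dl)).
    by rewrite cabsN cabsM cabs_toC gtr0_norm.
  by apply: le_trans (cabsD _ _); rewrite Nz addrK.
rewrite -cabsM; apply: lt_le_trans h3.
rewrite mulrDl mul1r -addrA ltrDl -mulrBr mulr_gt0// subr_gt0.
by lra.
Qed.

Lemma nbhs_cabs (z : CC R) (U : set (CC R)) : nbhs z U ->
  exists2 r : R, 0 < r & forall y, cabs (y - z) < r -> U y.
Proof.
move=> /nbhs_ballP[e /= e0 eU]; exists (complex.Re e).
  by move: e0; rewrite ltcE /= => /andP[].
move=> y yz; apply: eU; suff : `|z - y| < e by [].
move: e0; rewrite ltcE /= => /andP[/eqP i0 _].
rewrite -opprB normrN ltcE /Num.norm /= i0 eqxx/=; exact: yz.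
Qed.

Lemma cabs_nbhs (z : CC R) (r : R) : 0 < r -> nbhs z [set y | cabs (y - z) < r].
Proof.
move=> r0; apply/nbhs_ballP; exists r%:C%C; first by rewrite /= ltcR.
move=> y yr; have {yr} : `|z - y| < r%:C%C by [].
by rewrite -opprB normrN /Num.norm /= ltcR.
Qed.

Lemma continuous_cabs_horner P z0 : {for z0, continuous (fun z : CC R => cabs P.[z])}.
Proof.
have [C C0 HC] := horner_lipschitz P z0.
apply/(@cvgrPdist_lt _ _ _ (nbhs z0) (nbhs_filter z0)) => e e0.
pose r := Num.min 1 (e / (C + 1)).
have C1 : 0 < C + 1 by lra.
have r0 : 0 < r by rewrite lt_min ltr01 divr_gt0.
have : nbhs z0 [set y | cabs (y - z0) < r] by exact: cabs_nbhs.
apply: filterS => z /= zr.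
have z1 : cabs (z - z0) <= 1 by rewrite ltW// (lt_le_trans zr)// ge_min lexx.
apply: (@le_lt_trans _ _ (cabs (P.[z] - P.[z0]))).
  rewrite ler_norml; apply/andP; split.
    have := cabsD (P.[z] - P.[z0]) P.[z0]; rewrite subrK; lra.
  by have := cabsD (P.[z0] - P.[z]) P.[z]; rewrite subrK -opprB cabsN; lra.
apply: (le_lt_trans (HC _ z1)); apply: (@lt_le_trans _ _ ((C + 1) * r)).
  by have := cabs_ge0 (z - z0); nra.
by rewrite mulrC -ler_pdivlMr// ge_min lexx orbT.
Qed.

End maximum_modulus.

Section hyperbolic_product.
Context {R : realType}.

Lemma hyp_dist_le1 (z mu : CC R) : cabs z < 1 -> cabs mu < 1 -> hyp_dist z mu <= 1.
Proof.
move=> z1 m1; have d0 := conj_one_sub_neq0 _ _ m1 (ltW z1).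
rewrite /hyp_dist cabsM cabsV ler_pdivrMr; last first.
  by rewrite lt_neqAle cabs_ge0 andbT eq_sym cabs_eq0.
rewrite mul1r -(@ler_pXn2r _ 2)// ?nnegrE ?cabs_ge0//.
have sq (x : CC R) : cabs x < 1 -> complex.Re x ^+ 2 + complex.Im x ^+ 2 <= 1.
  by move=> x1; rewrite -cabs_sqr expr_le1 ?cabs_ge0 ?ltW.
have := sq z z1; have := sq mu m1; rewrite !cabs_sqr.
case: (z) (mu) => [x y] [a b] /= ab xy; rewrite -subr_ge0.
rewrite (_ : _ - _ = (1 - (a ^+ 2 + b ^+ 2)) * (1 - (x ^+ 2 + y ^+ 2))); last by ring.
by rewrite mulr_ge0 ?subr_ge0.
Qed.

Variable (q : nat).
Implicit Types nu : 'I_q -> CC R.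

Lemma hyp_prod_ge0 nu z : 0 <= hyp_prod nu z.
Proof. by apply: prodr_ge0 => k _; exact: cabs_ge0. Qed.

Lemma hyp_prod_le1 nu z : cabs z < 1 -> (forall k, cabs (nu k) < 1) -> hyp_prod nu z <= 1.
Proof.
move=> z1 n1; suff /andP[] : 0 <= hyp_prod nu z <= 1 by [].
apply: (big_ind (fun x => 0 <= x <= 1)); first by rewrite ler01 lexx.
  by move=> x y /andP[x0 x1] /andP[y0 y1]; rewrite mulr_ge0// mulr_ile1.
by move=> k _; rewrite cabs_ge0 hyp_dist_le1.
Qed.

(** Numerator and denominator as polynomials, as [maximum_modulus_local] requires. *)
Definition hyp_num nu : {poly CC R} := \prod_k ('X - (nu k)%:P).

Definition hyp_den nu : {poly CC R} := \prod_k (1 - (conjc (nu k))%:P * 'X).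

Lemma hyp_denE nu z : (hyp_den nu).[z] = \prod_k (1 - conjc (nu k) * z).
Proof.
rewrite horner_prod; apply: eq_bigr => k _.
by rewrite hornerD hornerN hornerM hornerX !hornerC.
Qed.

Lemma hyp_den_neq0 nu z : cabs z <= 1 -> (forall k, cabs (nu k) < 1) -> (hyp_den nu).[z] != 0.
Proof.
move=> z1 n1; rewrite hyp_denE; apply/prodf_neq0 => k _.
exact: conj_one_sub_neq0.
Qed.

Lemma hyp_prodE nu z : hyp_prod nu z = cabs (hyp_num nu).[z] / cabs (hyp_den nu).[z].
Proof.
rewrite -cabsV -cabsM hyp_denE horner_prod -prodf_div (big_morph (@cabs R) cabsM cabs1).
by apply: eq_bigr => k _; rewrite hornerXsubC.
Qed.

Lemma continuous_hyp_prod nu z0 : cabs z0 < 1 -> (forall k, cabs (nu k) < 1) ->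
  {for z0, continuous (hyp_prod nu)}.
Proof.
move=> z1 n1; rewrite (_ : hyp_prod nu = fun z : CC R =>
  cabs (hyp_num nu).[z] / cabs (hyp_den nu).[z]); last by apply/funext => z; exact: hyp_prodE.
apply: (@cvgM _ _ (nbhs z0) (nbhs_filter z0)); first exact: continuous_cabs_horner.
apply: (@cvgV _ _ (nbhs z0) (nbhs_filter z0)); last exact: continuous_cabs_horner.
by rewrite cabs_eq0 hyp_den_neq0 ?ltW.
Qed.

Variable D : set (CC R).
Hypotheses (D_compact : compact D) (D_disc : forall z, D z -> cabs z < 1)
  (D0 : D !=set0).

(** A point where |z + 2| is maximal on D cannot be interior: in the unit disc z + 2 has positive
    real part, so a small step to the right increases the modulus. *)
Lemma bdry_nonempty : bdry D !=set0.
Proof.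
have cf : {within D, continuous (fun z : CC R => cabs ('X + 2%:P : {poly CC R}).[z])}.
  apply: continuous_in_subspaceT => z _; exact: continuous_cabs_horner.
have [c] := compact_EVT_max D0 D_compact cf; rewrite inE => cD cmax.
exists c; split; first exact: subset_closure.
move=> /nbhs_cabs[r r0 rD].
pose y := c + toC (r / 2).
have yD : D y.
  by apply: rD; rewrite /y addrC addKr cabs_toC gtr0_norm ?divr_gt0//; lra.
have := cmax y; rewrite inE => /(_ yD); apply/negP; rewrite -ltNge.
rewrite !hornerD !hornerX !hornerC -(@ltr_pXn2r _ 2)// ?nnegrE ?cabs_ge0// !cabs_sqr.
have c1 := D_disc _ cD; have := Re_le_cabs c; rewrite ler_norml => /andP[cr _].
rewrite /y; case: (c) c1 cr => [a b] /= c1 cr; rewrite !addr0.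
have rr : 0 < r * (a + 2) by rewrite mulr_gt0//; lra.
have := sqr_ge0 r.
nra.
Qed.

Lemma bdry_subset : bdry D `<=` D.
Proof.
have Dc : closed D by apply: compact_closed D_compact; exact: norm_hausdorff.
by move=> z [] /=; rewrite -(proj1 (closure_id D) Dc).
Qed.

(** A nonzero maximum at an interior point makes numerator and denominator proportional as
    polynomials, so the product is constant on all of D and any boundary point attains it. *)
Lemma hyp_prod_max_on_bdry nu : (forall k, cabs (nu k) < 1) ->
  exists2 zb, bdry D zb & forall z, D z -> hyp_prod nu z <= hyp_prod nu zb.
Proof.
move=> n1.
have cf : {within D, continuous (hyp_prod nu)}.
  apply: continuous_in_subspaceT => z; rewrite inE => zD.
  by apply: continuous_hyp_prod => //; exact: D_disc.
have [c] := compact_EVT_max D0 D_compact cf; rewrite inE => cD cmax.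
have {}cmax z : D z -> hyp_prod nu z <= hyp_prod nu c by move=> zD; apply: cmax; rewrite inE.
have [zb zbb] := bdry_nonempty.
have [c0|c0] := eqVneq (hyp_prod nu c) 0.
  exists zb => // z zD; apply: (le_trans (cmax z zD)).
  by rewrite c0 hyp_prod_ge0.
have [cI|cI] := pselect (interior D c); last first.
  by exists c; [split; [exact: subset_closure|exact: cI]|exact: cmax].
have [r r0 rD] := nbhs_cabs _ _ cI.
have Qc z : D z -> (hyp_den nu).[z] != 0.
  by move=> zD; apply: hyp_den_neq0 => //; exact/ltW/D_disc.
have cQ z : D z -> 0 < cabs (hyp_den nu).[z].
  by move=> zD; rewrite lt_neqAle cabs_ge0 andbT eq_sym cabs_eq0 Qc.
pose w : CC R := (hyp_num nu).[c] / (hyp_den nu).[c].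
have wE : cabs w = hyp_prod nu c by rewrite hyp_prodE /w cabsM cabsV.
have NE : hyp_num nu = w *: hyp_den nu.
  apply: (maximum_modulus_local _ _ c w r) => //.
  - by rewrite -cabs_eq0 wE.
  - exact: Qc.
  - by rewrite /w divfK// Qc.
  - move=> z /rD zD; rewrite wE -ler_pdivrMr ?cQ// -hyp_prodE; exact: cmax.
have hE z : D z -> hyp_prod nu z = cabs w.
  by move=> zD; rewrite hyp_prodE NE hornerZ cabsM mulfK// gt_eqF// cQ.
by exists zb => // z zD; rewrite !hE//; exact: bdry_subset.
Qed.

End hyperbolic_product.

(** * Minimal suprema, their roots and the limit of the roots *)

Section chebyshev_constants.
Context {R : realType} (D : set (CC R)).
Hypotheses (D_compact : compact D) (D_disc : forall z, D z -> cabs z < 1)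
  (D0 : D !=set0).

Lemma compact_disc_radius : exists2 rho : R, 0 <= rho < 1 & forall z, D z -> cabs z <= rho.
Proof.
have cf : {within D, continuous (fun z : CC R => cabs ('X : {poly CC R}).[z])}.
  apply: continuous_in_subspaceT => z _; exact: continuous_cabs_horner.
have [c] := compact_EVT_max D0 D_compact cf; rewrite inE => cD cmax.
exists (cabs c); first by rewrite cabs_ge0 D_disc.
by move=> z zD; have := cmax z; rewrite inE !hornerX; apply.
Qed.

Section fixed_degree.
Variable q : nat.
Implicit Types nu mu : 'I_q -> CC R.

Definition hyp_sup nu : R := sup [set hyp_prod nu z | z in D].

Lemma hyp_prod_has_ubound nu : (forall k, D (nu k)) ->
  has_ubound [set hyp_prod nu z | z in D].
Proof.
move=> nD; exists 1 => _ [z zD <-].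
by apply: hyp_prod_le1 => [|k]; exact: D_disc.
Qed.

Lemma hyp_prod_le_sup nu z : (forall k, D (nu k)) -> D z -> hyp_prod nu z <= hyp_sup nu.
Proof.
move=> nD zD; apply: ub_le_sup; first exact: hyp_prod_has_ubound.
by exists z.
Qed.

Lemma hyp_sup_ge0 nu : (forall k, D (nu k)) -> 0 <= hyp_sup nu.
Proof.
by move=> nD; have [z zD] := D0; apply: le_trans (hyp_prod_le_sup _ _ nD zD); exact: hyp_prod_ge0.
Qed.

Lemma hyp_sup_le nu x : (forall z, D z -> hyp_prod nu z <= x) -> hyp_sup nu <= x.
Proof.
move=> H; apply: ge_sup; first by have [z zD] := D0; exists (hyp_prod nu z), z.
by move=> _ [z zD <-]; exact: H.
Qed.

(** The minimax property compares suprema over the boundary; the left one controls the value at l by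
    [hyp_prod_max_on_bdry], the right one is at most the supremum over D. *)
Lemma minimizer_le_sup mu nu l : cheb_minimizer D mu -> (forall k, D (nu k)) -> D l ->
  hyp_prod mu l <= hyp_sup nu.
Proof.
move=> [muD mumin] nD lD.
have [zb zbb zbm] := hyp_prod_max_on_bdry q D D_compact D_disc D0 mu (fun k => D_disc _ (muD k)).
have ubb (x : 'I_q -> CC R) : (forall k, D (x k)) -> has_ubound [set hyp_prod x z | z in bdry D].
  move=> xD; have [M HM] := hyp_prod_has_ubound x xD; exists M => _ [z /(bdry_subset D D_compact) zD <-].
  by apply: HM; exists z.
apply: (le_trans (zbm _ lD)); apply: (@le_trans _ _ (sup [set hyp_prod mu z | z in bdry D])).
  by apply: ub_le_sup; [exact: ubb|exists zb].
apply: (le_trans (mumin nu nD)); apply: ge_sup; first by exists (hyp_prod nu zb), zb.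
by move=> _ [z /(bdry_subset D D_compact) zD <-]; exact: hyp_prod_le_sup.
Qed.

(** The q-th power of the Chebyshev constant ([cheb_pow]), the form in which it is
    submultiplicative. *)
Definition cheb_inf : R := inf [set hyp_sup nu | nu in [set nu : 'I_q -> CC R | forall k, D (nu k)]].

Lemma nodes_nonempty : exists nu : 'I_q -> CC R, forall k, D (nu k).
Proof. by have [z zD] := D0; exists (fun=> z). Qed.

Lemma cheb_inf_le nu : (forall k, D (nu k)) -> cheb_inf <= hyp_sup nu.
Proof.
move=> nD; apply: ge_inf; last by exists nu.
by exists 0 => _ [x xD <-]; exact: hyp_sup_ge0.
Qed.

Lemma le_cheb_inf x : (forall nu, (forall k, D (nu k)) -> x <= hyp_sup nu) -> x <= cheb_inf.
Proof.
move=> H; apply: lb_le_inf; first by have [nu nD] := nodes_nonempty; exists (hyp_sup nu), nu.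
by move=> _ [nu nD <-]; exact: H.
Qed.

Lemma cheb_inf_ge0 : 0 <= cheb_inf.
Proof. by apply: le_cheb_inf => nu; exact: hyp_sup_ge0. Qed.

Lemma cheb_inf_le1 : cheb_inf <= 1.
Proof.
have [nu nD] := nodes_nonempty; apply: (le_trans (cheb_inf_le _ nD)).
by apply: hyp_sup_le => z zD; apply: hyp_prod_le1 => [|k]; exact: D_disc.
Qed.

Lemma minimizer_le_cheb_inf mu l : cheb_minimizer D mu -> D l -> hyp_prod mu l <= cheb_inf.
Proof. by move=> muP lD; apply: le_cheb_inf => nu nD; exact: minimizer_le_sup. Qed.

Hypothesis q0 : (0 < q)%N.

Lemma root_powR (x : R) : 0 <= x -> (x `^ q%:R^-1) ^+ q = x.
Proof.
move=> x0; rewrite -powR_mulrn ?powR_ge0// -powRrM mulVf ?powRr1//.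
by rewrite pnatr_eq0 -lt0n.
Qed.

Lemma le_root_powR (x y : R) : 0 <= x -> 0 <= y -> x <= y -> x `^ q%:R^-1 <= y `^ q%:R^-1.
Proof. by move=> x0 y0; apply: ge0_ler_powR; rewrite ?nnegrE ?invr_ge0. Qed.

Lemma le_root_pow (x y : R) : 0 <= x -> 0 <= y -> x `^ q%:R^-1 <= y -> x <= y ^+ q.
Proof. by move=> x0 y0 xy; rewrite -[leLHS]root_powR// ler_pXn2r ?nnegrE ?powR_ge0. Qed.

Lemma sup_root nu : (forall k, D (nu k)) ->
  sup [set hyp_prod nu z `^ q%:R^-1 | z in D] = hyp_sup nu `^ q%:R^-1.
Proof.
move=> nD; set A := [set _ | _ in _].
have ubA : ubound A (hyp_sup nu `^ q%:R^-1).
  move=> _ [z zD <-]; apply: le_root_powR; rewrite ?hyp_prod_ge0 ?hyp_sup_ge0//.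
  exact: hyp_prod_le_sup.
have [z0 zD0] := D0.
have A0 : A !=set0 by exists (hyp_prod nu z0 `^ q%:R^-1), z0.
have leA z : D z -> hyp_prod nu z `^ q%:R^-1 <= sup A.
  by move=> zD; apply: ub_le_sup; [exists (hyp_sup nu `^ q%:R^-1)|exists z].
have sA0 : 0 <= sup A by apply: le_trans (leA _ zD0); exact: powR_ge0.
apply/eqP; rewrite eq_le; apply/andP; split; first exact: ge_sup.
rewrite -(@ler_pXn2r _ q) ?nnegrE ?powR_ge0// root_powR ?hyp_sup_ge0//.
by apply: hyp_sup_le => z zD; apply: le_root_pow; rewrite ?hyp_prod_ge0 ?leA.
Qed.

Lemma cheb_ge0 : 0 <= cheb q D.
Proof.
rewrite /cheb; apply: lb_le_inf.
  have [nu nD] := nodes_nonempty.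
  by exists (sup [set hyp_prod nu z `^ q%:R^-1 | z in D]), nu.
by move=> _ [nu nD <-]; rewrite sup_root// powR_ge0.
Qed.

Lemma cheb_pow : cheb q D ^+ q = cheb_inf.
Proof.
have ch nu : (forall k, D (nu k)) -> cheb q D <= hyp_sup nu `^ q%:R^-1.
  move=> nD; rewrite -sup_root//; apply: ge_inf; last by exists nu.
  by exists 0 => _ [x xD <-]; rewrite sup_root// powR_ge0.
apply/eqP; rewrite eq_le; apply/andP; split.
  apply: le_cheb_inf => nu nD; rewrite -[leRHS]root_powR ?hyp_sup_ge0//.
  by rewrite ler_pXn2r ?nnegrE ?powR_ge0 ?cheb_ge0 ?ch.
apply: le_root_pow; [exact: cheb_inf_ge0|exact: cheb_ge0|].
apply: lb_le_inf.
  have [nu nD] := nodes_nonempty.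
  by exists (sup [set hyp_prod nu z `^ q%:R^-1 | z in D]), nu.
move=> _ [nu nD <-]; rewrite sup_root//; apply: le_root_powR.
- exact: cheb_inf_ge0.
- exact: hyp_sup_ge0.
- exact: cheb_inf_le.
Qed.

Lemma cheb_le1 : cheb q D <= 1.
Proof.
by rewrite -(@ler_pXn2r _ q) ?nnegrE ?cheb_ge0// expr1n cheb_pow cheb_inf_le1.
Qed.

End fixed_degree.

(** Joining two families of nodes multiplies the products. The two infima are then taken one after
    the other, a vanishing factor being treated apart. *)
Lemma cheb_infD q r : cheb_inf (q + r) <= cheb_inf q * cheb_inf r.
Proof.
have H (nu : 'I_q -> CC R) (nu' : 'I_r -> CC R) : (forall k, D (nu k)) -> (forall k, D (nu' k)) ->
    cheb_inf (q + r) <= hyp_sup q nu * hyp_sup r nu'.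
  move=> nD nD'; pose x (k : 'I_(q + r)) := match fintype.split k with inl i => nu i | inr j => nu' j end.
  have xD k : D (x k) by rewrite /x; case: fintype.split.
  apply: (le_trans (cheb_inf_le _ _ xD)); apply: hyp_sup_le => z zD.
  rewrite /hyp_prod big_split_ord/=.
  rewrite (eq_bigr (fun k => hyp_dist z (nu k))); last first.
    by move=> k _; rewrite /x -[lshift _ _]/(unsplit (inl k)) unsplitK.
  rewrite [X in _ * X](eq_bigr (fun k => hyp_dist z (nu' k))); last first.
    by move=> k _; rewrite /x -[rshift _ _]/(unsplit (inr k)) unsplitK.
  by apply: ler_pM; rewrite ?hyp_prod_ge0// hyp_prod_le_sup.
have H2 (nu : 'I_q -> CC R) : (forall k, D (nu k)) -> cheb_inf (q + r) <= hyp_sup q nu * cheb_inf r.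
  move=> nD; have s0 := hyp_sup_ge0 q nu nD.
  have [s00|sn0] := eqVneq (hyp_sup q nu) 0.
    have [nu' nD'] := nodes_nonempty r.
    by have := H nu nu' nD nD'; rewrite s00 !mul0r.
  have sp : 0 < hyp_sup q nu by rewrite lt_neqAle eq_sym sn0.
  rewrite -ler_pdivrMl//; apply: le_cheb_inf => nu' nD'.
  by rewrite ler_pdivrMl// H.
have [c0|cn0] := eqVneq (cheb_inf r) 0.
  by have [nu nD] := nodes_nonempty q; have := H2 nu nD; rewrite c0 !mulr0.
have cp : 0 < cheb_inf r by rewrite lt_neqAle eq_sym cn0 cheb_inf_ge0.
by rewrite -ler_pdivrMr//; apply: le_cheb_inf => nu nD; rewrite ler_pdivrMr// H2.
Qed.

Lemma cheb_infMD q a r : cheb_inf (a * q + r) <= cheb_inf q ^+ a.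
Proof.
elim: a => [|a IH]; first by rewrite mul0n add0n expr0 cheb_inf_le1.
rewrite mulSn -addnA exprS; apply: (le_trans (cheb_infD _ _)).
by rewrite ler_wpM2l ?cheb_inf_ge0.
Qed.

(* Fekete's lemma for the submultiplicative sequence of the minimal suprema. *)
Lemma cheb_cvg : cvgn (fun n => cheb n D).
Proof.
pose L := inf [set cheb n.+1 D | n in [set: nat]].
have Ll n : L <= cheb n.+1 D.
  by apply: ge_inf; [exists 0 => _ [k _ <-]; exact: cheb_ge0|exists n].
have L0 : 0 <= L.
  by apply: lb_le_inf; [exists (cheb 1 D), 0%N|move=> _ [k _ <-]; exact: cheb_ge0].
suff H : forall e, 0 < e -> exists n0, forall n, (n0 <= n)%N -> cheb n.+1 D < L + e.
  apply/cvg_ex; exists L; rewrite -(cvg_shiftS (fun n => cheb n D)).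
  apply/cvgrPdist_lt => e e0; have [n0 Hn] := H e e0.
  exists n0 => // n /= /Hn lt; have := Ll n; rewrite distrC => Ln.
  by rewrite ger0_norm ?subr_ge0// ltrBlDl.
move=> e e0.
have [q yL] : exists q, cheb q.+1 D < L + e.
  apply: contrapT => /forallNP h.
  have : L + e <= L.
    apply: lb_le_inf; first by exists (cheb 1 D), 0%N.
    by move=> _ [k _ <-]; rewrite leNgt; apply/negP; exact: h.
  by rewrite gerDl leNgt e0.
set Q := q.+1 in yL; set y := cheb Q D in yL.
have y0 : 0 <= y by exact: cheb_ge0.
have yQ : y ^+ Q = cheb_inf Q by exact: cheb_pow.
have [y00|yn0] := eqVneq y 0.
  exists Q => n nQ; suff -> : cheb n.+1 D = 0 by rewrite ltr_wpDl.
  have : cheb_inf n.+1 <= cheb_inf Q * cheb_inf (n.+1 - Q).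
    by rewrite -{1}(subnKC (leqW nQ)) cheb_infD.
  rewrite -yQ y00 expr0n mul0r -cheb_pow// => h.
  apply/eqP; have : cheb n.+1 D ^+ n.+1 == 0.
    by rewrite eq_le h exprn_ge0 ?cheb_ge0.
  by rewrite expf_eq0.
have yp : 0 < y by rewrite lt_neqAle eq_sym yn0.
have y1 : y <= 1 by exact: cheb_le1.
set Y := L + e in yL *; have Yp : 0 < Y by exact: lt_trans yL.
have x1 : 0 <= y / Y < 1 by rewrite divr_ge0 ?ltW//= ltr_pdivrMr// mul1r.
(* Division by Q gives tau_N^N <= y^(Q floor(N/Q)), and y <= 1 bounds y^Q times this by y^N. So
   tau_N >= Y would force (y/Y)^N >= y^Q, which fails for large N. *)
have [n0 Hn] := geometric_lt (y / Y) 1 _ x1 (exprn_gt0 Q yp).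
exists n0 => n /leqW /Hn; rewrite mul1r; apply: contraTlt; rewrite -leNgt => Yc.
rewrite expr_div_n ler_pdivlMr ?exprn_gt0// mulrC.
set N := n.+1 in Yc *.
have cN : cheb N D ^+ N <= y ^+ (Q * (N %/ Q)).
  rewrite cheb_pow// {1}(divn_eq N Q) exprM yQ; exact: cheb_infMD.
apply: (@le_trans _ _ (y ^+ (Q * (N %/ Q)) * y ^+ Q)).
  rewrite ler_wpM2r ?exprn_ge0//; apply: le_trans cN.
  by rewrite ler_pXn2r ?nnegrE ?cheb_ge0// ltW.
rewrite -exprD; apply: ler_wiXn2l => //.
rewrite -mulnSr mulnC; exact/ltnW/ltn_ceil.
Qed.

End chebyshev_constants.

(** * Divergence bounds *)

Section quadratic_form_bound.
Context {R : realType}.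

Lemma qform_le (k : nat) (S : 'M[R]_k) (x : 'cV[R]_k) :
  qform S x <= frob S * \sum_i x i 0 ^+ 2.
Proof.
have -> : qform S x = \sum_(q : 'I_k * 'I_k) S q.1 q.2 * (x q.1 0 * x q.2 0).
  rewrite /qform mxE -(pair_big xpredT xpredT (fun i j => S i j * (x i 0 * x j 0)))/=.
  rewrite exchange_big/=; apply: eq_bigr => j _; rewrite mxE mulr_suml.
  by apply: eq_bigr => i _; rewrite mxE; ring.
apply: (le_trans (sum_mul_le_sqrt _ _ _)).
rewrite /frob -(pair_big xpredT xpredT (fun i j => S i j ^+ 2))/=.
apply: ler_wpM2l; first exact: sqrtr_ge0.
rewrite -(pair_big xpredT xpredT (fun i j => (x i 0 * x j 0) ^+ 2))/=.
under eq_bigr do (under eq_bigr do rewrite exprMn; rewrite -mulr_sumr).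
rewrite -mulr_suml -expr2 sqrtr_sqr ger0_norm// sumr_ge0// => i _; exact: sqr_ge0.
Qed.

End quadratic_form_bound.

Section divergence_bound.
Context {R : realType} {D : set (CC R)} {p m n : nat}.
Hypotheses (D_compact : compact D) (D_disc : forall z, D z -> cabs z < 1).
Variable E : experiment D p m n.
Hypothesis n0 : (0 < n)%N.

Let h k := exn_g E k - exn_gs E k.
Let F z := exn_G E z - exn_Gs E z.

Let lam1 k : cabs (exn_lam E k) < 1. Proof. exact: D_disc (exn_lamD E k). Qed.
Let mu1 k : cabs (exn_mu E k) < 1. Proof. exact: D_disc ((exn_muP E).1 k). Qed.
Let D0 : D !=set0. Proof. exists (exn_lam E (Ordinal n0)); exact: exn_lamD. Qed.

Let tG i j : tame (fun z => exn_G E z i j). Proof. exact: partial_fractions_tame. Qed.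
Let tGs i j : tame (fun z => exn_Gs E z i j). Proof. exact: partial_fractions_tame. Qed.

Let tF i j : tame (fun z => F z i j).
Proof.
rewrite (_ : (fun z => _) = fun z => exn_G E z i j + exn_Gs E z i j * (-1)).
  by apply: tameD => //; exact: tameZ.
by apply/funext => z; rewrite !mxE mulrN1.
Qed.

Let hP : impulse_response F h.
Proof.
move=> z z1 i j; rewrite (_ : (fun K => _) = fun K : nat =>
    \sum_(k < K) z ^- k * toC (exn_g E k i j) - \sum_(k < K) z ^- k * toC (exn_gs E k i j)).
  by rewrite !mxE; apply: cvgB; [exact: exn_gP|exact: exn_gsP].
apply/funext => K; rewrite -sumrB; apply: eq_bigr => k _; rewrite -mulrBr; congr (_ * _).
by rewrite !mxE /toC; apply/eqP; rewrite eq_complex /= subr0 !eqxx.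
Qed.

(** Partial fractions vanish at infinity, so the models have no direct term: this is the relative
    degree that makes the loop strictly causal. *)
Let g_0 : exn_g E 0 = 0. Proof. exact: (matrix_impulse_response0 p m (exn_G E) (exn_g E) tG (@exn_gP _ _ _ _ _ E)). Qed.
Let gs_0 : exn_gs E 0 = 0. Proof. exact: (matrix_impulse_response0 p m (exn_Gs E) (exn_gs E) tGs (@exn_gsP _ _ _ _ _ E)). Qed.

Lemma spectral_radius_lt1 : 0 <= spectral_radius E < 1.
Proof.
apply/andP; split; last by apply: bigmax_lt => // j _; exact: lam1.
by apply: (le_trans (cabs_ge0 (exn_lam E (Ordinal n0)))); exact: le_bigmax.
Qed.

Lemma spectral_radius_le (rho : R) : 0 <= rho -> (forall z, D z -> cabs z <= rho) ->
  spectral_radius E <= rho.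
Proof.
by move=> r0 H; apply: bigmax_le => // j _; apply: H; exact: exn_lamD.
Qed.

Lemma surrogate_energy_le K : \sum_(k < K) frob (h k) ^+ 2 <=
  residue_sum E ^+ 2 * cheb n D ^+ (2 * n) / (1 - spectral_radius E ^+ 2).
Proof.
apply: (le_trans (matrix_impulse_energy_le _ _ F h tF hP K)).
rewrite mulnC exprM (cheb_pow _ D_disc D0 _ n0).
apply: (best_residues_le (exn_lam E) (exn_mu E) (exn_res E) (exn_sres E) (cheb_inf D n)
  (spectral_radius E) (@exn_lam_inj _ _ _ _ _ E) lam1 mu1 (exn_sresP E)
  spectral_radius_lt1) => k.
  exact: le_bigmax.
exact: (minimizer_le_cheb_inf D D_compact D_disc D0 n _ _ (exn_muP E) (exn_lamD E k)).
Qed.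

Let mu t i : measurable_fun setT (fun w => exn_u0 E t w i 0).
Proof.
have mr := measurable_record p m t.+1 (exn_gu E) (exn_noise E) (exn_exc E)
  (@exn_noise_meas _ _ _ _ _ E) (@exn_exc_meas _ _ _ _ _ E) (exn_g E) (exn_u0 E) (exn_y0 E) g_0 (@exn_data0 _ _ _ _ _ E).
have m1 : measurable_fun setT (input_record t.+1 (exn_u0 E)).
  exact: (measurableT_comp measurable_fst mr).
rewrite (_ : (fun w => _) =
  fun w => tnth (tnth (input_record t.+1 (exn_u0 E) w) ord_max) i); last first.
  by apply/funext => w; rewrite !tnth_mktuple.
by apply: measurable_tnth_comp; exact: measurable_tnth_comp.
Qed.

Let B : R := precision_norm E / 2 * (Phi_sup E *
  (residue_sum E ^+ 2 * cheb n D ^+ (2 * n) / (1 - spectral_radius E ^+ 2))).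

Let energy_term t :
  (\int[exn_P E]_w (qform (invmx (exn_cov E)) (conv h (fun s => exn_u0 E s w) t) / 2)%:E <= B%:E)%E.
Proof.
have mx i : measurable_fun setT (fun w => conv h (fun s => exn_u0 E s w) t i 0).
  exact: (msignal_conv h (exn_u0 E) mu t i).
have p0 : 0 <= precision_norm E / 2 by rewrite divr_ge0 ?sqrtr_ge0.
apply: (@le_trans _ _ (\int[exn_P E]_w ((precision_norm E / 2)%:E *
    (\sum_i conv h (fun s => exn_u0 E s w) t i 0 ^+ 2)%:E))%E).
  apply: ge0_le_integral => //.
  - by move=> w _; rewrite lee_fin divr_ge0// (qform_ge0 _ (exn_cov_pos E)).
  - by apply/measurable_EFinP; apply: measurable_funM => //; exact: measurable_qform.
  - apply/measurable_EFinP; apply: measurable_funM => //; apply: measurable_sum => i.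
    by apply: measurable_funX.
  - move=> w _; rewrite -EFinM lee_fin mulrAC ler_wpM2r//.
    exact: qform_le.
rewrite ge0_integralZl_EFin//; last 2 first.
- by move=> w _; rewrite lee_fin sumr_ge0// => i _; exact: sqr_ge0.
- apply/measurable_EFinP; apply: measurable_sum => i.
  by apply: measurable_funX.
rewrite /B [leRHS]EFinM; apply: lee_wpmul2l; first by rewrite lee_fin.
apply: (le_trans (expected_filtered_energy_le (exn_P E) p m (exn_u0 E) (exn_Phi E) h t
  mu (exn_stat E) (exn_PhiP E) (exn_Phi_bnd E))).
by rewrite lee_fin ler_wpM2l ?ess_sup_norm_ge0// surrogate_energy_le.
Qed.

Lemma expected_KL_bound : (expected_KL E <= (B * (exn_N E)%:R)%:E)%E.
Proof.
set N := exn_N E; set S := exn_cov E.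
have mR0 := measurable_record p m N (exn_gu E) (exn_noise E) (exn_exc E)
  (@exn_noise_meas _ _ _ _ _ E) (@exn_exc_meas _ _ _ _ _ E) (exn_g E) (exn_u0 E) (exn_y0 E) g_0 (@exn_data0 _ _ _ _ _ E).
have mR1 := measurable_record p m N (exn_gu E) (exn_noise E) (exn_exc E)
  (@exn_noise_meas _ _ _ _ _ E) (@exn_exc_meas _ _ _ _ _ E) (exn_gs E) (exn_u1 E) (exn_y1 E) gs_0 (@exn_data1 _ _ _ _ _ E).
have lossE := rec_loss_model (exn_P E) p m N S (exn_gu E) (exn_noise E) (exn_exc E) (exn_cov_pos E) (@exn_noise_meas _ _ _ _ _ E)
  (@exn_exc_meas _ _ _ _ _ E) (exn_noise_gauss E) (exn_noise_indep E) (exn_exc_indep E)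
  (exn_g E) (exn_u0 E) (exn_y0 E) g_0 (@exn_data0 _ _ _ _ _ E) (exn_gs E) gs_0.
have loss_fin := rec_loss_noise_lty (exn_P E) p m N S (exn_gu E) (exn_noise E) (exn_exc E) (exn_cov_pos E) (@exn_noise_meas _ _ _ _ _ E)
  (exn_noise_gauss E) (exn_g E) (exn_u0 E) (exn_y0 E) g_0 (@exn_data0 _ _ _ _ _ E).
have sum_le : (\sum_(t < N) \int[exn_P E]_w (qform (invmx S)
    (conv h (fun s => exn_u0 E s w) t.+1) / 2)%:E <= (B * N%:R)%:E)%E.
  apply: (@le_trans _ _ (\sum_(t < N) B%:E)%E); first by apply: lee_sum => t _; exact: energy_term.
  by rewrite sumEFin lee_fin sumr_const card_ord mulr_natr.
set a := rec_loss S (exn_gs E) in lossE.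
set b := rec_loss S (exn_g E) in lossE loss_fin.
have b0 z : 0 <= b z.
  by apply: sumr_ge0 => t _; rewrite divr_ge0// (qform_ge0 _ (exn_cov_pos E)).
have a0 z : 0 <= a z.
  by apply: sumr_ge0 => t _; rewrite divr_ge0// (qform_ge0 _ (exn_cov_pos E)).
have bfin : (\int[exn_P E]_w (b (input_record N (exn_u0 E) w, output_record N (exn_y0 E) w))%:E
    \is a fin_num)%E.
  by rewrite ge0_fin_numE// integral_ge0// => w _; rewrite lee_fin.
have := expected_KL_le (exn_P E) (input_record N (exn_u0 E)) (input_record N (exn_u1 E))
  (output_record N (exn_y0 E)) (output_record N (exn_y1 E)) (exn_P0 E) (exn_P1 E) a b
  (measurableT_comp measurable_fst mR0) (measurableT_comp measurable_fst mR1)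
  (measurableT_comp measurable_snd mR0) (measurableT_comp measurable_snd mR1)
  (exn_P0P E) (exn_P1P E) (measurable_rec_loss S (exn_gs E)) (measurable_rec_loss S (exn_g E))
  a0 b0 (countably_generated_tuple _ _ (countably_generated_tuple _ _ (countably_generated_R R)))
  (closed_loop_density (exn_P E) p m N S (exn_gu E) (exn_noise E) (exn_exc E) (exn_cov_pos E)
     (@exn_noise_meas _ _ _ _ _ E) (@exn_exc_meas _ _ _ _ _ E) (exn_noise_gauss E) (exn_noise_indep E)
     (exn_exc_indep E) (exn_g E) (exn_gs E) (exn_u0 E) (exn_u1 E) (exn_y0 E) (exn_y1 E)
     g_0 gs_0 (@exn_data0 _ _ _ _ _ E) (@exn_data1 _ _ _ _ _ E)).
rewrite lossE => KLle.
(* The expected loss of the true model is finite and cancels from both sides. *)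
apply: (le_trans _ sum_le); rewrite -(@leeD2lE _ _ _ _ bfin) addeC; apply: KLle => //.
rewrite lte_add_pinfty//; exact: le_lt_trans sum_le (ltry _).
Qed.

Lemma expected_KL_le_chebyshev :
  (expected_KL E <=
     (residue_sum E ^+ 2 * precision_norm E * Phi_sup E
        / (2 * (1 - spectral_radius E ^+ 2))
      * cheb n D ^+ (2 * n) * (exn_N E)%:R)%:E)%E.
Proof.
apply: (le_trans expected_KL_bound).
have /andP[r0 r1] := spectral_radius_lt1.
have rr : 1 - spectral_radius E ^+ 2 != 0 by rewrite gt_eqF// subr_gt0 expr_lt1.
rewrite lee_fin /B le_eqVlt; apply/orP; left; apply/eqP.
by field; rewrite rr.
Qed.

(** If the constant or the Chebyshev constant were 0, the divergence bound would be 0, below delta.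
    The positivity is recorded because it makes the quotients genuine. *)
Lemma sample_size_ge (delta : R) : 0 < delta -> (delta%:E <= expected_KL E)%E ->
  [/\ 0 < residue_sum E ^+ 2 * precision_norm E * Phi_sup E, 0 < cheb n D &
  2 * delta * (1 - spectral_radius E ^+ 2)
    / (residue_sum E ^+ 2 * precision_norm E * Phi_sup E)
  * cheb n D ^- (2 * n) <= (exn_N E)%:R].
Proof.
move=> d0 dle; have := le_trans dle expected_KL_le_chebyshev; rewrite lee_fin.
have /andP[r0 r1] := spectral_radius_lt1.
have rr : 0 < 1 - spectral_radius E ^+ 2 by rewrite subr_gt0 expr_lt1.
set K := _ * Phi_sup E; set C := cheb n D ^+ (2 * n).
have c0 : 0 <= cheb n D by exact: (cheb_ge0 D D_disc D0).
have K0 : 0 <= K.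
  by apply: mulr_ge0; [rewrite mulr_ge0 ?sqr_ge0 ?sqrtr_ge0|exact: ess_sup_norm_ge0].
have C0 : 0 <= C by rewrite exprn_ge0.
have [->|Kn] := eqVneq K 0; first by rewrite !mul0r leNgt d0.
have [->|Cn] := eqVneq C 0; first by rewrite mulr0 mul0r leNgt d0.
have Kp : 0 < K by rewrite lt_neqAle eq_sym Kn.
have Cp : 0 < C by rewrite lt_neqAle eq_sym Cn.
move=> hN; split=> //.
  rewrite lt_neqAle c0 andbT eq_sym; apply: contra Cn => /eqP c00.
  by rewrite /C c00 expr0n muln_eq0/= -[n == 0%N]negbK -lt0n n0.
rewrite -/C ler_pdivrMr// ler_pdivrMr//.
set x := 1 - spectral_radius E ^+ 2 in rr hN *.
have hE : K / (2 * x) * C * (exn_N E)%:R = (exn_N E)%:R * C * K / (2 * x).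
  by field; rewrite gt_eqF.
rewrite hE ler_pdivlMr ?mulr_gt0// in hN.
by apply: le_trans hN; rewrite mulrCA mulrA.
Qed.

End divergence_bound.

(** * Roots of the sample size *)

Section sample_growth.
Context {R : realType}.

Lemma cvg_root_cst (k : R) : 0 < k -> (fun n => k `^ (2 * n.+1)%:R^-1) @ \oo --> (1 : R).
Proof.
move=> k0; rewrite (_ : (fun n => _) = fun n => expR (2^-1 * ln k * harmonic n)).
  rewrite -[X in _ --> X](_ : expR (2^-1 * ln k * 0) = 1); last by rewrite mulr0 expR0.
  apply: (@continuous_cvg _ _ _ _ _ _ (@expR R)); first exact: continuous_expR.
  by apply: cvgMr; exact: cvg_harmonic.
by apply/funext => n; rewrite /powR gt_eqF// natrM invfM /harmonic/= mulrAC.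
Qed.

Lemma le_limn_einf (u : nat -> \bar R) (r : \bar R) :
  (\forall n \near \oo, (r <= u n)%E) -> (r <= limn_einf u)%E.
Proof.
move=> [n0 _ H]; rewrite limn_einf_lim.
have -> : limn (einfs u) = ereal_sup (range (einfs u)).
  by apply/cvg_lim => //; exact: cvg_einfs_sup.
apply: (@le_trans _ _ (einfs u n0)); last by apply: ereal_sup_ubound; exists n0.
by apply: le_ereal_inf_tmp => _ [k /= nk <-]; exact: H.
Qed.

(** The 2(n+1)-th root of the constant k tends to 1, so only the limit of c survives. *)
Lemma limn_einf_root_ge (c N : nat -> R) (k l : R) : 0 < k -> (forall n, 0 < c n) ->
  c @ \oo --> l -> (forall n, k * c n ^- (2 * n.+1) <= N n) ->
  (l%:E^-1 <= limn_einf (fun n => (N n `^ (2 * n.+1)%:R^-1)%:E))%E.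
Proof.
move=> k0 c0 cl H.
have l0 : 0 <= l.
  rewrite -(cvg_lim _ cl)//; apply: limr_ge; first by apply/cvg_ex; exists l.
  by apply: nearW => n; exact: ltW.
have root n : k `^ (2 * n.+1)%:R^-1 / c n <= N n `^ (2 * n.+1)%:R^-1.
  have m0 : (0 < 2 * n.+1)%N by [].
  have b0 : 0 <= k `^ (2 * n.+1)%:R^-1 / c n by rewrite divr_ge0 ?powR_ge0 ?ltW.
  have N0 : 0 <= N n.
    by apply: le_trans (H n); rewrite mulr_ge0 ?invr_ge0 ?exprn_ge0// ltW.
  rewrite -(@ler_pXn2r _ (2 * n.+1)) ?nnegrE ?powR_ge0// (root_powR _ m0)//.
  by rewrite expr_div_n (root_powR _ m0 _ (ltW k0)).
(* Writing r < 1/l as r l < 1 also covers l = 0, where every real r qualifies and the lower limit is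
   infinite. *)
have key r : r * l < 1 -> (r%:E <= limn_einf (fun n => (N n `^ (2 * n.+1)%:R^-1)%:E))%E.
  move=> rl; apply: le_limn_einf.
  pose q := (r * l + 1) / 2.
  have h1 : \forall n \near \oo, r * c n < q.
    have cv : (fun n => r * c n) @ \oo --> r * l by exact: cvgMr.
    by apply: (cvgr_lt _ cv); rewrite /q; lra.
  have h2 : \forall n \near \oo, q < k `^ (2 * n.+1)%:R^-1.
    by apply: (cvgr_gt _ (cvg_root_cst k k0)); rewrite /q; lra.
  near=> n; rewrite lee_fin; apply: le_trans (root n).
  rewrite ler_pdivlMr//; apply: ltW; apply: (@lt_trans _ _ q); near: n; [exact: h1|exact: h2].
have [l00|ln] := eqVneq l 0.
  rewrite l00 inve0 leye_eq; apply/eqP/eqyP => A A0; apply: key.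
  by rewrite l00 mulr0 ltr01.
have lp : 0 < l by rewrite lt_neqAle eq_sym ln.
rewrite inver (negbTE ln); apply/lee_subgt0Pr => e e0; rewrite -EFinB; apply: key.
by rewrite mulrBl mulVf// gtrBl mulr_gt0.
Unshelve. all: by end_near.
Qed.

End sample_growth.

Theorem theorem10 (R : realType) (D : set (CC R)) (p m : nat)
    (D_compact : compact D) (D_connected : connected D)
    (D_disc : forall z, D z -> cabs z < 1) :
  (forall (n : nat) (E : experiment D p m n), (0 < n)%N ->
     (expected_KL E <=
        (residue_sum E ^+ 2 * precision_norm E * Phi_sup E
           / (2 * (1 - spectral_radius E ^+ 2))
         * cheb n D ^+ (2 * n) * (exn_N E)%:R)%:E)%E
     /\
     (forall delta : R, 0 < delta -> (delta%:E <= expected_KL E)%E ->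
        2 * delta * (1 - spectral_radius E ^+ 2)
          / (residue_sum E ^+ 2 * precision_norm E * Phi_sup E)
        * cheb n D ^- (2 * n)
        <= (exn_N E)%:R))
  /\
  (forall (delta c : R) (E : forall n : nat, experiment D p m n.+1),
     0 < delta ->
     (forall n, [/\ residue_sum (E n) <= c, precision_norm (E n) <= c
                  & Phi_sup (E n) <= c]) ->
     (forall n, (delta%:E <= expected_KL (E n))%E) ->
     ((cheb_lim D)%:E^-1 <=
        limn_einf (fun n =>
          ((exn_N (E n))%:R `^ (2 * n.+1)%:R^-1)%:E))%E).
Proof.
split=> [n E n0|delta c E d0 Ec dE].
  split=> [|delta d0 dE]; first exact: expected_KL_le_chebyshev.
  by have [] := sample_size_ge D_compact D_disc E n0 _ d0 dE.
have D0 : D !=set0 by exists (exn_lam (E 0%N) ord0); exact: exn_lamD.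
(* The constant must not depend on n: the radius of D keeps all spectral radii uniformly below 1,
   and c^4 bounds the products of the other quantities. *)
have [rho /andP[rho0 rho1] Drho] := compact_disc_radius D D_compact D_disc D0.
have rr : 0 < 1 - rho ^+ 2 by rewrite subr_gt0 expr_lt1.
have ss n := sample_size_ge D_compact D_disc (E n) (ltn0Sn n) _ d0 (dE n).
have Kle n : residue_sum (E n) ^+ 2 * precision_norm (E n) * Phi_sup (E n) <= c ^+ 4.
  have [rc pc fc] := Ec n.
  have r0 : 0 <= residue_sum (E n) by apply: sumr_ge0 => j _; exact: sqrtr_ge0.
  have c0 : 0 <= c by exact: le_trans rc.
  rewrite (_ : c ^+ 4 = c ^+ 2 * c * c); last by rewrite -!exprSr.
  apply: ler_pM => //; [by rewrite mulr_ge0 ?sqr_ge0 ?sqrtr_ge0|exact: ess_sup_norm_ge0|].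
  apply: ler_pM => //; [exact: sqr_ge0|exact: sqrtr_ge0|].
  by rewrite ler_pXn2r ?nnegrE.
(* The constant of the first experiment is positive because its divergence is at least delta. *)
have c4 : 0 < c ^+ 4 by have [K0 _ _] := ss 0%N; exact: lt_le_trans (Kle 0%N).
apply: (@limn_einf_root_ge _ (fun n => cheb n.+1 D) _ (2 * delta * (1 - rho ^+ 2) / c ^+ 4)).
- by rewrite divr_gt0// !mulr_gt0.
- by move=> n; have [] := ss n.
- by rewrite (cvg_shiftS (fun n => cheb n D)); exact: cheb_cvg.
move=> n; have [K0 ch0] := ss n; apply: le_trans.
have le_rho : spectral_radius (E n) <= rho by exact: spectral_radius_le.
have /andP[s0 s1] := spectral_radius_lt1 D_disc (E n) (ltn0Sn n).
rewrite ler_wpM2r ?invr_ge0 ?exprn_ge0 ?(ltW ch0)//.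
apply: ler_pM.
- by rewrite !mulr_ge0 ?(ltW d0) ?(ltW rr).
- by rewrite invr_ge0 ltW.
- by rewrite ler_pM2l ?mulr_gt0// lerD2l lerN2 ler_pXn2r ?nnegrE.
- by rewrite lef_pV2 ?posrE.
Qed.
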